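(* Let $\mathbf{x}$ be a closed generalized equi-centro-affine extremal curve on a sphere of radius $R>0$ in $\mathbb{R}^3$, with constant $C_1$. Then one of the following holds: (1) $\mathbf{x}$ is a planar circle on the sphere; (2) $\mathbf{x}=\mathbf{x}_{p,q}$ is a curve whose curvature is a nonconstant periodic solution of $B_{ss}-2B^{-2}+R^{-2}B=\frac{C_1}{2}$, $B=\kappa_g^{-2/3}$, depending upon $(p,q)\in\mathbb{N}\times\mathbb{N}$, where the pair $(p,q)$ is not arbitrary and must be such that $p/q$ lies in the open interval $$\Big(\tfrac12,\ \tfrac{1}{2\pi}\lim_{\lambda\to D}\Lambda^\Theta\Big),$$ with $$\lim_{\lambda\to D}\Lambda^\Theta=\frac{12\pi}{\sqrt{Rd_0}}\Bigg(\frac1{2d_0+6r_0-RC_1}+\frac1{6r_0+4d_0+RC_1}+\frac{6d_0}{(6r_0+4d_0+RC_1)(6r_0-2d_0+RC_1)}\Bigg).$$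
   Context: A curve on the sphere of radius $R$ with nowhere vanishing geodesic curvature, oriented so that $\kappa_g>0$, with Euclidean arc length $s$, is a generalized equi-centro-affine extremal curve if $B=\kappa_g^{-2/3}$ satisfies $B_{ss}-2B^{-2}+R^{-2}B=\frac{C_1}2$ for a constant $C_1$; then $B_s^2=C_2-\frac{B^2}{R^2}-4B^{-1}+C_1B$ for an integration constant $C_2$. If $B$ is nonconstant, it is periodic and the field $\mathbf{J}=-2B^{-1/2}\mathbf{T}+B_s\boldsymbol\epsilon$ along the curve ($\mathbf T$ unit tangent, $\boldsymbol\epsilon$ unit normal in the sphere, $\nabla_{\mathbf T}\mathbf T=\kappa_g\boldsymbol\epsilon$) is the restriction of an infinitesimal rotation of the sphere about an axis; the progression angle $\Lambda^\Theta$ is the absolute change of the azimuthal angle about this axis along the curve over one period of $\kappa_g$. $\mathbf{x}_{p,q}$ denotes a curve that closes up after $q$ periods of its curvature while winding $p$ times about the axis, i.e. $q\Lambda^\Theta=2\pi p$, $p,q$ coprime positive integers. With $\mu=R^2C_1$, $\lambda=R^2C_2$, the number $D=D(R,C_1)$ is: if $\mu\ge-3(2R)^{2/3}$, $$D=\frac{-\mu^2-(Y_1^{1/3}+Y_2^{1/3})}{12},\quad Y_{1,2}=\mu^6+2160R^2\mu^3-93312R^4\pm48\sqrt3R\sqrt{(\mu^3+108R^2)^3}$$ (real cube roots); if $\mu\le-3(2R)^{2/3}$, $$D=\frac{-\mu^2}{12}+\frac{\sqrt{\mu(\mu^3-864R^2)}}6\cos\frac{\vartheta-\pi}3,\quad\vartheta=\arccos\frac{-\mu^6-2160R^2\mu^3+93312R^4}{\mu(864R^2-\mu^3)\sqrt{\mu(\mu^3-864R^2)}}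 .$$ Moreover $r_0=\sqrt{\frac{D}{R^2}+\frac{R^2C_1^2}{4}}$ and $d_0=\sqrt{\frac{3D}{R^2}+C_1^2R^2}$, and limits $\lambda\to D$ are from above with $R,C_1$ fixed. *)

(* Defs.v *)
From Stdlib Require Import Reals.
From Coquelicot Require Import Coquelicot.
Open Scope R_scope.

(* The vector space operations and the topology of [R3] are those of
   Coquelicot's product normed modules. *)
Notation R3 := (R * R * R)%type.

Definition crd1 (v : R3) : R := fst (fst v).
Definition crd2 (v : R3) : R := snd (fst v).
Definition crd3 (v : R3) : R := snd v.

Definition dot (v w : R3) : R :=
  crd1 v * crd1 w + crd2 v * crd2 w + crd3 v * crd3 w.

Definition cross (v w : R3) : R3 :=
  (crd2 v * crd3 w - crd3 v * crd2 w,
   crd3 v * crd1 w - crd1 v * crd3 w,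
   crd1 v * crd2 w - crd2 v * crd1 w).

Definition vDerive (x : R -> R3) (s : R) : R3 :=
  (Derive (fun t => crd1 (x t)) s,
   Derive (fun t => crd2 (x t)) s,
   Derive (fun t => crd3 (x t)) s).

Definition tangent (x : R -> R3) (s : R) : R3 := vDerive x s.

Definition normal (rad : R) (x : R -> R3) (s : R) : R3 :=
  scal (/ rad) (cross (x s) (tangent x s)).

(* Levi-Civita connection of the sphere: the component of the acceleration
   tangent to the sphere. *)
Definition nablaTT (rad : R) (x : R -> R3) (s : R) : R3 :=
  let a := vDerive (tangent x) s in
  minus a (scal (dot a (x s) / rad ^ 2) (x s)).

(* For unit speed curves [nablaTT] is [kappa_g] times [normal]. *)
Definition kappa_g (rad : R) (x : R -> R3) (s : R) : R :=
  dot (nablaTT rad x s) (normal rad x s).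

Definition Bfun (rad : R) (x : R -> R3) (s : R) : R :=
  Rpower (kappa_g rad x s) (- (2 / 3)).

Record spherical_curve (rad : R) (x : R -> R3) : Prop := {
  sc_on_sphere : forall s, dot (x s) (x s) = rad ^ 2;
  sc_ex_tangent : forall s, ex_derive x s;
  sc_arc_length : forall s, dot (tangent x s) (tangent x s) = 1;
  sc_ex_acceleration : forall s, ex_derive (tangent x) s
}.

(* Reversing [x] changes the sign of [kappa_g], so positivity is only a choice
   of orientation for a curve with nowhere vanishing geodesic curvature. *)
Record extremal (rad C1 : R) (x : R -> R3) : Prop := {
  ext_curve : spherical_curve rad x;
  ext_kappa_pos : forall s, 0 < kappa_g rad x s;
  ext_ex_Bs : forall s, ex_derive (Bfun rad x) s;
  ext_ex_Bss : forall s, ex_derive (Derive (Bfun rad x)) s;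
  ext_ode : forall s,
    Derive (Derive (Bfun rad x)) s - 2 * / (Bfun rad x s) ^ 2
      + / rad ^ 2 * Bfun rad x s = C1 / 2
}.

Definition first_integral (rad C1 C2 : R) (x : R -> R3) : Prop :=
  forall s,
    (Derive (Bfun rad x) s) ^ 2
    = C2 - (Bfun rad x s) ^ 2 / rad ^ 2 - 4 * / Bfun rad x s
      + C1 * Bfun rad x s.

Definition closed_curve (x : R -> R3) : Prop :=
  exists L, 0 < L /\ forall s, x (s + L) = x s.

Definition planar_circle (rad : R) (x : R -> R3) : Prop :=
  exists (n : R3) (h : R),
    dot n n = 1 /\ Rabs h < rad /\
    forall y : R3,
      (exists s, x s = y) <-> (dot y y = rad ^ 2 /\ dot n y = h).

Definition nonconstant (f : R -> R) : Prop := exists s t, f s <> f t.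

Definition periodic_with (f : R -> R) (rho : R) : Prop :=
  0 < rho /\ forall s, f (s + rho) = f s.

Definition least_period (f : R -> R) (rho : R) : Prop :=
  periodic_with f rho /\ forall r, periodic_with f r -> rho <= r.

Definition Jfield (rad : R) (x : R -> R3) (s : R) : R3 :=
  plus (scal (- 2 * Rpower (Bfun rad x s) (- (1 / 2))) (tangent x s))
       (scal (Derive (Bfun rad x) s) (normal rad x s)).

(* [(e1, e2, e3)] is a positively oriented orthonormal frame whose vector [e3]
   spans the axis of the infinitesimal rotation
   [y |-> cross (scal c e3) y] that restricts to [Jfield] along [x]. *)
Definition axis_frame (rad : R) (x : R -> R3) (e1 e2 e3 : R3) : Prop :=
  dot e1 e1 = 1 /\ dot e2 e2 = 1 /\ dot e1 e2 = 0 /\ cross e1 e2 = e3 /\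
  exists c, 0 < c /\ forall s, Jfield rad x s = cross (scal c e3) (x s).

(* A continuous determination of the azimuth of [x] about the axis
   orthogonal to [e1] and [e2]. *)
Definition azimuth (x : R -> R3) (e1 e2 : R3) (theta : R -> R) : Prop :=
  (forall s, continuous theta s) /\
  forall s, exists r, 0 < r /\
    dot (x s) e1 = r * cos (theta s) /\ dot (x s) e2 = r * sin (theta s).

Definition progression_angle (rad : R) (x : R -> R3) (a : R) : Prop :=
  exists (e1 e2 e3 : R3) (theta : R -> R) (rho : R),
    axis_frame rad x e1 e2 e3 /\ azimuth x e1 e2 theta /\
    least_period (kappa_g rad x) rho /\
    forall s, a = Rabs (theta (s + rho) - theta s).

Definition is_x_pq (rad : R) (x : R -> R3) (p q : nat) : Prop :=
  (0 < p)%nat /\ (0 < q)%nat /\ Nat.gcd p q = 1%nat /\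
  exists rho a,
    least_period (kappa_g rad x) rho /\ progression_angle rad x a /\
    (forall s, x (s + INR q * rho) = x s) /\
    INR q * a = 2 * PI * INR p.

(* The progression angle as a function of [lam = rad^2 * C2], for fixed [rad]
   and [C1]: the angle shared by all extremal curves with these constants
   ([iota P] is the unique element satisfying [P]). *)
Definition Lambda (rad C1 lam : R) : R :=
  iota (fun a : R =>
    exists x, extremal rad C1 x /\ first_integral rad C1 (lam / rad ^ 2) x /\
      progression_angle rad x a).

(* Real cube root; [Rpower] is only meaningful on positive bases. *)
Definition cbrt (y : R) : R :=
  match total_order_T y 0 with
  | inleft (left _) => - Rpower (- y) (1 / 3)
  | inleft (right _) => 0
  | inright _ => Rpower y (1 / 3)
  end.

Definition Dcubic (rad mu : R) : R :=
  let m := mu ^ 6 + 2160 * rad ^ 2 * mu ^ 3 - 93312 * rad ^ 4 in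
  let d := 48 * sqrt 3 * rad * sqrt ((mu ^ 3 + 108 * rad ^ 2) ^ 3) in
  (- mu ^ 2 - (cbrt (m + d) + cbrt (m - d))) / 12.

Definition Dtrig (rad mu : R) : R :=
  let vartheta :=
    acos ((- mu ^ 6 - 2160 * rad ^ 2 * mu ^ 3 + 93312 * rad ^ 4)
          / (mu * (864 * rad ^ 2 - mu ^ 3)
             * sqrt (mu * (mu ^ 3 - 864 * rad ^ 2)))) in
  - mu ^ 2 / 12
  + sqrt (mu * (mu ^ 3 - 864 * rad ^ 2)) / 6 * cos ((vartheta - PI) / 3).

(* At the threshold both expressions have the same value. *)
Definition Dvalue (rad C1 : R) : R :=
  let mu := rad ^ 2 * C1 in
  if Rle_dec (- 3 * Rpower (2 * rad) (2 / 3)) mu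
  then Dcubic rad mu else Dtrig rad mu.

Definition r0 (rad C1 : R) : R :=
  sqrt (Dvalue rad C1 / rad ^ 2 + rad ^ 2 * C1 ^ 2 / 4).

Definition d0 (rad C1 : R) : R :=
  sqrt (3 * Dvalue rad C1 / rad ^ 2 + C1 ^ 2 * rad ^ 2).

Definition limit_angle (rad C1 : R) : R :=
  let r := r0 rad C1 in
  let d := d0 rad C1 in
  12 * PI / sqrt (rad * d)
  * (1 / (2 * d + 6 * r - rad * C1)
     + 1 / (6 * r + 4 * d + rad * C1)
     + 6 * d / ((6 * r + 4 * d + rad * C1) * (6 * r - 2 * d + rad * C1))).

(* Main.v *)
Require Import Defs.
From Stdlib Require Import Reals.
From Coquelicot Require Import Coquelicot.
From Stdlib Require Import Lra Lia Psatz Classical.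
Open Scope R_scope.

(* With lam = rad^2 C2 and mu = rad^2 C1 the first integral reads
   rad^2 B B_s^2 = B (lam + mu B - B^2) - 4 rad^2, a cubic with roots
   - k^2 < 0 < mid - amp < mid + amp.  The substitution
   B = mid - amp cos phi turns it into the regular equation
   phi_s = speed (phi), so nonconstant solutions exist, are unique up to a
   shift of s, and have the period in which phi grows by 2 PI.  The vector
   w = (C1/2 - B/rad^2) x/rad - B_s/rad T - 2 B^(-1/2)/rad eps is constant and
   J is the cross product of w and x, so the azimuth about w is known and the
   progression angle is the integral over [0, 2 PI] of
     rad (1/(B - B1) + 1/(B2 - B)) / sqrt (B + k^2),
   B1 = p^2 - k^2 and B2 = q^2 - k^2 being the roots of lam + mu B - B^2.

   In these parameters p q k = 2 rad and the integrals of 1/(B - B1),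
   1/(B2 - B) and 1/(B + k^2) are elementary.  Bounding sqrt (B + k^2) by q in
   the second summand gives an angle > PI.  Cauchy-Schwarz applied to each
   summand gives an algebraic upper bound; it is below the limit angle
   2 PI sqrt ((b^3 + rad^2)/(b^3 + 4 rad^2)), where b is the double root that
   the cubic has at lam = D, because after normalisation the difference
   becomes a polynomial with positive coefficients. *)

(** Both estimates are pointwise in lam. The strict inequality between the angle and its limit gives
    the right end of the interval and also the upper half of the limit; the lower half comes from a
    cruder bound that is continuous up to lam = D. Cauchy-Schwarz fits because it loses nothing when
    B is constant: with t = b/(p q) - 1, which vanishes in that case, the algebraic comparison is an
    equality at t = 0, and any loss there would spoil the sharp endpoint. At fixed C1 the number b
    does not depend on lam, so it is the natural coordinate for everything evaluated at D: mu = 2 b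
    - 4 rad^2/b^2 and D = - b^2 + 8 rad^2/b are rational in b, and both closed forms of D are
    verified by substitution instead of being derived. Passing to the phase phi removes two
    obstacles at the turning points of B: the first-order equation there lets constant solutions be
    glued to nonconstant ones, and the angle integral taken over B would be improper. *)

(** * The algebraic comparison *)

(* [comparison_normalized] with the square roots removed by squaring and the
   denominators cleared. *)
Lemma comparison_polynomial_pos (t N : R) : 0 < t -> 0 < N ->
  let b := 1 + t in
  let M := b ^ 3 + N in
  let Y := N * (N * (2 * b ^ 2 - 1) + 2 * b ^ 2 * t) in
  let Z := Y + b ^ 2 * (1 + 2 * N) in
  (M ^ 2 * (Y + 2 * b ^ 2) - ((2 * b ^ 3 - N) ^ 2 - 2 * M ^ 2) * Z) ^ 2
  < (8 * M - 6 * N) ^ 2 * M ^ 2 * Y * Z.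
Proof.
intros ht hN b M Y Z.
apply Rlt_0_minus; unfold Z, Y, M, b.
(* The difference vanishes at [t = 0]. Expanded in [t] and [N] it has only positive coefficients, so
   positivity is checked monomial by monomial. *)
ring_simplify.
repeat (apply Rplus_lt_0_compat || apply Rmult_lt_0_compat || apply pow_lt); lra.
Qed.

(* [b], [N], [y], [De] stand for the double root, [k ^ 2], [(q - p) * k] and
   [disc p q k], each divided by [p * q]. *)
Lemma comparison_normalized (t N : R) : 0 < t -> 0 < N ->
  let b := 1 + t in
  let Y := N * (N * (2 * b ^ 2 - 1) + 2 * b ^ 2 * t) / b ^ 2 in
  let y := sqrt Y in
  let De := sqrt (Y + 1 + 2 * N) in
  0 <= 1 + Y + N - y * De /\
  2 * sqrt (1 + Y + N - y * De) < (2 - 3 * (N / (b ^ 3 + N))) * De + y.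
Proof.
intros ht hN b Y y De.
assert (hb : 1 < b) by (unfold b; lra).
assert (hb2 : 1 < b ^ 2) by nra.
assert (hb3 : 1 < b ^ 3) by nra.
assert (hYN : N ^ 2 < Y).
{ assert (E : Y - N ^ 2 = N * (N * (b ^ 2 - 1) + 2 * b ^ 2 * t) / b ^ 2)
    by (unfold Y; field; lra).
  assert (0 < Y - N ^ 2); [|lra].
  rewrite E; apply Rdiv_lt_0_compat; [|lra].
  apply Rmult_lt_0_compat; [lra|]. nra. }
assert (hY : 0 < Y) by nra.
assert (Ey : y ^ 2 = Y) by (unfold y; rewrite pow2_sqrt; lra).
assert (EDe : De ^ 2 = Y + 1 + 2 * N) by (unfold De; rewrite pow2_sqrt; lra).
assert (hy : 0 < y) by (apply sqrt_lt_R0; lra).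
assert (hDe : 0 < De) by (apply sqrt_lt_R0; lra).
assert (hyN : N < y) by nra.
(* Squared, this is [N ^ 2 <= Y] multiplied by [1 + 2 * N]. *)
assert (hNDe : N * De <= (N + 1) * y).
{ apply Rsqr_incr_0_var; unfold Rsqr; nra. }
set (tau := N / (b ^ 3 + N)).
assert (htau : tau * (b ^ 3 + N) = N) by (unfold tau; field; lra).
assert (htau0 : 0 < tau) by (apply Rdiv_lt_0_compat; lra).
assert (htau1 : tau * (1 + N) < N) by nra.
(* Squaring needs this sign. As [tau < N / (N + 1)], the factor [2 - 3 * tau] exceeds
   [(2 - N) / (N + 1)]; for [N > 2] this is negative, and [hNDe] lets [y] compensate. *)
assert (hZ : 0 < (2 - 3 * tau) * De + y).
{ assert (h : 0 < (N + 1) * N * ((2 - 3 * tau) * De + y)).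
  { replace ((N + 1) * N * ((2 - 3 * tau) * De + y))
      with (3 * (N - tau * (1 + N)) * (N * De) + (2 - N) * (N * De) + N * (N + 1) * y) by ring.
    assert (0 < (N - tau * (1 + N)) * (N * De)) by (apply Rmult_lt_0_compat; nra).
    destruct (Rle_lt_dec N 2); nra. }
  apply Rmult_lt_reg_l with ((N + 1) * N); nra. }
(* The radicand is quadratic in [De] and [y], so after one squaring the only irrational term is
   [y * De]; a second squaring, in [hsq], removes it. *)
assert (hX : 4 * (1 + Y + N - y * De) = 2 * (De - y) ^ 2 + 2).
{ replace (2 * (De - y) ^ 2 + 2) with (2 * De ^ 2 + 2 * y ^ 2 - 4 * (y * De) + 2) by ring.
  rewrite EDe, Ey; ring. }
assert (hX0 : 0 < 1 + Y + N - y * De) by (assert (0 <= (De - y) ^ 2) by apply pow2_ge_0; lra).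
split; [lra|].
assert (key : 2 * (De - y) ^ 2 + 2 < ((2 - 3 * tau) * De + y) ^ 2).
{ apply Rlt_0_minus.
  replace (((2 - 3 * tau) * De + y) ^ 2 - (2 * (De - y) ^ 2 + 2))
    with ((8 - 6 * tau) * (y * De) - (y ^ 2 + 2 - ((2 - 3 * tau) ^ 2 - 2) * De ^ 2)) by ring.
  rewrite Ey, EDe.
  assert (htau1' : tau < 1) by nra.
  assert (h : 0 < (8 - 6 * tau) * (y * De)) by (apply Rmult_lt_0_compat; nra).
  assert (hsq : (Y + 2 - ((2 - 3 * tau) ^ 2 - 2) * (Y + 1 + 2 * N)) ^ 2
                < ((8 - 6 * tau) * (y * De)) ^ 2).
  { replace (((8 - 6 * tau) * (y * De)) ^ 2) with ((8 - 6 * tau) ^ 2 * (y ^ 2 * De ^ 2)) by ring.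
    rewrite Ey, EDe.
    generalize (comparison_polynomial_pos t N ht hN); cbv zeta; fold b; intros P.
    apply Rmult_lt_reg_r with ((b ^ 3 + N) ^ 4 * (b ^ 2) ^ 2).
    { apply Rmult_lt_0_compat; apply pow_lt; nra. }
    match type of P with ?l < ?r =>
      replace ((Y + 2 - ((2 - 3 * tau) ^ 2 - 2) * (Y + 1 + 2 * N)) ^ 2 * ((b ^ 3 + N) ^ 4 * (b ^ 2) ^ 2)) with l;
      [replace ((8 - 6 * tau) ^ 2 * (Y * (Y + 1 + 2 * N)) * ((b ^ 3 + N) ^ 4 * (b ^ 2) ^ 2)) with r; [exact P|]|]
    end; unfold Y, tau; field; repeat split; nra. }
  apply Rnot_le_lt; intros hc. nra. }
set (s := sqrt _).
assert (hs : 0 <= s) by apply sqrt_pos.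
assert (hs2 : s ^ 2 = 1 + Y + N - y * De) by (unfold s; rewrite pow2_sqrt; lra).
apply Rnot_le_lt; intros hc; nra.
Qed.

(** * The angle integral and its bounds *)

Lemma sin2_cos2_pow (x : R) : sin x ^ 2 + cos x ^ 2 = 1.
Proof. rewrite <- (sin2_cos2 x); unfold Rsqr; ring. Qed.

Lemma ex_RInt_cont (f : R -> R) (a b : R) : (forall t, continuous f t) -> ex_RInt f a b.
Proof. intros h; apply (@ex_RInt_continuous R_CompleteNormedModule); intros; apply h. Qed.

Lemma continuous_of_ex_derive (f : R -> R) (t : R) : ex_derive f t -> continuous f t.
Proof. apply (@ex_derive_continuous R_AbsRing R_NormedModule). Qed.

Lemma add_mul_cos_pos (a b t : R) : 0 < a -> b ^ 2 < a ^ 2 -> 0 < a + b * cos t.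
Proof.
intros ha hb.
assert (hc := COS_bound t).
assert (h : (b * cos t) ^ 2 <= b ^ 2) 
  by (assert (cos t ^ 2 <= 1) by nra; assert (0 <= b ^ 2) by apply pow2_ge_0; nra).
set (u := b * cos t) in *.
apply Rnot_le_lt; intros hneg; nra.
Qed.

(* The usual tangent half-angle primitive jumps at odd multiples of [PI];
   the one used here is smooth on the whole line. *)
Lemma is_RInt_inv_add_mul_cos (a b : R) : 0 < a -> b ^ 2 < a ^ 2 ->
  is_RInt (fun t => / (a + b * cos t)) 0 (2 * PI) (2 * PI / sqrt (a ^ 2 - b ^ 2)).
Proof.
intros ha hb.
set (s := sqrt (a ^ 2 - b ^ 2)).
assert (hs : 0 < s) by (apply sqrt_lt_R0; lra).
assert (hs2 : s ^ 2 = a ^ 2 - b ^ 2) by (unfold s; rewrite pow2_sqrt; lra).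
(* The arctangent is the argument of [a + s + b e^(it)], whose real part stays positive. It is
   periodic, so over a full turn only the term [t / s] contributes. *)
set (H := fun t => (t - 2 * atan (b * sin t / (a + s + b * cos t))) / s).
assert (E : 2 * PI / s = minus (H (2 * PI)) (H 0)).
{ unfold H, minus, plus, opp; simpl. rewrite sin_2PI, sin_0, Rmult_0_r.
  unfold Rdiv; rewrite !Rmult_0_l, atan_0; ring. }
rewrite E.
assert (hpos := fun t => add_mul_cos_pos a b t ha hb).
apply (@is_RInt_derive R_CompleteNormedModule).
- intros t _; unfold H.
  assert (h := hpos t).
  auto_derive; [lra|].
  assert (h1 : 0 < (a + s + b * cos t) ^ 2 + (b * sin t) ^ 2).
  { assert (0 < a + s + b * cos t) by lra. nra. }
  assert (hsc := sin2_cos2_pow t).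
  assert (hD : (a + s + b * cos t) ^ 2 + (b * sin t) ^ 2 = 2 * (a + s) * (a + b * cos t)).
  { replace ((b * sin t) ^ 2) with (b ^ 2 * (1 - cos t ^ 2)) by (rewrite <- hsc; ring). nra. }
  transitivity ((1 - 2 * ((b * cos t * (a + s) + b ^ 2) / ((a + s + b * cos t) ^ 2 + (b * sin t) ^ 2))) / s).
  { replace (b * cos t * (a + s) + b ^ 2)
      with (b * cos t * (a + s + b * cos t) + b * sin t * (b * sin t))
      by (replace (b ^ 2) with (b ^ 2 * (sin t ^ 2 + cos t ^ 2)) by (rewrite hsc; ring); ring).
    field; repeat split; nra. }
  rewrite hD.
  replace (b ^ 2) with ((a - s) * (a + s)) by (rewrite <- (Rplus_0_r (b ^ 2)); nra).
  field; repeat split; nra.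
- intros t _. apply continuous_of_ex_derive.
  auto_derive. generalize (hpos t); lra.
Qed.

(* The cubic of the first integral has roots [- k ^ 2] and [mid - amp], [mid + amp],
   whose product is [(p * q) ^ 2]. *)
Definition mid (p q k : R) : R := (p ^ 2 + q ^ 2 - k ^ 2) / 2.
Definition amp (p q k : R) : R := sqrt (mid p q k ^ 2 - (p * q) ^ 2).
Definition prof (p q k t : R) : R := mid p q k - amp p q k * cos t.

Definition angle_density (p q k t : R) : R :=
  p * q * k / 2 * (/ (prof p q k t - (p ^ 2 - k ^ 2)) + / (q ^ 2 - k ^ 2 - prof p q k t))
  / sqrt (prof p q k t + k ^ 2).

Definition angle (p q k : R) : R := RInt (angle_density p q k) 0 (2 * PI).

(** This is the geometric mean of the distances of the two positive roots of the cubic from its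
    negative root [- k ^ 2]. *)
Definition disc (p q k : R) : R := sqrt ((p * q) ^ 2 + k ^ 2 * (p ^ 2 + q ^ 2)).

(** The condition [p + k < q] amounts to [p * q < mid p q k]: it keeps the two positive roots
    [mid - amp] and [mid + amp] apart, which merge when [q = p + k]. *)
Record admissible (p q k : R) : Prop := {
  adm_p : 0 < p; adm_k : 0 < k; adm_q : p + k < q }.

Section Bounds.
Context (p q k : R) (H : admissible p q k).

Let hp : 0 < p := adm_p _ _ _ H.
Let hk : 0 < k := adm_k _ _ _ H.
Let hq : p + k < q := adm_q _ _ _ H.

Lemma mid_gt : p * q < mid p q k.
Proof. unfold mid; nra. Qed.

Lemma amp_pos : 0 < amp p q k.
Proof. apply sqrt_lt_R0. assert (h := mid_gt). assert (0 < p * q) by nra. nra. Qed.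

Lemma amp_sq : amp p q k ^ 2 = mid p q k ^ 2 - (p * q) ^ 2.
Proof.
unfold amp; rewrite pow2_sqrt; [reflexivity|].
assert (h := mid_gt). assert (0 < p * q) by nra. nra.
Qed.

Lemma amp_lt_mid : amp p q k < mid p q k.
Proof.
assert (h := amp_sq). assert (h' := mid_gt). assert (0 < p * q) by nra.
assert (h2 := amp_pos). nra.
Qed.

Lemma prof_bounds t : mid p q k - amp p q k <= prof p q k t <= mid p q k + amp p q k.
Proof. assert (h := COS_bound t). assert (h2 := amp_pos). unfold prof; nra. Qed.

Lemma prof_pos t : 0 < prof p q k t.
Proof. generalize (prof_bounds t) amp_lt_mid; lra. Qed.

(** The base on the right is the distance of [mid] from the pole [p ^ 2 - k ^ 2]. That its square
    exceeds [amp ^ 2] by a perfect square is what the parameters [p], [q], [k] achieve: the integral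
    of the reciprocal then contains no radical. *)
Lemma amp_lt_lower : amp p q k ^ 2 + (q * k) ^ 2 = ((q ^ 2 - p ^ 2 + k ^ 2) / 2) ^ 2.
Proof. rewrite amp_sq; unfold mid; field. Qed.

Lemma amp_lt_upper : amp p q k ^ 2 + (p * k) ^ 2 = ((q ^ 2 - p ^ 2 - k ^ 2) / 2) ^ 2.
Proof. rewrite amp_sq; unfold mid; field. Qed.

Lemma disc_sq : disc p q k ^ 2 = (p * q) ^ 2 + k ^ 2 * (p ^ 2 + q ^ 2).
Proof. unfold disc; apply pow2_sqrt; nra. Qed.

Lemma disc_pos : 0 < disc p q k.
Proof.
apply sqrt_lt_R0. assert (0 < (p * q) ^ 2) by (apply pow_lt; nra). nra.
Qed.

Lemma amp_lt_root : amp p q k ^ 2 + disc p q k ^ 2 = ((p ^ 2 + q ^ 2 + k ^ 2) / 2) ^ 2.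
Proof. rewrite amp_sq, disc_sq; unfold mid; field. Qed.

Lemma prof_gt_lower t : 0 < prof p q k t - (p ^ 2 - k ^ 2).
Proof.
assert (0 < q * k) by nra.
generalize (add_mul_cos_pos ((q ^ 2 - p ^ 2 + k ^ 2) / 2) (- amp p q k) t); intros h.
assert (h' := amp_lt_lower). unfold prof, mid.
assert (0 < (q ^ 2 - p ^ 2 + k ^ 2) / 2) by nra. assert (0 < (q * k) ^ 2) by nra.
specialize (h ltac:(lra)). specialize (h ltac:(lra)). lra.
Qed.

Lemma prof_lt_upper t : 0 < q ^ 2 - k ^ 2 - prof p q k t.
Proof.
assert (0 < p * k) by nra.
generalize (add_mul_cos_pos ((q ^ 2 - p ^ 2 - k ^ 2) / 2) (amp p q k) t); intros h.
assert (h' := amp_lt_upper). unfold prof, mid.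
assert (0 < (q ^ 2 - p ^ 2 - k ^ 2) / 2) by nra. assert (0 < (p * k) ^ 2) by nra.
specialize (h ltac:(lra)). specialize (h ltac:(lra)). lra.
Qed.

Lemma prof_root_pos t : 0 < prof p q k t + k ^ 2.
Proof. generalize (prof_pos t); nra. Qed.

Lemma is_RInt_lower :
  is_RInt (fun t => / (prof p q k t - (p ^ 2 - k ^ 2))) 0 (2 * PI) (2 * PI / (q * k)).
Proof.
assert (0 < q * k) by nra. assert (0 < (q * k) ^ 2) by nra.
assert (h := amp_lt_lower).
replace (q * k) with (sqrt (((q ^ 2 - p ^ 2 + k ^ 2) / 2) ^ 2 - (- amp p q k) ^ 2)).
2:{ replace (((q ^ 2 - p ^ 2 + k ^ 2) / 2) ^ 2 - (- amp p q k) ^ 2) with ((q * k) ^ 2) by lra.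
    apply sqrt_pow2; lra. }
eapply is_RInt_ext; [|apply is_RInt_inv_add_mul_cos].
- intros t _; simpl. f_equal; unfold prof, mid; field.
- nra.
- lra.
Qed.

Lemma is_RInt_upper :
  is_RInt (fun t => / (q ^ 2 - k ^ 2 - prof p q k t)) 0 (2 * PI) (2 * PI / (p * k)).
Proof.
assert (0 < p * k) by nra. assert (0 < (p * k) ^ 2) by nra.
assert (h := amp_lt_upper).
replace (p * k) with (sqrt (((q ^ 2 - p ^ 2 - k ^ 2) / 2) ^ 2 - (amp p q k) ^ 2)).
2:{ replace (((q ^ 2 - p ^ 2 - k ^ 2) / 2) ^ 2 - (amp p q k) ^ 2) with ((p * k) ^ 2) by lra.
    apply sqrt_pow2; lra. }
eapply is_RInt_ext; [|apply is_RInt_inv_add_mul_cos].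
- intros t _; simpl. f_equal; unfold prof, mid; field.
- nra.
- lra.
Qed.

Lemma is_RInt_root :
  is_RInt (fun t => / (prof p q k t + k ^ 2)) 0 (2 * PI) (2 * PI / disc p q k).
Proof.
assert (h0 := disc_pos). assert (0 < disc p q k ^ 2) by nra.
assert (h := amp_lt_root).
replace (disc p q k) with (sqrt (((p ^ 2 + q ^ 2 + k ^ 2) / 2) ^ 2 - (- amp p q k) ^ 2)).
2:{ replace (((p ^ 2 + q ^ 2 + k ^ 2) / 2) ^ 2 - (- amp p q k) ^ 2) with (disc p q k ^ 2) by lra.
    apply sqrt_pow2; lra. }
eapply is_RInt_ext; [|apply is_RInt_inv_add_mul_cos].
- intros t _; simpl. f_equal; unfold prof, mid; field.
- nra.
- lra.
Qed.

Lemma ex_derive_prof t : ex_derive (prof p q k) t.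
Proof. unfold prof; auto_derive; auto. Qed.

Lemma ex_derive_angle_density t : ex_derive (angle_density p q k) t.
Proof.
assert (h1 := prof_gt_lower t). assert (h2 := prof_lt_upper t). assert (h3 := prof_root_pos t).
unfold angle_density. auto_derive.
assert (sqrt (prof p q k t + k ^ 2) <> 0) by (apply Rgt_not_eq, sqrt_lt_R0; lra).
replace (k * (k * 1)) with (k ^ 2) by ring.
replace (p * (p * 1)) with (p ^ 2) by ring.
replace (q * (q * 1)) with (q ^ 2) by ring.
repeat split; try lra; auto using ex_derive_prof.
Qed.

Lemma continuous_angle_density t : continuous (angle_density p q k) t.
Proof. apply continuous_of_ex_derive, ex_derive_angle_density. Qed.

Lemma is_RInt_sum_density :
  is_RInt (fun t => p * q * k / 2 * (/ (prof p q k t - (p ^ 2 - k ^ 2)) + / (q ^ 2 - k ^ 2 - prof p q k t)))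
    0 (2 * PI) (PI * (p + q)).
Proof.
replace (PI * (p + q)) with (scal (p * q * k / 2) (plus (2 * PI / (q * k)) (2 * PI / (p * k)))).
2:{ unfold scal, plus; simpl; unfold mult; simpl. field; repeat split; nra. }
apply (is_RInt_scal (V := R_NormedModule)).
apply (is_RInt_plus (V := R_NormedModule)); [apply is_RInt_lower|apply is_RInt_upper].
Qed.

(** The radicand is replaced by its maximum, after which the integral is elementary. The loss tends
    to zero with [amp], so this bound yields the lower half of the limit at D. *)
Lemma angle_lower_continuous :
  PI * (p + q) / sqrt (mid p q k + amp p q k + k ^ 2) <= angle p q k.
Proof.
assert (hm : 0 < mid p q k + amp p q k + k ^ 2)
  by (generalize amp_lt_mid amp_pos (pow2_ge_0 k); lra).
set (S := sqrt _).
assert (hS : 0 < S) by (apply sqrt_lt_R0; lra).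
assert (hI : is_RInt (fun t => scal (/ S) (p * q * k / 2 * (/ (prof p q k t - (p ^ 2 - k ^ 2))
               + / (q ^ 2 - k ^ 2 - prof p q k t)))) 0 (2 * PI) (PI * (p + q) / S)).
{ replace (PI * (p + q) / S) with (scal (/ S) (PI * (p + q)))
    by (unfold scal; simpl; unfold mult; simpl; field; lra).
  apply (is_RInt_scal (V := R_NormedModule)), is_RInt_sum_density. }
rewrite <- (is_RInt_unique _ _ _ _ hI).
apply RInt_le.
- generalize PI_RGT_0; lra.
- eexists; apply hI.
- apply ex_RInt_cont, continuous_angle_density.
- intros t _. unfold scal; simpl; unfold mult; simpl.
  assert (h1 := prof_gt_lower t). assert (h2 := prof_lt_upper t). assert (h3 := prof_root_pos t).
  unfold angle_density, Rdiv. simpl in *. rewrite (Rmult_comm (/ S)).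
  apply Rmult_le_compat_l.
  { apply Rmult_le_pos; [assert (0 < p * q) by nra; nra|].
    apply Rplus_le_le_0_compat; left; apply Rinv_0_lt_compat; lra. }
  apply Rinv_le_contravar; [apply sqrt_lt_R0; lra|].
  apply sqrt_le_1_alt. generalize (prof_bounds t); simpl; lra.
Qed.

(* Only the pole at [q ^ 2 - k ^ 2] is kept: bounding [sqrt (prof + k ^ 2)] by
   its value [q] at that pole makes the remaining integral exactly [PI]. *)
Lemma angle_gt_PI : PI < angle p q k.
Proof.
assert (hI : is_RInt (fun t => scal (p * k / 2) (/ (q ^ 2 - k ^ 2 - prof p q k t))) 0 (2 * PI) PI).
{ replace PI with (scal (p * k / 2) (2 * PI / (p * k))) at 2
    by (unfold scal; simpl; unfold mult; simpl; field; nra).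
  apply (is_RInt_scal (V := R_NormedModule)), is_RInt_upper. }
rewrite <- (is_RInt_unique _ _ _ _ hI).
apply RInt_lt.
- generalize PI_RGT_0; lra.
- intros; apply continuous_angle_density.
- intros t _. apply continuous_of_ex_derive. unfold scal; simpl; unfold mult; simpl.
  generalize (prof_lt_upper t) (ex_derive_prof t); intros.
  auto_derive; simpl in *; split; auto; lra.
- intros t _. unfold scal; simpl; unfold mult; simpl. unfold angle_density.
  assert (h1 := prof_gt_lower t). assert (h2 := prof_lt_upper t). assert (h3 := prof_root_pos t).
  set (S := sqrt _).
  assert (hS : 0 < S) by (apply sqrt_lt_R0; lra).
  assert (hSq : S < q).
  { rewrite <- (sqrt_pow2 q) by nra. apply sqrt_lt_1_alt. lra. }
  simpl in *.
  set (u := / (_ - _ - prof p q k t)). set (v := / (prof p q k t - _)).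
  assert (hu : 0 < u) by (apply Rinv_0_lt_compat; lra).
  assert (hv : 0 < v) by (apply Rinv_0_lt_compat; lra).
  apply Rmult_lt_reg_r with S; [lra|].
  replace (p * q * k / 2 * (v + u) / S * S) with (p * q * k / 2 * (v + u)) by (field; lra).
  assert (0 < p * k) by nra.
  apply Rlt_trans with (p * k / 2 * u * q); [apply Rmult_lt_compat_l; [nra|lra]|].
  assert (0 < p * q * k / 2 * v); [|nra].
  assert (0 < p * q) by nra. apply Rmult_lt_0_compat; nra.
Qed.

End Bounds.

(** Cauchy-Schwarz for the functions [1] and [1 / sqrt h] with weight [w]. It follows from the
    pointwise inequality between arithmetic and geometric means, with coefficients tuned to the two
    integrals [X] and [Z] so that integrating gives exactly [sqrt (X * Z)]. *)
Lemma RInt_div_sqrt_le (w h : R -> R) (X Z : R) :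
  (forall t, continuous w t) -> (forall t, continuous h t) ->
  (forall t, 0 < w t) -> (forall t, 0 < h t) ->
  is_RInt w 0 (2 * PI) X -> is_RInt (fun t => w t / h t) 0 (2 * PI) Z ->
  RInt (fun t => w t / sqrt (h t)) 0 (2 * PI) <= sqrt (X * Z).
Proof.
intros cw ch pw ph hX hZ.
assert (hpi := PI_RGT_0).
assert (cwh : forall t, continuous (fun t => w t / h t) t).
{ intros t. apply (continuous_mult w (fun t => / h t)); [apply cw|].
  apply (continuous_comp h Rinv); [apply ch|].
  apply continuous_of_ex_derive. auto_derive. apply Rgt_not_eq, ph. }
assert (X0 : 0 < X).
{ rewrite <- (is_RInt_unique _ _ _ _ hX); apply RInt_gt_0; auto; lra. }
assert (Z0 : 0 < Z).
{ rewrite <- (is_RInt_unique _ _ _ _ hZ); apply RInt_gt_0; auto; [lra|].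
  intros; apply Rdiv_lt_0_compat; auto. }
assert (sX : 0 < sqrt X) by (apply sqrt_lt_R0; lra).
assert (sZ : 0 < sqrt Z) by (apply sqrt_lt_R0; lra).
assert (eX : sqrt X * sqrt X = X) by (apply sqrt_sqrt; lra).
assert (eZ : sqrt Z * sqrt Z = Z) by (apply sqrt_sqrt; lra).
rewrite sqrt_mult by lra.
assert (hI : is_RInt (fun t => plus (scal (sqrt Z / sqrt X / 2) (w t)) (scal (sqrt X / sqrt Z / 2) (w t / h t)))
   0 (2 * PI) (sqrt X * sqrt Z)).
{ replace (sqrt X * sqrt Z) with (plus (scal (sqrt Z / sqrt X / 2) X) (scal (sqrt X / sqrt Z / 2) Z)).
  2:{ unfold plus, scal; simpl; unfold mult; simpl.
      rewrite <- eX at 2. rewrite <- eZ at 3. field; lra. }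
  apply (is_RInt_plus (V := R_NormedModule)); apply (is_RInt_scal (V := R_NormedModule)); assumption. }
rewrite <- (is_RInt_unique _ _ _ _ hI).
apply RInt_le.
- lra.
- apply ex_RInt_cont. intros t.
  apply (continuous_mult w (fun t => / sqrt (h t))); [apply cw|].
  apply (continuous_comp h (fun v => / sqrt v)); [apply ch|].
  apply continuous_of_ex_derive. assert (hh := ph t).
  auto_derive. split; [assumption|]. split; [|trivial].
  apply Rgt_not_eq, sqrt_lt_R0; assumption.
- eexists; apply hI.
- intros t _. unfold plus, scal; simpl; unfold mult; simpl.
  assert (hh := ph t). assert (hw := pw t).
  assert (sh : 0 < sqrt (h t)) by (apply sqrt_lt_R0; lra).
  assert (eh : sqrt (h t) * sqrt (h t) = h t) by (apply sqrt_sqrt; lra).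
  rewrite <- eh at 2. set (a := sqrt (h t)) in *. set (x := sqrt X) in *. set (z := sqrt Z) in *.
  apply Rminus_le_0.
  replace (z / x / 2 * w t + x / z / 2 * (w t / (a * a)) - w t / a)
    with (w t * (a * z - x) ^ 2 / (2 * x * z * (a * a))) by (field; lra).
  apply Rmult_le_pos; [apply Rmult_le_pos; [lra|apply pow2_ge_0]|].
  left; apply Rinv_0_lt_compat. repeat apply Rmult_lt_0_compat; lra.
Qed.

(** * Upper bound of the angle and comparison with the limit value *)

Section Upper.
Context (p q k : R) (H : admissible p q k).

Let hp : 0 < p := adm_p _ _ _ H.
Let hk : 0 < k := adm_k _ _ _ H.
Let hq : p + k < q := adm_q _ _ _ H.

Lemma disc_gt_lower : q * k < disc p q k.
Proof.
assert (h := disc_sq p q k). assert (h0 := disc_pos p q k H).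
assert (0 < q * k) by nra. assert (0 < p * q) by nra. assert (0 < p * k) by nra. nra.
Qed.

Lemma angle_upper :
  angle p q k <= PI * (sqrt (1 - q * k / disc p q k) + sqrt (1 + p * k / disc p q k)).
Proof.
assert (hpi := PI_RGT_0).
assert (h0 := disc_pos p q k H). assert (h1 := disc_gt_lower).
set (D := disc p q k) in *.
assert (cp : forall t, continuous (fun t => prof p q k t + k ^ 2) t).
{ intros t; apply continuous_of_ex_derive. unfold prof; auto_derive; auto. }
assert (cl : forall t, continuous (fun t => / (prof p q k t - (p ^ 2 - k ^ 2))) t).
{ intros t; apply continuous_of_ex_derive. generalize (prof_gt_lower p q k H t); unfold prof.
  intros; auto_derive; simpl in *; lra. }
assert (cu : forall t, continuous (fun t => / (q ^ 2 - k ^ 2 - prof p q k t)) t).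
{ intros t; apply continuous_of_ex_derive. generalize (prof_lt_upper p q k H t); unfold prof.
  intros; auto_derive; simpl in *; lra. }
assert (hr := prof_root_pos p q k H).
assert (hl : forall t, 0 < / (prof p q k t - (p ^ 2 - k ^ 2)))
  by (intros; apply Rinv_0_lt_compat, prof_gt_lower, H).
assert (hu : forall t, 0 < / (q ^ 2 - k ^ 2 - prof p q k t))
  by (intros; apply Rinv_0_lt_compat, prof_lt_upper, H).
assert (Il := is_RInt_lower p q k H). assert (Iu := is_RInt_upper p q k H).
assert (Ir := is_RInt_root p q k H). fold D in Ir.
(* Partial fractions: [prof + k ^ 2] exceeds the first denominator by the constant [p ^ 2]. In [Ju]
   the two denominators add up to [q ^ 2], whence the plus sign. *)
assert (Jl : is_RInt (fun t => / (prof p q k t - (p ^ 2 - k ^ 2)) / (prof p q k t + k ^ 2)) 0 (2 * PI)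
   (scal (/ p ^ 2) (minus (2 * PI / (q * k)) (2 * PI / D)))).
{ eapply is_RInt_ext.
  2:{ apply (is_RInt_scal (V := R_NormedModule)), (is_RInt_minus (V := R_NormedModule)); eassumption. }
  intros t _. unfold scal, minus, plus, opp; simpl; unfold mult; simpl.
  generalize (prof_gt_lower p q k H t) (hr t); simpl; intros.
  field. repeat split; nra. }
assert (Ju : is_RInt (fun t => / (q ^ 2 - k ^ 2 - prof p q k t) / (prof p q k t + k ^ 2)) 0 (2 * PI)
   (scal (/ q ^ 2) (plus (2 * PI / (p * k)) (2 * PI / D)))).
{ eapply is_RInt_ext.
  2:{ apply (is_RInt_scal (V := R_NormedModule)), (is_RInt_plus (V := R_NormedModule)); eassumption. }
  intros t _. unfold scal, minus, plus, opp; simpl; unfold mult; simpl.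
  generalize (prof_lt_upper p q k H t) (hr t); simpl; intros.
  field. repeat split; nra. }
assert (Bl := RInt_div_sqrt_le _ _ _ _ cl cp hl hr Il Jl).
assert (Bu := RInt_div_sqrt_le _ _ _ _ cu cp hu hr Iu Ju).
assert (El : sqrt (2 * PI / (q * k) * scal (/ p ^ 2) (minus (2 * PI / (q * k)) (2 * PI / D)))
   = 2 * PI / (p * q * k) * sqrt (1 - q * k / D)).
{ replace (2 * PI / (q * k) * scal (/ p ^ 2) (minus (2 * PI / (q * k)) (2 * PI / D)))
    with ((2 * PI / (p * q * k)) ^ 2 * (1 - q * k / D)).
  2:{ unfold scal, minus, plus, opp; simpl; unfold mult; simpl. field; repeat split; nra. }
  rewrite sqrt_mult_alt by apply pow2_ge_0. rewrite sqrt_pow2; [reflexivity|].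
  left; apply Rdiv_lt_0_compat; [lra|]. repeat apply Rmult_lt_0_compat; lra. }
assert (Eu : sqrt (2 * PI / (p * k) * scal (/ q ^ 2) (plus (2 * PI / (p * k)) (2 * PI / D)))
   = 2 * PI / (p * q * k) * sqrt (1 + p * k / D)).
{ replace (2 * PI / (p * k) * scal (/ q ^ 2) (plus (2 * PI / (p * k)) (2 * PI / D)))
    with ((2 * PI / (p * q * k)) ^ 2 * (1 + p * k / D)).
  2:{ unfold scal, minus, plus, opp; simpl; unfold mult; simpl. field; repeat split; nra. }
  rewrite sqrt_mult_alt by apply pow2_ge_0. rewrite sqrt_pow2; [reflexivity|].
  left; apply Rdiv_lt_0_compat; [lra|]. repeat apply Rmult_lt_0_compat; lra. }
rewrite El in Bl. rewrite Eu in Bu.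
assert (cdiv : forall w : R -> R, (forall t, continuous w t) ->
   forall t, continuous (fun t => w t / sqrt (prof p q k t + k ^ 2)) t).
{ intros w cw t. apply (continuous_mult w (fun t => / sqrt (prof p q k t + k ^ 2))); [apply cw|].
  apply (continuous_comp (fun t => prof p q k t + k ^ 2) (fun v => / sqrt v)); [apply cp|].
  apply continuous_of_ex_derive. assert (hh := hr t).
  auto_derive. split; [assumption|]. split; [|trivial].
  apply Rgt_not_eq, sqrt_lt_R0; assumption. }
assert (Esum : is_RInt (angle_density p q k) 0 (2 * PI)
   (scal (p * q * k / 2) (plus (RInt (fun t => / (prof p q k t - (p ^ 2 - k ^ 2)) / sqrt (prof p q k t + k ^ 2)) 0 (2 * PI))
     (RInt (fun t => / (q ^ 2 - k ^ 2 - prof p q k t) / sqrt (prof p q k t + k ^ 2)) 0 (2 * PI))))).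
{ eapply is_RInt_ext.
  2:{ apply (is_RInt_scal (V := R_NormedModule)), (is_RInt_plus (V := R_NormedModule));
      apply (RInt_correct (V := R_CompleteNormedModule)), ex_RInt_cont, cdiv; assumption. }
  intros t _. unfold scal, plus; simpl; unfold mult; simpl. unfold angle_density. simpl. unfold Rdiv; ring. }
unfold angle. rewrite (is_RInt_unique _ _ _ _ Esum). unfold scal, plus; simpl; unfold mult; simpl.
simpl in Bl, Bu.
assert (hR : 0 < p * q * k / 2) by (assert (0 < p * q) by nra; nra).
match goal with |- ?a * (?b + ?c) <= _ => apply Rle_trans with (a * (2 * PI / (p * q * k) * sqrt (1 - q * k / D) + 2 * PI / (p * q * k) * sqrt (1 + p * k / D))) end.
- apply Rmult_le_compat_l; [lra|]. apply Rplus_le_compat; assumption.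
- right; field. repeat split; nra.
Qed.

(** With [p q k = 2 rad] the hypothesis on [b] says that [b] is the double root belonging to the
    same mu. Division of all lengths by the appropriate power of [p * q] then turns the square of
    [angle_upper] into [comparison_normalized]. *)
Lemma angle_lt_limit (b : R) : 0 < b ->
  2 * b - (p * q * k) ^ 2 / b ^ 2 = p ^ 2 + q ^ 2 - 2 * k ^ 2 ->
  angle p q k < 2 * PI * sqrt ((b ^ 3 + (p * q * k) ^ 2 / 4) / (b ^ 3 + (p * q * k) ^ 2)).
Proof.
intros hb eb.
assert (hpi := PI_RGT_0).
apply Rle_lt_trans with (1 := angle_upper).
assert (h0 := disc_pos p q k H). assert (h1 := disc_gt_lower). assert (h2 := disc_sq p q k).
set (D := disc p q k) in *.
set (g := p * q). assert (hg : 0 < g) by (unfold g; nra).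
assert (hgb : g < b).
(* The expression [2 b - (g k)^2 / b^2] increases with [b] and equals [2 g - k^2] at [b = g], which
   is smaller than [p^2 + q^2 - 2 k^2] because [k < q - p]. *)
{ apply Rnot_le_lt; intros hc.
  assert (k ^ 2 <= (p * q * k) ^ 2 / b ^ 2).
  { apply Rmult_le_reg_r with (b ^ 2); [nra|].
    replace ((p * q * k) ^ 2 / b ^ 2 * b ^ 2) with (k ^ 2 * g ^ 2) by (unfold g; field; lra).
    apply Rmult_le_compat_l; [nra|]. apply pow_incr; lra. }
  assert (2 * b <= 2 * (p * q)) by (fold g; lra).
  assert (0 < (q - p - k) * (q - p + k)) by (apply Rmult_lt_0_compat; lra).
  nra. }
set (t := b / g - 1). set (N := k ^ 2 / g).
assert (ht : 0 < t).
{ unfold t. apply Rlt_0_minus. apply Rmult_lt_reg_r with g; [lra|]. unfold Rdiv; rewrite Rmult_assoc, Rinv_l; lra. }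
assert (hN : 0 < N) by (apply Rdiv_lt_0_compat; nra).
destruct (comparison_normalized t N ht hN) as [c1 c2].
assert (eb1 : 1 + t = b / g) by (unfold t; ring).
assert (eY : N * (N * (2 * (1 + t) ^ 2 - 1) + 2 * (1 + t) ^ 2 * t) / (1 + t) ^ 2 = ((q - p) * k / g) ^ 2).
{ rewrite eb1.
  transitivity (k ^ 2 * (2 * b - (p * q * k) ^ 2 / b ^ 2 + 2 * k ^ 2 - 2 * g) / g ^ 2).
  - unfold N, t, g. field. repeat split; nra.
  - rewrite eb. unfold g. field. nra. }
rewrite eY in c1, c2.
assert (ey : sqrt (((q - p) * k / g) ^ 2) = (q - p) * k / g).
{ apply sqrt_pow2. left; apply Rdiv_lt_0_compat; nra. }
rewrite ey in c1, c2.
assert (eD : sqrt (((q - p) * k / g) ^ 2 + 1 + 2 * N) = D / g).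
{ replace (((q - p) * k / g) ^ 2 + 1 + 2 * N) with ((D / g) ^ 2).
  - apply sqrt_pow2. left; apply Rdiv_lt_0_compat; lra.
  - replace ((D / g) ^ 2) with (D ^ 2 / g ^ 2) by (field; lra). rewrite h2. unfold N, g; field; nra. }
rewrite eD in c1, c2.
set (X := 1 + ((q - p) * k / g) ^ 2 + N - (q - p) * k / g * (D / g)) in *.
assert (hq1 : 0 <= 1 - q * k / D).
{ apply Rlt_le, Rlt_0_minus. apply Rmult_lt_reg_r with D; [lra|]. unfold Rdiv; rewrite Rmult_assoc, Rinv_l; lra. }
assert (hp1 : 0 <= 1 + p * k / D).
{ assert (0 < p * k / D) by (apply Rdiv_lt_0_compat; nra). lra. }
(* By [disc_sq] the mixed term of the square of the sum is the single radical that
   [comparison_normalized] controls. *)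
assert (eprod : sqrt (1 - q * k / D) * sqrt (1 + p * k / D) = sqrt X * (g / D)).
{ rewrite <- sqrt_mult by assumption.
  rewrite <- (sqrt_pow2 (g / D)) by (left; apply Rdiv_lt_0_compat; lra).
  rewrite <- sqrt_mult by (try apply pow2_ge_0; assumption). f_equal.
  unfold X.
  transitivity ((D ^ 2 - (q - p) * k * D - p * q * k ^ 2) / D ^ 2); [field; lra|].
  transitivity ((g ^ 2 + ((q - p) * k) ^ 2 + k ^ 2 * g - (q - p) * k * D) / D ^ 2).
  - unfold Rdiv; f_equal; rewrite h2; unfold g; ring.
  - unfold N. field; lra. }
set (V := sqrt (1 - q * k / D) + sqrt (1 + p * k / D)).
assert (hV : V ^ 2 < 4 * ((b ^ 3 + (p * q * k) ^ 2 / 4) / (b ^ 3 + (p * q * k) ^ 2))).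
{ unfold V.
  replace ((sqrt (1 - q * k / D) + sqrt (1 + p * k / D)) ^ 2)
    with (sqrt (1 - q * k / D) ^ 2 + sqrt (1 + p * k / D) ^ 2 + 2 * (sqrt (1 - q * k / D) * sqrt (1 + p * k / D))) by ring.
  rewrite eprod, !pow2_sqrt by assumption.
  replace (4 * ((b ^ 3 + (p * q * k) ^ 2 / 4) / (b ^ 3 + (p * q * k) ^ 2))) with (4 - 3 * (N / ((1 + t) ^ 3 + N))).
  2:{ rewrite eb1. unfold N, g. assert (0 < b ^ 3) by (apply pow_lt; lra).
      assert (0 <= (p * q * k) ^ 2) by apply pow2_ge_0.
      field. assert (0 < p * q) by nra. assert (0 < (p * q) ^ 2) by nra. assert (0 < k ^ 2) by nra.
      repeat split; try nra; simpl in *; nra. }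
  apply Rmult_lt_reg_r with (D / g); [apply Rdiv_lt_0_compat; lra|].
  replace ((1 - q * k / D + (1 + p * k / D) + 2 * (sqrt X * (g / D))) * (D / g))
    with (2 * (D / g) - (q - p) * k / g + 2 * sqrt X) by (field; lra).
  lra. }
set (T := (b ^ 3 + (p * q * k) ^ 2 / 4) / (b ^ 3 + (p * q * k) ^ 2)) in *.
assert (hV0 : 0 <= V) by (apply Rplus_le_le_0_compat; apply sqrt_pos).
assert (hVT : V < 2 * sqrt T).
{ assert (hT : 0 < T) by (assert (0 <= V ^ 2) by apply pow2_ge_0; lra).
  assert (hs := sqrt_lt_R0 T hT). assert (es : sqrt T ^ 2 = T) by (apply pow2_sqrt; lra). nra. }
rewrite (Rmult_comm 2 PI), Rmult_assoc; apply Rmult_lt_compat_l; assumption.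
Qed.

End Upper.

(** * Cardano: the values of D and of the limit angle *)

(** The equation is the cubic [2 b^3 - mu b^2 - e = 0], negative at [0] and positive far out. With
    [e = 4 rad^2] it makes [b] available as a parameter for every value of [C1]. *)
Lemma exists_double_root (e mu : R) : 0 < e -> exists b, 0 < b /\ mu = 2 * b - e / b ^ 2.
Proof.
intros he.
set (f := fun b => 2 * b ^ 3 - mu * b ^ 2 - e).
set (M := 1 + Rabs mu + e).
assert (ha := Rle_abs mu). assert (ha' := Rabs_pos mu).
assert (hM : 1 < M) by (unfold M; lra).
assert (f0 : f 0 < 0) by (unfold f; nra).
assert (fM : 0 < f M).
{ unfold f. assert (h1 : M ^ 2 * (M - mu) > 0) by (apply Rmult_lt_0_compat; [nra|unfold M; lra]).
  assert (h2 : e < M) by (unfold M; lra). assert (M < M ^ 3) by (assert (1 < M ^ 2) by nra; nra). nra. }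
destruct (IVT_gen f 0 M 0) as [b [hb fb]].
- unfold f; reg.
- rewrite Rmin_left, Rmax_right; lra.
- rewrite Rmin_left, Rmax_right in hb by lra.
  assert (b <> 0) by (intros E; rewrite E in fb; lra).
  exists b; split; [lra|]. unfold f in fb.
  apply Rmult_eq_reg_r with (b ^ 2); [|apply pow_nonzero; assumption].
  replace ((2 * b - e / b ^ 2) * b ^ 2) with (2 * b ^ 3 - e) by (field; assumption). lra.
Qed.

Lemma Rpower_third_cube (u : R) : 0 < u -> Rpower (u ^ 3) (1 / 3) = u.
Proof.
intros hu. rewrite <- Rpower_pow, Rpower_mult by assumption.
replace (INR 3 * (1 / 3)) with 1 by (simpl; field). apply Rpower_1; assumption.
Qed.

Lemma cbrt_cube (u : R) : cbrt (u ^ 3) = u.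
Proof.
unfold cbrt. destruct (total_order_T (u ^ 3) 0) as [[h|h]|h].
- assert (u < 0) by (apply Rnot_le_lt; intros hc; assert (0 <= u ^ 3) by (apply pow_le; lra); lra).
  replace (- u ^ 3) with ((- u) ^ 3) by ring. rewrite Rpower_third_cube; lra.
- destruct (Req_dec u 0) as [E|E]; [lra|]. exfalso; apply (pow_nonzero u 3 E h).
- assert (0 < u).
  { apply Rnot_le_lt; intros hc. assert (0 <= (- u) ^ 3) by (apply pow_le; lra).
    replace ((- u) ^ 3) with (- u ^ 3) in * by ring. lra. }
  apply Rpower_third_cube; assumption.
Qed.

Lemma cos_triple (a : R) : cos (3 * a) = 4 * cos a ^ 3 - 3 * cos a.
Proof.
replace (3 * a) with (2 * a + a) by ring.
rewrite cos_plus, sin_2a, cos_2a_cos.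
assert (h := sin2_cos2 a). unfold Rsqr in h.
replace (2 * sin a * cos a * sin a) with (2 * cos a * (sin a * sin a)) by ring.
replace (sin a * sin a) with (1 - cos a * cos a) by lra. ring.
Qed.

(** The range of [X] selects the branch: it gives [acos X <= PI / 3], so [PI - 3 acos X] lies in
    [[0, PI]] and is therefore [acos c]. *)
Lemma cos_third_acos (c X : R) : 1 / 2 <= X <= 1 -> 4 * X ^ 3 - 3 * X = - c ->
  cos ((acos c - PI) / 3) = X.
Proof.
intros hX hc.
assert (hpi := PI_RGT_0).
set (a := acos X).
assert (ha := acos_bound X). fold a in ha.
assert (ea : cos a = X) by (apply cos_acos; lra).
assert (ha3 : a <= PI / 3).
{ apply Rnot_lt_le; intros h. assert (hd := cos_decreasing_1 (PI / 3) a).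
  rewrite cos_PI3 in hd. specialize (hd ltac:(lra) ltac:(lra) ltac:(lra) ltac:(lra) h). lra. }
assert (ec : c = cos (PI - 3 * a)).
{ rewrite Rtrigo_facts.cos_pi_minus, cos_triple, ea; lra. }
rewrite ec, acos_cos by lra.
replace ((PI - 3 * a - PI) / 3) with (- a) by field. rewrite cos_neg; exact ea.
Qed.

(** Cubing is increasing and sends the power [Rpower (2 * rad) (2 / 3)] to [4 * rad ^ 2], so the
    case distinction becomes polynomial in mu. *)
Lemma threshold_cube (rad mu : R) : 0 < rad ->
  (- 3 * Rpower (2 * rad) (2 / 3) <= mu <-> - 108 * rad ^ 2 <= mu ^ 3).
Proof.
intros hr.
set (r := Rpower (2 * rad) (2 / 3)).
assert (hr0 : 0 < r) by apply exp_pos.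
assert (er : r ^ 3 = 4 * rad ^ 2).
{ unfold r. rewrite <- Rpower_pow, Rpower_mult by apply exp_pos.
  replace (2 / 3 * INR 3) with (INR 2) by (simpl; field).
  rewrite Rpower_pow by lra. ring. }
assert (e : mu ^ 3 + 108 * rad ^ 2 = (mu + 3 * r) * (mu ^ 2 - 3 * r * mu + 9 * r ^ 2)).
{ replace (108 * rad ^ 2) with (27 * (4 * rad ^ 2)) by ring. rewrite <- er; ring. }
assert (h : 0 < mu ^ 2 - 3 * r * mu + 9 * r ^ 2).
{ replace (mu ^ 2 - 3 * r * mu + 9 * r ^ 2) with ((mu - 3 / 2 * r) ^ 2 + 27 / 4 * r ^ 2) by field.
  assert (0 <= (mu - 3 / 2 * r) ^ 2) by apply pow2_ge_0. nra. }
split; intros; nra.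
Qed.

(* Here [z1 + z2 = S] and [z1 z2 = (S ^ 2 - ka ^ 2) / 4] for the two cube roots
   [z1], [z2], and [12 D + mu ^ 2 = - S]. *)
Lemma Dvalue_double_root (rad C1 b : R) : 0 < rad -> 0 < b ->
  rad ^ 2 * C1 = 2 * b - 4 * rad ^ 2 / b ^ 2 ->
  Dvalue rad C1 = - b ^ 2 + 8 * rad ^ 2 / b.
Proof.
intros hr hb emu. unfold Dvalue. cbv zeta. set (mu := rad ^ 2 * C1) in *.
set (S := 8 * b ^ 2 - 80 * rad ^ 2 / b - 16 * rad ^ 4 / b ^ 4).
assert (eD : (- mu ^ 2 - S) / 12 = - b ^ 2 + 8 * rad ^ 2 / b) by (rewrite emu; unfold S; field; lra).
assert (hb3 : 0 < b ^ 3) by (apply pow_lt; lra).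
assert (hr2 : 0 < rad ^ 2) by (apply pow_lt; lra).
(* The sign of this quantity is that of [8 * b ^ 3 - 4 * rad ^ 2], so [b] decides which closed form
   applies. In the first case [w], the root of the latter, makes the outer radicand of [Dcubic] a
   perfect square. *)
assert (e3 : mu ^ 3 + 108 * rad ^ 2 = (b ^ 3 + 4 * rad ^ 2) ^ 2 * (8 * b ^ 3 - 4 * rad ^ 2) / b ^ 6)
  by (rewrite emu; field; lra).
assert (hpos : 0 < (b ^ 3 + 4 * rad ^ 2) ^ 2 / b ^ 6).
{ apply Rdiv_lt_0_compat; apply pow_lt; lra. }
destruct (Rle_dec _ mu) as [h|h]; rewrite threshold_cube in h by assumption.
- rewrite <- eD. unfold Dcubic. f_equal. f_equal. f_equal.
  assert (hw : 0 <= 8 * b ^ 3 - 4 * rad ^ 2).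
  { replace ((b ^ 3 + 4 * rad ^ 2) ^ 2 * (8 * b ^ 3 - 4 * rad ^ 2) / b ^ 6)
      with ((b ^ 3 + 4 * rad ^ 2) ^ 2 / b ^ 6 * (8 * b ^ 3 - 4 * rad ^ 2)) in e3 by (field; lra). nra. }
  set (w := sqrt (8 * b ^ 3 - 4 * rad ^ 2)).
  assert (ew : w ^ 2 = 8 * b ^ 3 - 4 * rad ^ 2) by (apply pow2_sqrt; assumption).
  assert (hw0 : 0 <= w) by apply sqrt_pos.
  assert (es : sqrt ((mu ^ 3 + 108 * rad ^ 2) ^ 3) = ((b ^ 3 + 4 * rad ^ 2) * w / b ^ 3) ^ 3).
  { rewrite <- (sqrt_pow2 (((b ^ 3 + 4 * rad ^ 2) * w / b ^ 3) ^ 3)).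
    - f_equal. rewrite e3, <- ew. field; lra.
    - apply pow_le. apply Rmult_le_pos; [apply Rmult_le_pos; lra|left; apply Rinv_0_lt_compat; lra]. }
  rewrite es.
  (* The difference of the two cube roots, which are thus [(S + ka) / 2] and [(S - ka) / 2]. *)
  set (ka := 2 * rad * sqrt 3 * w ^ 3 / b ^ 4).
  assert (e33 : sqrt 3 ^ 2 = 3) by (apply pow2_sqrt; lra).
  assert (eka : ka ^ 2 = 12 * rad ^ 2 * (8 * b ^ 3 - 4 * rad ^ 2) ^ 3 / b ^ 8).
  { rewrite <- ew. replace 12 with (4 * 3) by ring. rewrite <- e33. unfold ka; field; lra. }
  assert (em : mu ^ 6 + 2160 * rad ^ 2 * mu ^ 3 - 93312 * rad ^ 4 = (S ^ 3 + 3 * S * ka ^ 2) / 8).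
  { rewrite eka, emu. unfold S. field; lra. }
  assert (ed : 48 * sqrt 3 * rad * ((b ^ 3 + 4 * rad ^ 2) * w / b ^ 3) ^ 3 = ka * (3 * S ^ 2 + ka ^ 2) / 8).
  { rewrite eka. unfold S, ka. field; lra. }
  rewrite em, ed.
  replace ((S ^ 3 + 3 * S * ka ^ 2) / 8 + ka * (3 * S ^ 2 + ka ^ 2) / 8) with (((S + ka) / 2) ^ 3) by field.
  replace ((S ^ 3 + 3 * S * ka ^ 2) / 8 - ka * (3 * S ^ 2 + ka ^ 2) / 8) with (((S - ka) / 2) ^ 3) by field.
  rewrite !cbrt_cube. field.
- assert (hw : 8 * b ^ 3 - 4 * rad ^ 2 < 0).
  { replace ((b ^ 3 + 4 * rad ^ 2) ^ 2 * (8 * b ^ 3 - 4 * rad ^ 2) / b ^ 6)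
      with ((b ^ 3 + 4 * rad ^ 2) ^ 2 / b ^ 6 * (8 * b ^ 3 - 4 * rad ^ 2)) in e3 by (field; lra).
    apply Rnot_le_lt in h. nra. }
  assert (hmu : mu < 0).
  { apply Rnot_le_lt in h. apply Rnot_le_lt; intros hc.
    assert (0 <= mu ^ 3) by (apply pow_le; lra). lra. }
  unfold Dtrig.
  set (Pi3 := mu * (mu ^ 3 - 864 * rad ^ 2)).
  assert (hPi : 0 < Pi3).
  { unfold Pi3. assert (0 <= (- mu) ^ 3) by (apply pow_le; lra).
    replace ((- mu) ^ 3) with (- mu ^ 3) in * by ring. nra. }
  set (r := sqrt Pi3).
  assert (hr0 : 0 < r) by (apply sqrt_lt_R0; assumption).
  assert (er : r ^ 2 = Pi3) by (apply pow2_sqrt; lra).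
  replace (mu * (864 * rad ^ 2 - mu ^ 3)) with (- r ^ 2) by (rewrite er; unfold Pi3; ring).
  assert (hS : S < 0).
  { unfold S. replace (8 * b ^ 2) with ((8 * b ^ 3) / b) by (field; lra).
    replace (8 * b ^ 3 / b - 80 * rad ^ 2 / b - 16 * rad ^ 4 / b ^ 4)
      with (- ((80 * rad ^ 2 - 8 * b ^ 3) / b + 16 * rad ^ 4 / b ^ 4)) by (field; lra).
    assert (0 < (80 * rad ^ 2 - 8 * b ^ 3) / b) by (apply Rdiv_lt_0_compat; lra).
    assert (0 < 16 * rad ^ 4 / b ^ 4) by (apply Rdiv_lt_0_compat; [apply Rmult_lt_0_compat; [lra|]|]; apply pow_lt; lra).
    lra. }
  assert (eS : S ^ 2 - 4 * Pi3 = - (12 * rad ^ 2 * (4 * rad ^ 2 - 8 * b ^ 3) ^ 3 / b ^ 8)).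
  { unfold Pi3, S. rewrite emu. field; lra. }
  assert (hS4 : S ^ 2 <= 4 * Pi3).
  { assert (0 < 12 * rad ^ 2 * (4 * rad ^ 2 - 8 * b ^ 3) ^ 3 / b ^ 8); [|lra].
    apply Rdiv_lt_0_compat; [apply Rmult_lt_0_compat; [lra|]|]; apply pow_lt; lra. }
  assert (eS' : S ^ 2 - Pi3 = 48 * b ^ 3 * (b ^ 3 + 4 * rad ^ 2) ^ 3 / b ^ 8).
  { unfold Pi3, S. rewrite emu. field; lra. }
  assert (hS1 : Pi3 <= S ^ 2).
  { assert (0 < 48 * b ^ 3 * (b ^ 3 + 4 * rad ^ 2) ^ 3 / b ^ 8); [|lra].
    apply Rdiv_lt_0_compat; [repeat apply Rmult_lt_0_compat; try lra|]; apply pow_lt; lra. }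
  (* The bounds [Pi3 <= S ^ 2 <= 4 * Pi3] together with [S < 0] place this value in [[1 / 2, 1]], as
     the branch requires. *)
  rewrite (cos_third_acos _ (- S / (2 * r))).
  + rewrite <- eD. field; lra.
  + assert (h1 : r <= - S) by nra. assert (h2 : - S <= 2 * r) by nra.
    split.
    * apply Rmult_le_reg_r with (2 * r); [lra|].
      replace (- S / (2 * r) * (2 * r)) with (- S) by (field; lra). lra.
    * apply Rmult_le_reg_r with (2 * r); [lra|].
      replace (- S / (2 * r) * (2 * r)) with (- S) by (field; lra). lra.
  + assert (em : 2 * (mu ^ 6 + 2160 * rad ^ 2 * mu ^ 3 - 93312 * rad ^ 4) = S ^ 3 - 3 * S * r ^ 2).
    { rewrite er. unfold Pi3, S. rewrite emu. field; lra. }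
    replace (- mu ^ 6 - 2160 * rad ^ 2 * mu ^ 3 + 93312 * rad ^ 4)
      with (- ((S ^ 3 - 3 * S * r ^ 2) / 2)) by (rewrite <- em; field).
    field; lra.
Qed.

(** In terms of [v^2 = b^3 + rad^2] and [s^2 = b^3 + 4 rad^2] one has [r0 = 2 v / b^2] and
    [d0 = s^2 / (b^2 rad)]. All denominators become multiples of [v + rad], its square, or
    [v - rad], and [(v + rad) (v - rad) = b^3] collapses the sum. *)
Lemma limit_angle_double_root (rad C1 b : R) : 0 < rad -> 0 < b ->
  rad ^ 2 * C1 = 2 * b - 4 * rad ^ 2 / b ^ 2 ->
  limit_angle rad C1 = 2 * PI * sqrt ((b ^ 3 + rad ^ 2) / (b ^ 3 + 4 * rad ^ 2)).
Proof.
intros hr hb emu.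
assert (eC : C1 = (2 * b - 4 * rad ^ 2 / b ^ 2) / rad ^ 2) by (rewrite <- emu; field; lra).
assert (hb3 : 0 < b ^ 3) by (apply pow_lt; lra).
assert (hb2 : 0 < b ^ 2) by (apply pow_lt; lra).
assert (hr2 : 0 < rad ^ 2) by (apply pow_lt; lra).
set (v := sqrt (b ^ 3 + rad ^ 2)). set (s := sqrt (b ^ 3 + 4 * rad ^ 2)).
assert (ev : v ^ 2 = b ^ 3 + rad ^ 2) by (apply pow2_sqrt; lra).
assert (es : s ^ 2 = b ^ 3 + 4 * rad ^ 2) by (apply pow2_sqrt; lra).
assert (hv : 0 < v) by (apply sqrt_lt_R0; lra).
assert (hs : 0 < s) by (apply sqrt_lt_R0; lra).
assert (hvr : rad < v) by nra.
assert (er0 : r0 rad C1 = 2 * v / b ^ 2).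
{ unfold r0. rewrite (Dvalue_double_root rad C1 b) by assumption.
  rewrite <- (sqrt_pow2 (2 * v / b ^ 2)) by (left; apply Rdiv_lt_0_compat; lra).
  f_equal. replace ((2 * v / b ^ 2) ^ 2) with (4 * v ^ 2 / b ^ 4) by (field; lra).
  rewrite ev, eC. field; lra. }
assert (ed0 : d0 rad C1 = s ^ 2 / (b ^ 2 * rad)).
{ unfold d0. rewrite (Dvalue_double_root rad C1 b) by assumption.
  rewrite <- (sqrt_pow2 (s ^ 2 / (b ^ 2 * rad))).
  2:{ left; apply Rdiv_lt_0_compat; [apply pow_lt; lra|apply Rmult_lt_0_compat; lra]. }
  f_equal. rewrite es, eC. field; lra. }
unfold limit_angle. cbv zeta. rewrite er0, ed0.
replace (rad * (s ^ 2 / (b ^ 2 * rad))) with ((s / b) ^ 2) by (field; lra).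
rewrite sqrt_pow2 by (left; apply Rdiv_lt_0_compat; lra).
rewrite sqrt_div_alt by lra. fold v s.
assert (eb3 : b ^ 3 = v ^ 2 - rad ^ 2) by lra.
assert (es' : s ^ 2 = v ^ 2 + 3 * rad ^ 2) by lra.
replace (2 * (s ^ 2 / (b ^ 2 * rad)) + 6 * (2 * v / b ^ 2) - rad * C1) with (12 * (rad + v) / b ^ 2).
2:{ rewrite es, eC. field; lra. }
replace (6 * (2 * v / b ^ 2) - 2 * (s ^ 2 / (b ^ 2 * rad)) + rad * C1) with (12 * (v - rad) / b ^ 2).
2:{ rewrite es, eC. field; lra. }
replace (6 * (2 * v / b ^ 2) + 4 * (s ^ 2 / (b ^ 2 * rad)) + rad * C1) with (6 * (v + rad) ^ 2 / (b ^ 2 * rad)).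
2:{ replace ((v + rad) ^ 2) with (v ^ 2 + 2 * v * rad + rad ^ 2) by ring. rewrite ev, es, eC. field; lra. }
rewrite es'.
transitivity (12 * PI * b ^ 3 / s * (2 * v / (12 * ((v + rad) * (v - rad))))).
- field. repeat split; lra.
- replace ((v + rad) * (v - rad)) with (b ^ 3) by (rewrite eb3; ring). field; lra.
Qed.

(** * The parameters p, q, k *)

(* [- 4 rad ^ 2 / b ^ 2] is the negative root when [b] is a double root; the last
   bound is what makes [k ^ 2] converge as [lam] decreases to that case. *)
Lemma exists_admissible (rad mu b lam : R) : 0 < rad -> 0 < b ->
  mu = 2 * b - 4 * rad ^ 2 / b ^ 2 ->
  - b ^ 2 + 8 * rad ^ 2 / b < lam ->
  exists p q k, admissible p q k /\ p * q * k / 2 = rad /\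
    p ^ 2 + q ^ 2 - 2 * k ^ 2 = mu /\ - (p ^ 2 - k ^ 2) * (q ^ 2 - k ^ 2) = lam /\
    0 < k ^ 2 - 4 * rad ^ 2 / b ^ 2 <= (lam - (- b ^ 2 + 8 * rad ^ 2 / b)) / (2 * b).
Proof.
intros hr hb emu hlam.
set (e := 4 * rad ^ 2). set (nD := e / b ^ 2). set (D := - b ^ 2 + 8 * rad ^ 2 / b) in *.
assert (he : 0 < e) by (unfold e; nra).
assert (hb2 : 0 < b ^ 2) by nra.
assert (hnD : 0 < nD) by (apply Rdiv_lt_0_compat; lra).
assert (eD : D = nD ^ 2 + mu * nD - e / nD) by (unfold D, nD; rewrite emu; unfold e; field; lra).
fold e nD in emu.
(* [F n] is the cubic of the first integral at [B = - n], so its zero is the future [k ^ 2]. At [nD]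
   it equals [nD * (D - lam)], negative above D. *)
set (F := fun n => n ^ 3 + mu * n ^ 2 - lam * n - e).
set (M := 1 + Rabs mu + Rabs lam + e + nD).
assert (h1 := Rabs_pos mu). assert (h2 := Rabs_pos lam).
assert (h3 := Rle_abs (- mu)). rewrite Rabs_Ropp in h3. assert (h4 := Rle_abs lam).
assert (hM : 1 < M) by (unfold M; lra).
assert (F0 : F nD < 0).
{ assert (E : F nD = nD * (D - lam)) by (rewrite eD; unfold F; field; lra).
  rewrite E. nra. }
assert (FM : 0 < F M).
{ assert (a1 : 1 + Rabs lam + e <= M + mu) by (unfold M; lra).
  assert (a2 : M * (1 + Rabs lam + e) <= M * (M + mu)) by (apply Rmult_le_compat_l; lra).
  assert (a3 : 1 + e <= M * (M + mu) - lam) by nra.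
  assert (a4 : 1 + e < M * (M * (M + mu) - lam)) by nra.
  unfold F. replace (M ^ 3 + mu * M ^ 2 - lam * M - e) with (M * (M * (M + mu) - lam) - e) by ring. lra. }
destruct (IVT_gen F nD M 0) as [n [hn Fn]].
{ unfold F; reg. }
{ rewrite Rmin_left, Rmax_right; lra. }
assert (hnM : nD < M) by (unfold M; lra).
rewrite Rmin_left, Rmax_right in hn by lra.
assert (hnn : nD < n) by (destruct (Rle_lt_or_eq_dec nD n) as [h|h]; [lra|assumption|rewrite h in F0; lra]).
assert (elam : lam = n ^ 2 + mu * n - e / n).
{ apply Rmult_eq_reg_r with n; [|lra]. unfold F in Fn.
  replace ((n ^ 2 + mu * n - e / n) * n) with (n ^ 3 + mu * n ^ 2 - e) by (field; lra). lra. }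
set (k := sqrt n).
assert (hk : 0 < k) by (apply sqrt_lt_R0; lra).
assert (ek : k ^ 2 = n) by (apply pow2_sqrt; lra).
set (g := 2 * rad / k).
assert (hg : 0 < g) by (apply Rdiv_lt_0_compat; lra).
assert (eg : g ^ 2 * n = e) by (rewrite <- ek; unfold g, e; field; lra).
assert (enD : b ^ 2 * nD = e) by (unfold nD; field; lra).
assert (hgb : g < b).
{ apply Rnot_le_lt; intros hc. assert (b ^ 2 <= g ^ 2) by (apply pow_incr; lra). nra. }
(* [d] and [s] are going to be [q - p] and [q + p], with [g = p * q]. Since [mu = 2 * b - nD], the
   inequality [k < d] follows from [nD < n] and [g < b]. *)
set (d := sqrt (mu + 2 * n - 2 * g)). set (s := sqrt (mu + 2 * n + 2 * g)).
assert (hd2 : n < mu + 2 * n - 2 * g) by lra.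
assert (ed : d ^ 2 = mu + 2 * n - 2 * g) by (apply pow2_sqrt; lra).
assert (es : s ^ 2 = mu + 2 * n + 2 * g) by (apply pow2_sqrt; lra).
assert (hd : k < d) by (apply sqrt_lt_1_alt; lra).
assert (hs : d < s) by (apply sqrt_lt_1_alt; lra).
exists ((s - d) / 2), ((s + d) / 2), k.
assert (epq : (s - d) / 2 * ((s + d) / 2) = g).
{ replace ((s - d) / 2 * ((s + d) / 2)) with ((s ^ 2 - d ^ 2) / 4) by field. rewrite es, ed; field. }
assert (epq2 : ((s - d) / 2) ^ 2 + ((s + d) / 2) ^ 2 = mu + 2 * n).
{ replace (((s - d) / 2) ^ 2 + ((s + d) / 2) ^ 2) with ((s ^ 2 + d ^ 2) / 2) by field. rewrite es, ed; field. }
split; [constructor; lra|].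
split; [rewrite epq; unfold g; field; lra|].
split; [rewrite ek; lra|].
split.
- rewrite ek.
  replace (- (((s - d) / 2) ^ 2 - n) * (((s + d) / 2) ^ 2 - n))
    with (- ((s - d) / 2 * ((s + d) / 2)) ^ 2 + n * (((s - d) / 2) ^ 2 + ((s + d) / 2) ^ 2) - n ^ 2) by ring.
  rewrite epq, epq2, elam. replace (e / n) with (g ^ 2) by (rewrite <- eg; field; lra). ring.
- rewrite ek. fold nD. split; [lra|].
  apply Rmult_le_reg_r with (2 * b); [lra|].
  replace ((lam - D) / (2 * b) * (2 * b)) with (lam - D) by (field; lra).
  (* Since [mu + nD = 2 * b], the second factor is at least [2 * b]; this is the rate at which
     [k ^ 2] is controlled by [lam - D]. *)
  assert (E : lam - D = (n - nD) * (n + nD + mu + e / (n * nD))) by (rewrite elam, eD; field; lra).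
  rewrite E. apply Rmult_le_compat_l; [lra|].
  assert (0 < e / (n * nD)) by (apply Rdiv_lt_0_compat; nra). lra.
Qed.

(** Once [rad] and [mu] are fixed, [p q = 2 rad / k] and [(p + q)^2 = mu + 2 k^2 + 2 p q], so the
    bound of [angle_lower_continuous] is a function [low] of [n = k^2] alone. It is continuous at
    [nD], where the radical for [amp] vanishes and the limit value appears. *)
Lemma angle_near_limit (rad mu b : R) : 0 < rad -> 0 < b ->
  mu = 2 * b - 4 * rad ^ 2 / b ^ 2 ->
  forall eps : posreal, exists delta : posreal, forall p q k,
    admissible p q k -> p * q * k / 2 = rad -> p ^ 2 + q ^ 2 - 2 * k ^ 2 = mu ->
    Rabs (k ^ 2 - 4 * rad ^ 2 / b ^ 2) < delta ->
    2 * PI * sqrt ((b ^ 3 + rad ^ 2) / (b ^ 3 + 4 * rad ^ 2)) - eps < angle p q k.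
Proof.
intros hr hb emu eps.
set (nD := 4 * rad ^ 2 / b ^ 2) in *.
assert (hb2 : 0 < b ^ 2) by nra. assert (hb3 : 0 < b ^ 3) by (apply pow_lt; lra).
assert (hr2 : 0 < rad ^ 2) by nra.
assert (hnD : 0 < nD) by (apply Rdiv_lt_0_compat; lra).
set (low := fun n => PI * sqrt (mu + 2 * n + 2 * (2 * rad / sqrt n))
   / sqrt ((mu + n) / 2 + sqrt (((mu + n) / 2) ^ 2 - (2 * rad / sqrt n) ^ 2) + n)).
assert (esnD : sqrt nD = 2 * rad / b).
{ rewrite <- (sqrt_pow2 (2 * rad / b)) by (left; apply Rdiv_lt_0_compat; lra).
  f_equal; unfold nD; field; lra. }
assert (egD : 2 * rad / sqrt nD = b) by (rewrite esnD; field; lra).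
assert (elow : low nD = 2 * PI * sqrt ((b ^ 3 + rad ^ 2) / (b ^ 3 + 4 * rad ^ 2))).
{ unfold low. rewrite egD.
  replace (((mu + nD) / 2) ^ 2 - b ^ 2) with 0 by (rewrite emu; field). rewrite sqrt_0.
  replace (mu + 2 * nD + 2 * b) with (2 ^ 2 * ((b ^ 3 + rad ^ 2) / b ^ 2)) by (rewrite emu; unfold nD; field; lra).
  replace ((mu + nD) / 2 + 0 + nD) with ((b ^ 3 + 4 * rad ^ 2) / b ^ 2) by (rewrite emu; unfold nD; field; lra).
  rewrite sqrt_mult_alt, sqrt_pow2 by lra.
  rewrite !sqrt_div_alt by lra. rewrite (sqrt_pow2 b) by lra. field.
  split; [apply Rgt_not_eq, sqrt_lt_R0; lra|lra]. }
assert (cg : continuous (fun n => 2 * rad / sqrt n) nD).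
{ apply continuous_of_ex_derive. auto_derive. split; [lra|]. split; [|trivial].
  apply Rgt_not_eq, sqrt_lt_R0; lra. }
assert (cs : forall (f : R -> R) t, continuous f t -> continuous (fun x => sqrt (f x)) t)
  by (intros f t hf; apply (continuous_comp f sqrt); [exact hf|apply continuous_sqrt]).
assert (clow : continuous low nD).
{ unfold low. apply (continuous_mult (fun n => PI * sqrt _) (fun n => / sqrt _)).
  - apply (continuous_mult (fun _ => PI)); [apply continuous_const|].
    apply cs, (continuous_plus (V := R_NormedModule)).
    + apply continuous_of_ex_derive; auto_derive; auto.
    + apply (continuous_mult (fun _ => 2)); [apply continuous_const|exact cg].
  - apply (continuous_comp (fun n => sqrt _) Rinv).
    + apply cs, (continuous_plus (V := R_NormedModule)); [|apply continuous_id].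
      apply (continuous_plus (V := R_NormedModule)); [apply continuous_of_ex_derive; auto_derive; auto|].
      apply cs, (continuous_minus (V := R_NormedModule)); [apply continuous_of_ex_derive; auto_derive; auto|].
      apply (continuous_comp (fun n => 2 * rad / sqrt n) (fun v => v ^ 2)); [exact cg|].
      apply continuous_of_ex_derive; auto_derive; auto.
    + apply continuous_of_ex_derive. auto_derive.
      apply Rgt_not_eq, sqrt_lt_R0.
      match goal with |- context [_ + sqrt ?a + nD] => assert (h := sqrt_pos a) end.
      rewrite emu in *. lra. }
assert (cl : locally nD (fun n => low nD - eps < low n)).
{ assert (h : locally (low nD) (fun y => low nD - eps < y)).
  { exists eps. intros y hy. apply Rabs_def2 in hy. unfold minus, plus, opp in hy; simpl in hy. lra. }
  exact (clow _ h). }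
destruct cl as [delta hdelta].
exists delta. intros p q k H epqk eM hk.
specialize (hdelta (k ^ 2)). rewrite elow in hdelta.
apply Rlt_le_trans with (low (k ^ 2)); [apply hdelta; exact hk|].
destruct H as [hp hk0 hq].
apply Rle_trans with (2 := angle_lower_continuous p q k (Build_admissible _ _ _ hp hk0 hq)).
right. unfold low.
rewrite sqrt_pow2 by lra.
assert (eg : 2 * rad / k = p * q) by (rewrite <- epqk; field; lra).
rewrite eg.
replace (mu + 2 * k ^ 2 + 2 * (p * q)) with ((p + q) ^ 2) by (rewrite <- eM; ring).
rewrite sqrt_pow2 by lra.
replace ((mu + k ^ 2) / 2) with (mid p q k) by (rewrite <- eM; unfold mid; field).
reflexivity.
Qed.

(** * The equation for B *)

(* [auto_derive] leaves derivatives of variables eta-expanded. *)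
Ltac eval_derive h :=
  lazymatch type of h with
  | is_derive ?f ?t ?l =>
      let g := eval cbv beta in (fun x : R => f x) in
      replace (Derive g t) with l by (symmetry; apply is_derive_unique; exact h)
  end.

Lemma is_derive_continuity_pt (f : R -> R) (x l : R) : is_derive f x l -> continuity_pt f x.
Proof.
intros h. apply continuity_pt_filterlim.
apply (continuous_of_ex_derive f x). exists l; exact h.
Qed.

Lemma MVT_is_derive (f df : R -> R) (a b : R) : (forall x, is_derive f x (df x)) ->
  exists c, Rmin a b <= c <= Rmax a b /\ f b - f a = df c * (b - a).
Proof.
intros h. apply MVT_gen; intros; [apply h|].
eapply is_derive_continuity_pt, h.
Qed.

Lemma is_derive_increasing (f df : R -> R) : (forall x, is_derive f x (df x)) ->
  (forall x, 0 < df x) -> forall a b, a < b -> f a < f b.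
Proof.
intros h hp a b hab. destruct (MVT_is_derive f df a b h) as [c [_ E]].
assert (0 < df c * (b - a)) by (apply Rmult_lt_0_compat; [apply hp|lra]). lra.
Qed.

Lemma is_derive_zero_const (f : R -> R) : (forall x, is_derive f x 0) ->
  forall a b, f a = f b.
Proof.
intros h a b. destruct (MVT_is_derive f (fun _ => 0) a b h) as [c [_ E]]. lra.
Qed.

(** Inverting the time function [G] solves the autonomous equation [phi_s = 1 / dG (phi)] on the
    whole line. The positive lower bound on [dG] serves twice: it makes [G] onto, and it makes the
    inverse Lipschitz, hence continuous, before its derivative is computed. *)
Lemma increasing_inverse (G dG : R -> R) (d : R) : 0 < d ->
  (forall x, is_derive G x (dG x)) -> (forall x, continuous dG x) -> (forall x, d <= dG x) ->
  exists phi, (forall s, G (phi s) = s) /\ (forall s, is_derive phi s (/ dG (phi s))).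
Proof.
intros hd hG cG hdG.
assert (surj : forall s, {x | G x = s}).
{ intros s. set (M := (Rabs s + Rabs (G 0)) / d).
  assert (hM : 0 <= M).
  { apply Rmult_le_pos; [apply Rplus_le_le_0_compat; apply Rabs_pos|left; apply Rinv_0_lt_compat; lra]. }
  assert (eM : d * M = Rabs s + Rabs (G 0)) by (unfold M; field; lra).
  assert (h1 := Rle_abs s). assert (h2 := Rle_abs (- s)). rewrite Rabs_Ropp in h2.
  assert (h3 := Rle_abs (G 0)). assert (h4 := Rle_abs (- G 0)). rewrite Rabs_Ropp in h4.
  assert (up : s <= G M).
  { destruct (MVT_is_derive G dG 0 M hG) as [c [_ E]]. assert (h := hdG c). nra. }
  assert (lo : G (- M) <= s).
  { destruct (MVT_is_derive G dG (- M) 0 hG) as [c [_ E]]. assert (h := hdG c). nra. }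
  destruct (IVT_gen G (- M) M s) as [x [_ hx]].
  - intros x; eapply is_derive_continuity_pt, hG.
  - rewrite Rmin_left, Rmax_right; lra.
  - exists x; exact hx. }
set (phi := fun s => proj1_sig (surj s)).
assert (hphi : forall s, G (phi s) = s) by (intros s; unfold phi; destruct (surj s); assumption).
exists phi; split; [exact hphi|].
intros s. apply is_derive_Reals. intros eps heps.
assert (hc : continuous (fun x => / dG x) (phi s)).
{ apply (continuous_comp dG Rinv); [apply cG|]. apply continuous_of_ex_derive; auto_derive.
  generalize (hdG (phi s)); lra. }
assert (hloc := proj1 (filterlim_locally (F := locally (phi s)) _ _) hc (mkposreal eps heps)).
destruct hloc as [del hdel].
assert (hdd : 0 < d * del) by (apply Rmult_lt_0_compat; [lra|apply cond_pos]).
exists (mkposreal _ hdd). intros h hh0 hh. simpl in hh.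
destruct (MVT_is_derive G dG (phi s) (phi (s + h)) hG) as [c [hc1 E]].
rewrite !hphi in E. assert (hdc := hdG c).
assert (Eh : h = dG c * (phi (s + h) - phi s)) by lra.
assert (Eq : (phi (s + h) - phi s) / h = / dG c).
{ set (u := phi (s + h) - phi s) in *.
  assert (hu : u <> 0) by (intros E0; rewrite E0, Rmult_0_r in Eh; lra).
  rewrite Eh. field. split; lra. }
rewrite Eq. apply (hdel c).
assert (hb : Rabs (c - phi s) <= Rabs (phi (s + h) - phi s)).
{ revert hc1. unfold Rmin, Rmax. destruct (Rle_dec (phi s) (phi (s + h))); intros [? ?].
  - rewrite !Rabs_pos_eq; lra.
  - rewrite !Rabs_left1; lra. }
assert (hb2 : d * Rabs (phi (s + h) - phi s) <= Rabs h).
{ rewrite Eh at 2. rewrite Rabs_mult, (Rabs_pos_eq (dG c)) by lra.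
  apply Rmult_le_compat_r; [apply Rabs_pos|lra]. }
change (Rabs (c - phi s) < del).
assert (hdp := cond_pos del). nra.
Qed.

(** Gronwall applied to [E = (y1 - y2)^2 + (z1 - z2)^2], with [|E'| <= (1 + K) E], forwards and
    backwards in time. The Lipschitz bound is asked only along the two solutions because the
    intended right-hand side blows up at zero. *)
Lemma second_order_unique (f y1 y2 z1 z2 : R -> R) (K : R) : 0 <= K ->
  (forall s, is_derive y1 s (z1 s)) -> (forall s, is_derive z1 s (f (y1 s))) ->
  (forall s, is_derive y2 s (z2 s)) -> (forall s, is_derive z2 s (f (y2 s))) ->
  (forall s, Rabs (f (y1 s) - f (y2 s)) <= K * Rabs (y1 s - y2 s)) ->
  y1 0 = y2 0 -> z1 0 = z2 0 -> forall s, y1 s = y2 s.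
Proof.
intros K0 h1 k1 h2 k2 hK e0 e1 s.
set (L := 1 + K).
set (E := fun s => (y1 s - y2 s) ^ 2 + (z1 s - z2 s) ^ 2).
set (dE := fun s => 2 * (y1 s - y2 s) * (z1 s - z2 s) + 2 * (z1 s - z2 s) * (f (y1 s) - f (y2 s))).
assert (hE : forall s, is_derive E s (dE s)).
{ intros t. unfold E, dE. auto_derive.
  - repeat split; eexists; eauto.
  - eval_derive (h1 t); eval_derive (h2 t); eval_derive (k1 t); eval_derive (k2 t). ring. }
assert (bE : forall s, Rabs (dE s) <= L * E s).
{ intros t. unfold dE, E, L. assert (hk := hK t).
  set (u := y1 t - y2 t) in *. set (v := z1 t - z2 t) in *. set (w := f (y1 t) - f (y2 t)) in *.
  apply Rle_trans with (1 := Rabs_triang _ _).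
  rewrite !Rabs_mult, (Rabs_pos_eq 2) by lra.
  rewrite <- (pow2_abs u), <- (pow2_abs v).
  assert (0 <= Rabs u) by apply Rabs_pos. assert (0 <= Rabs v) by apply Rabs_pos.
  assert (0 <= Rabs w) by apply Rabs_pos.
  assert (h3 : Rabs v * Rabs w <= K * (Rabs v * Rabs u)) by nra.
  assert (h4 : 0 <= (Rabs u - Rabs v) ^ 2) by apply pow2_ge_0.
  nra. }
assert (E0 : E 0 = 0) by (unfold E; rewrite e0, e1; ring).
assert (Epos : forall t, 0 <= E t) by (intros; unfold E; apply Rplus_le_le_0_compat; apply pow2_ge_0).
assert (hs : E s = 0).
{ apply Rle_antisym; [|apply Epos].
  destruct (Rle_lt_dec 0 s) as [hs|hs].
  - assert (hD : forall t, is_derive (fun t => E t * exp (- L * t)) t ((dE t - L * E t) * exp (- L * t))).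
    { intros t. auto_derive; [eexists; apply hE|]. eval_derive (hE t). ring. }
    destruct (MVT_is_derive _ _ 0 s hD) as [c [_ Ec]].
    assert (hb := bE c). apply Rabs_le_between in hb.
    assert (0 < exp (- L * c)) by apply exp_pos. assert (0 < exp (- L * s)) by apply exp_pos.
    rewrite E0, Rmult_0_l, !Rminus_0_r in Ec.
    assert ((dE c - L * E c) * exp (- L * c) <= 0) by nra. nra.
  - assert (hD : forall t, is_derive (fun t => E t * exp (L * t)) t ((dE t + L * E t) * exp (L * t))).
    { intros t. auto_derive; [eexists; apply hE|]. eval_derive (hE t). ring. }
    destruct (MVT_is_derive _ _ 0 s hD) as [c [_ Ec]].
    assert (hb := bE c). apply Rabs_le_between in hb.
    assert (0 < exp (L * c)) by apply exp_pos. assert (0 < exp (L * s)) by apply exp_pos.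
    rewrite E0, Rmult_0_l, !Rminus_0_r in Ec.
    assert (0 <= (dE c + L * E c) * exp (L * c)) by nra. nra. }
unfold E in hs. assert (0 <= (y1 s - y2 s) ^ 2) by apply pow2_ge_0.
assert (0 <= (z1 s - z2 s) ^ 2) by apply pow2_ge_0.
assert ((y1 s - y2 s) ^ 2 = 0) by lra.
nra.
Qed.

(** With [B = prof phi] the first integral reads [rad^2 B (amp sin phi)^2 phi_s^2 = (amp sin phi)^2
    (B + k^2)]; cancelling the common factor leaves the positive root for [phi_s]. *)
Definition speed (p q k t : R) : R :=
  sqrt ((prof p q k t + k ^ 2) / prof p q k t) / (p * q * k / 2).

Record phase (p q k : R) (phi : R -> R) (rho : R) : Prop := {
  phase_period_pos : 0 < rho;
  phase_derive : forall s, is_derive phi s (speed p q k (phi s));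
  phase_period : forall s, phi (s + rho) = phi s + 2 * PI;
  phase_onto : forall x, exists s, phi s = x }.

(** * Solutions of the phase equation and the profiles they produce *)

Section Pendulum.
Context (p q k : R) (H : admissible p q k).

Let hp : 0 < p := adm_p _ _ _ H.
Let hk : 0 < k := adm_k _ _ _ H.
Let hq : p + k < q := adm_q _ _ _ H.

Lemma rad_pos : 0 < p * q * k / 2.
Proof. assert (0 < p * q) by nra. nra. Qed.

Lemma speed_pos t : 0 < speed p q k t.
Proof.
apply Rdiv_lt_0_compat; [|apply rad_pos].
apply sqrt_lt_R0, Rdiv_lt_0_compat; [apply prof_root_pos|apply prof_pos]; exact H.
Qed.

Lemma speed_sq t : speed p q k t ^ 2 = (prof p q k t + k ^ 2) / prof p q k t / (p * q * k / 2) ^ 2.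
Proof.
unfold speed. assert (h := rad_pos). unfold Rdiv at 1. rewrite Rpow_mult_distr, pow2_sqrt.
- rewrite pow_inv; reflexivity.
- left. apply Rdiv_lt_0_compat; [apply prof_root_pos|apply prof_pos]; exact H.
Qed.

Lemma is_derive_prof t : is_derive (prof p q k) t (amp p q k * sin t).
Proof. unfold prof; auto_derive; [auto|ring]. Qed.

Lemma is_derive_speed t : is_derive (speed p q k) t
  (- k ^ 2 * (amp p q k * sin t) / (2 * prof p q k t ^ 2 * (p * q * k / 2) ^ 2 * speed p q k t)).
Proof.
assert (h1 := prof_pos p q k H t). assert (h2 := prof_root_pos p q k H t).
assert (h3 := rad_pos). assert (h4 := speed_pos t).
assert (hd : 0 < (prof p q k t + k ^ 2) / prof p q k t) by (apply Rdiv_lt_0_compat; assumption).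
assert (hs := sqrt_lt_R0 _ hd).
assert (E : sqrt ((prof p q k t + k ^ 2) / prof p q k t) = speed p q k t * (p * q * k / 2))
  by (unfold speed; field; repeat split; nra).
assert (hdiv : is_derive (fun t => (prof p q k t + k ^ 2) / prof p q k t) t
   (- k ^ 2 * (amp p q k * sin t) / prof p q k t ^ 2)).
{ auto_derive; [repeat split; try (eexists; apply is_derive_prof); lra|].
  eval_derive (is_derive_prof t). field; lra. }
assert (hsq := is_derive_sqrt _ _ _ hdiv hd).
cbv beta in hsq; rewrite E in hsq.
apply (is_derive_scal _ _ (/ (p * q * k / 2))) in hsq.
match type of hsq with is_derive _ _ ?l => match goal with |- is_derive _ _ ?l' => replace l' with l end end.
- eapply is_derive_ext; [|exact hsq]. intros x; apply Rmult_comm.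
- field. repeat split; nra.
Qed.

(** Time as a function of the phase is the integral of [/ speed]; it is inverted by
    [increasing_inverse], and [rho] is its increment over one turn. *)
Lemma exists_phase : exists phi rho, phase p q k phi rho.
Proof.
assert (hpi := PI_RGT_0).
set (w := fun t => / speed p q k t).
assert (cw : forall t, continuous w t).
{ intros t. apply continuous_of_ex_derive. unfold w. auto_derive.
  repeat split; [eexists; apply is_derive_speed|]. apply Rgt_not_eq, speed_pos. }
assert (wp : forall t, 0 < w t) by (intros; apply Rinv_0_lt_compat, speed_pos).
set (G := fun x => RInt w 0 x).
assert (hG : forall x, is_derive G x (w x)).
{ intros x. apply (is_derive_RInt w G 0); [|apply cw].
  apply filter_forall. intros y. apply (RInt_correct (V := R_CompleteNormedModule)), ex_RInt_cont, cw. }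
assert (per : forall t, w (t + 2 * PI) = w t).
{ intros t; unfold w, speed, prof. replace (cos (t + 2 * PI)) with (cos t); [reflexivity|].
  symmetry; rewrite <- (cos_period t 1); f_equal; simpl; ring. }
assert (lb : exists d, 0 < d /\ forall t, d <= w t).
{ set (V := sqrt ((mid p q k + amp p q k + k ^ 2) / (mid p q k - amp p q k)) / (p * q * k / 2)).
  assert (h1 := amp_lt_mid p q k H). assert (h2 := amp_pos p q k H). assert (h3 := rad_pos).
  assert (hV : 0 < V).
  { apply Rdiv_lt_0_compat; [|assumption]. apply sqrt_lt_R0, Rdiv_lt_0_compat; nra. }
  exists (/ V). split; [apply Rinv_0_lt_compat, hV|].
  intros t. apply Rinv_le_contravar; [apply speed_pos|].
  unfold speed, V. apply Rmult_le_compat_r; [left; apply Rinv_0_lt_compat; assumption|].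
  apply sqrt_le_1_alt. assert (hb := prof_bounds p q k H t). assert (hk2 : 0 < k ^ 2) by nra.
  unfold Rdiv. apply Rmult_le_compat; [lra| |lra|].
  - left; apply Rinv_0_lt_compat; lra.
  - apply Rinv_le_contravar; lra. }
destruct lb as [d [hd hdw]].
destruct (increasing_inverse G w d hd hG cw hdw) as [phi [hphi dphi]].
set (rho := G (2 * PI) - G 0).
assert (hrho : 0 < rho).
{ unfold rho. assert (h := is_derive_increasing G w hG wp 0 (2 * PI)). lra. }
assert (hper : forall x, G (x + 2 * PI) = G x + rho).
{ intros x. unfold rho.
  assert (hz : forall y, is_derive (fun x => G (x + 2 * PI) - G x) y 0).
  { intros y. auto_derive; [repeat split; eexists; apply hG|].
    eval_derive (hG (y + 2 * PI)). eval_derive (hG y). rewrite per. ring. }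
  assert (h := is_derive_zero_const _ hz x 0). simpl in h. rewrite Rplus_0_l in h. lra. }
assert (inj : forall x y, G x = G y -> x = y).
{ intros x y hxy. destruct (Rtotal_order x y) as [h|[h|h]]; [|assumption|];
    apply (is_derive_increasing G w hG wp) in h; lra. }
exists phi, rho. constructor.
- assumption.
- intros s. replace (speed p q k (phi s)) with (/ w (phi s)); [apply dphi|].
  unfold w. apply Rinv_inv.
- intros s. apply inj. rewrite hper, !hphi. reflexivity.
- intros x. exists (G x). apply inj. rewrite hphi; reflexivity.
Qed.

Lemma phase_shift phi rho a : phase p q k phi rho -> phase p q k (fun s => phi (s + a)) rho.
Proof.
intros [h1 h2 h3 h4]. constructor.
- assumption.
- intros s. auto_derive; [eexists; apply h2|]. eval_derive (h2 (s + a)). ring.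
- intros s. rewrite <- h3. f_equal; ring.
- intros x. destruct (h4 x) as [s hs]. exists (s - a). rewrite <- hs. f_equal; ring.
Qed.

Lemma phase_increasing phi rho : phase p q k phi rho -> forall a b, a < b -> phi a < phi b.
Proof.
intros h. apply is_derive_increasing with (df := fun s => speed p q k (phi s)); [apply h|].
intros; apply speed_pos.
Qed.

Lemma prof_phase_period phi rho s : phase p q k phi rho ->
  prof p q k (phi (s + rho)) = prof p q k (phi s).
Proof.
intros h. rewrite (phase_period _ _ _ _ _ h). unfold prof. do 2 f_equal.
rewrite <- (cos_period (phi s) 1); f_equal; simpl; ring.
Qed.

Lemma cos_1_between x : 0 < x < 2 * PI -> cos x < 1.
Proof.
intros hx. replace x with (2 * (x / 2)) by field. rewrite cos_2a_sin.
assert (0 < sin (x / 2)) by (apply sin_gt_0; lra). nra.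
Qed.

(** At phase [0] the profile takes its minimum, which recurs only at multiples of [2 * PI]. A
    shorter period would put another minimum strictly between [0] and [2 * PI]. *)
Lemma prof_phase_least phi rho r : phase p q k phi rho -> 0 < r ->
  (forall s, prof p q k (phi (s + r)) = prof p q k (phi s)) -> rho <= r.
Proof.
intros h hr hper. apply Rnot_lt_le; intros hlt.
destruct (phase_onto _ _ _ _ _ h 0) as [s0 hs0].
assert (h1 := phase_increasing phi rho h s0 (s0 + r) ltac:(lra)).
assert (h2 := phase_increasing phi rho h (s0 + r) (s0 + rho) ltac:(lra)).
rewrite (phase_period _ _ _ _ _ h), hs0 in h2. rewrite hs0 in h1.
assert (hc := cos_1_between (phi (s0 + r)) ltac:(lra)).
specialize (hper s0). unfold prof in hper. rewrite hs0, cos_0 in hper.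
assert (ha := amp_pos p q k H). nra.
Qed.

Definition prof_speed (s : R) : R := amp p q k * sin s * speed p q k s.

Lemma phase_prof_derive phi rho s : phase p q k phi rho ->
  is_derive (fun s => prof p q k (phi s)) s (prof_speed (phi s)).
Proof.
intros h. assert (hd := phase_derive _ _ _ _ _ h).
auto_derive; [repeat split; eexists; [apply is_derive_prof|apply hd]|].
eval_derive (is_derive_prof (phi s)). eval_derive (hd s). unfold prof_speed; ring.
Qed.

Definition mu_of : R := p ^ 2 + q ^ 2 - 2 * k ^ 2.
Definition lam_of : R := - (p ^ 2 - k ^ 2) * (q ^ 2 - k ^ 2).

Lemma prof_speed_sq x :
  prof_speed x ^ 2 = lam_of / (p * q * k / 2) ^ 2 - prof p q k x ^ 2 / (p * q * k / 2) ^ 2 - 4 * / prof p q k x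
    + mu_of / (p * q * k / 2) ^ 2 * prof p q k x.
Proof.
assert (h1 := prof_pos p q k H x).
assert (hsc := sin2_cos2_pow x).
unfold prof_speed. replace ((amp p q k * sin x * speed p q k x) ^ 2)
  with ((amp p q k ^ 2 * sin x ^ 2) * speed p q k x ^ 2) by ring.
rewrite speed_sq.
replace (amp p q k ^ 2 * sin x ^ 2) with (amp p q k ^ 2 - (mid p q k - prof p q k x) ^ 2).
2:{ unfold prof. replace (sin x ^ 2) with (1 - cos x ^ 2) by lra. ring. }
rewrite amp_sq by exact H. unfold mid, lam_of, mu_of. field. repeat split; nra.
Qed.

Lemma phase_prof_derive2 phi rho s : phase p q k phi rho ->
  is_derive (fun s => prof_speed (phi s)) s
    (mu_of / (p * q * k / 2) ^ 2 / 2 + 2 * / prof p q k (phi s) ^ 2 - / (p * q * k / 2) ^ 2 * prof p q k (phi s)).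
Proof.
intros h. assert (hd := phase_derive _ _ _ _ _ h).
assert (h1 := prof_pos p q k H (phi s)). assert (h2 := speed_pos (phi s)).
assert (hsc := sin2_cos2_pow (phi s)). assert (h3 := rad_pos).
unfold prof_speed.
auto_derive; [repeat split; eexists; [apply hd|apply is_derive_speed|apply hd]|].
eval_derive (is_derive_speed (phi s)). eval_derive (hd s).
set (x := phi s) in *.
transitivity (amp p q k * cos x * speed p q k x ^ 2
   - k ^ 2 * (amp p q k ^ 2 * sin x ^ 2) / (2 * prof p q k x ^ 2 * (p * q * k / 2) ^ 2)).
{ field. repeat split; nra. }
rewrite speed_sq.
replace (amp p q k ^ 2 * sin x ^ 2) with (amp p q k ^ 2 - (mid p q k - prof p q k x) ^ 2).
2:{ unfold prof. replace (sin x ^ 2) with (1 - cos x ^ 2) by lra. ring. }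
replace (amp p q k * cos x) with (mid p q k - prof p q k x) by (unfold prof; ring).
rewrite amp_sq by exact H. unfold mid, lam_of, mu_of. field. repeat split; nra.
Qed.

(** Uniqueness is taken from the second-order equation. The first integral confines [B] between the
    two positive roots, which gives the Lipschitz constant, and it fixes [|dB 0|], so that the phase
    [acos c] or [- acos c], according to the sign of [dB 0], matches both initial values. *)
Lemma profile_solution (B dB : R -> R) :
  (forall s, 0 < B s) -> (forall s, is_derive B s (dB s)) ->
  (forall s, is_derive dB s (mu_of / (p * q * k / 2) ^ 2 / 2 + 2 * / B s ^ 2 - / (p * q * k / 2) ^ 2 * B s)) ->
  (forall s, dB s ^ 2 = lam_of / (p * q * k / 2) ^ 2 - B s ^ 2 / (p * q * k / 2) ^ 2 - 4 * / B s + mu_of / (p * q * k / 2) ^ 2 * B s) ->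
  exists phi rho, phase p q k phi rho /\ forall s, B s = prof p q k (phi s).
Proof.
set (rad := p * q * k / 2).
intros hB h1 h2 h3.
assert (hA := amp_pos p q k H). assert (hAm := amp_lt_mid p q k H). assert (hr := rad_pos). fold rad in hr.
assert (bB : forall s, mid p q k - amp p q k <= B s <= mid p q k + amp p q k).
{ intros s. assert (hb := hB s). assert (h := h3 s).
  assert (E : rad ^ 2 * B s * dB s ^ 2 = (amp p q k ^ 2 - (B s - mid p q k) ^ 2) * (B s + k ^ 2)).
  { rewrite h, amp_sq by exact H. unfold rad, mid, lam_of, mu_of. field. repeat split; nra. }
  assert (hk2 : 0 < k ^ 2) by nra.
  assert (0 <= amp p q k ^ 2 - (B s - mid p q k) ^ 2).
  { apply Rmult_le_reg_r with (B s + k ^ 2); [lra|]. rewrite Rmult_0_l, <- E.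
    apply Rmult_le_pos; [apply Rmult_le_pos; nra|apply pow2_ge_0]. }
  split; nra. }
set (c := (mid p q k - B 0) / amp p q k).
assert (hc : -1 <= c <= 1).
{ assert (hb := bB 0). assert (c * amp p q k = mid p q k - B 0) by (unfold c; field; lra). split; nra. }
assert (ca : cos (acos c) = c) by (apply cos_acos; lra).
assert (hx0 : exists x, prof p q k x = B 0 /\ prof_speed x = dB 0).
{ assert (hsin : 0 <= sin (acos c)) by (apply sin_ge_0; apply acos_bound).
  assert (e1 : prof p q k (acos c) = B 0) by (unfold prof; rewrite ca; unfold c; field; lra).
  assert (e2 : prof_speed (acos c) ^ 2 = dB 0 ^ 2) by (rewrite prof_speed_sq, e1, h3; reflexivity).
  assert (p0 : 0 <= prof_speed (acos c)).
  { unfold prof_speed. apply Rmult_le_pos; [apply Rmult_le_pos; lra|left; apply speed_pos]. }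
  destruct (Rle_lt_dec 0 (dB 0)) as [hd|hd].
  - exists (acos c). split; [assumption|]. nra.
  - exists (- acos c). split; [unfold prof; rewrite cos_neg; exact e1|].
    assert (E : prof_speed (- acos c) = - prof_speed (acos c)).
    { unfold prof_speed, speed, prof. rewrite cos_neg, sin_neg. ring. }
    rewrite E. nra. }
destruct hx0 as [x0 [e1 e2]].
destruct exists_phase as [phi0 [rho hphi0]].
destruct (phase_onto _ _ _ _ _ hphi0 x0) as [s0 hs0].
assert (hphi := phase_shift _ _ s0 hphi0).
exists (fun s => phi0 (s + s0)), rho. split; [assumption|].
set (lo := mid p q k - amp p q k). set (hi := mid p q k + amp p q k).
assert (hlo : 0 < lo) by (unfold lo; lra). assert (hhi : 0 < hi) by (unfold hi; lra).
assert (hlo4 : 0 < lo ^ 4) by (apply pow_lt; lra). assert (hr2 : 0 < rad ^ 2) by (apply pow_lt; lra).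
assert (0 <= / rad ^ 2) by (left; apply Rinv_0_lt_compat; assumption).
apply second_order_unique with (z1 := dB) (z2 := fun s => prof_speed (phi0 (s + s0)))
  (f := fun y => mu_of / rad ^ 2 / 2 + 2 * / y ^ 2 - / rad ^ 2 * y) (K := 4 * hi / lo ^ 4 + / rad ^ 2).
- apply Rplus_le_le_0_compat; [|assumption]. left; apply Rdiv_lt_0_compat; lra.
- assumption.
- assumption.
- intros s; apply (phase_prof_derive _ _ _ hphi).
- intros s; apply (phase_prof_derive2 _ _ _ hphi).
- intros s. cbv beta. set (y1 := B s). set (y2 := prof p q k (phi0 (s + s0))).
  assert (b1 : lo <= y1 <= hi) by apply bB.
  assert (b2 : lo <= y2 <= hi) by (apply prof_bounds; exact H).
  replace (mu_of / rad ^ 2 / 2 + 2 * / y1 ^ 2 - / rad ^ 2 * y1 - (mu_of / rad ^ 2 / 2 + 2 * / y2 ^ 2 - / rad ^ 2 * y2))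
    with (- (2 * (y1 + y2) / (y1 ^ 2 * y2 ^ 2) + / rad ^ 2) * (y1 - y2)) by (field; lra).
  rewrite Rabs_mult, Rabs_Ropp. apply Rmult_le_compat_r; [apply Rabs_pos|].
  assert (a1 : 0 < lo ^ 2) by (apply pow_lt; lra).
  assert (a2 : lo ^ 2 <= y1 ^ 2) by (apply pow_incr; lra).
  assert (a3 : lo ^ 2 <= y2 ^ 2) by (apply pow_incr; lra).
  assert (a4 : lo ^ 4 <= y1 ^ 2 * y2 ^ 2) by (replace (lo ^ 4) with (lo ^ 2 * lo ^ 2) by ring; apply Rmult_le_compat; lra).
  rewrite Rabs_pos_eq.
  2:{ apply Rplus_le_le_0_compat; [left; apply Rdiv_lt_0_compat; lra|assumption]. }
  apply Rplus_le_compat_r. unfold Rdiv. apply Rmult_le_compat; [lra| |lra|].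
  + left; apply Rinv_0_lt_compat; lra.
  + apply Rinv_le_contravar; lra.
- cbv beta. rewrite Rplus_0_l, hs0. symmetry; assumption.
- cbv beta. rewrite Rplus_0_l, hs0. symmetry; assumption.
Qed.

End Pendulum.

(** * Curves on the sphere *)

Lemma R3_ext (v w : R3) : crd1 v = crd1 w -> crd2 v = crd2 w -> crd3 v = crd3 w -> v = w.
Proof. destruct v as [[v1 v2] v3], w as [[w1 w2] w3]; unfold crd1, crd2, crd3; simpl; congruence. Qed.

Ltac coords :=
  repeat progress (unfold dot, cross, crd1, crd2, crd3, plus, scal, minus, opp, mult in *; simpl in *).

(** Coordinatewise derivatives reduce all product rules to the real ones; the next lemmas translate
    to and from [ex_derive] in the product module. *)
Definition is_vderive (f : R -> R3) (s : R) (l : R3) : Prop :=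
  is_derive (fun t : R => crd1 (f t)) s (crd1 l) /\
  is_derive (fun t : R => crd2 (f t)) s (crd2 l) /\
  is_derive (fun t : R => crd3 (f t)) s (crd3 l).

Lemma ex_derive_linear (f : R -> R3) (g : R3 -> R) (s : R) :
  is_linear (K := R_AbsRing) (U := prod_NormedModule _ (prod_NormedModule _ R_NormedModule R_NormedModule) R_NormedModule)
    (V := R_NormedModule) g ->
  ex_derive f s -> ex_derive (fun t => g (f t)) s.
Proof.
intros hg [l hl].
apply ex_derive_filterdiff. eexists.
refine (filterdiff_comp' f g s _ g _ _).
- exact hl.
- apply filterdiff_linear, hg.
Qed.

Lemma ex_derive_is_vderive (f : R -> R3) (s : R) : ex_derive f s -> is_vderive f s (vDerive f s).
Proof.
intros h. split; [|split]; apply Derive_correct.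
- apply (ex_derive_linear f crd1); [|exact h].
  apply (is_linear_comp (fst : R3 -> R * R) fst); apply is_linear_fst.
- apply (ex_derive_linear f crd2); [|exact h].
  apply (is_linear_comp (fst : R3 -> R * R) snd); [apply is_linear_fst|apply is_linear_snd].
- apply (ex_derive_linear f crd3); [|exact h]. apply is_linear_snd.
Qed.

Lemma is_vderive_ex_derive (f : R -> R3) (s : R) (l : R3) : is_vderive f s l -> ex_derive f s.
Proof.
intros [h1 [h2 h3]].
eapply ex_derive_ext.
2:{ apply (ex_derive_plus (V := prod_NormedModule _ (prod_NormedModule _ R_NormedModule R_NormedModule) R_NormedModule)).
    - apply (ex_derive_plus (V := prod_NormedModule _ (prod_NormedModule _ R_NormedModule R_NormedModule) R_NormedModule)).
      + eexists; apply (is_derive_scal_l (V := prod_NormedModule _ (prod_NormedModule _ R_NormedModule R_NormedModule) R_NormedModule) _ _ _ ((1, 0, 0) : R3) h1).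
      + eexists; apply (is_derive_scal_l (V := prod_NormedModule _ (prod_NormedModule _ R_NormedModule R_NormedModule) R_NormedModule) _ _ _ ((0, 1, 0) : R3) h2).
    - eexists; apply (is_derive_scal_l (V := prod_NormedModule _ (prod_NormedModule _ R_NormedModule R_NormedModule) R_NormedModule) _ _ _ ((0, 0, 1) : R3) h3). }
intros t. apply R3_ext; coords; ring.
Qed.

Lemma is_vderive_unique (f : R -> R3) (s : R) (l : R3) : is_vderive f s l -> vDerive f s = l.
Proof.
intros [h1 [h2 h3]]. unfold vDerive.
apply R3_ext; apply is_derive_unique; assumption.
Qed.

Lemma is_vderive_ext (f g : R -> R3) (s : R) (l : R3) :
  (forall t, f t = g t) -> is_vderive f s l -> is_vderive g s l.
Proof.
intros E [h1 [h2 h3]].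
split; [|split]; eapply is_derive_ext; try eassumption; intros; simpl; rewrite E; reflexivity.
Qed.

Lemma is_derive_prod (u v : R -> R) (s du dv : R) : is_derive u s du -> is_derive v s dv ->
  is_derive (fun t : R => u t * v t) s (du * v s + u s * dv).
Proof. intros h k. apply (is_derive_mult u v s du dv h k), Rmult_comm. Qed.

Lemma is_derive_dot (f g : R -> R3) (s : R) (l m : R3) : is_vderive f s l -> is_vderive g s m ->
  is_derive (fun t : R => dot (f t) (g t)) s (dot l (g s) + dot (f s) m).
Proof.
intros [h1 [h2 h3]] [k1 [k2 k3]]. unfold dot.
assert (h := is_derive_plus (V := R_NormedModule) _ _ _ _ _ (is_derive_plus (V := R_NormedModule) _ _ _ _ _
  (is_derive_prod _ _ _ _ _ h1 k1) (is_derive_prod _ _ _ _ _ h2 k2)) (is_derive_prod _ _ _ _ _ h3 k3)).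
match type of h with is_derive _ _ ?d => match goal with |- is_derive _ _ ?d' => replace d' with d; [exact h|] end end.
coords; ring.
Qed.

Lemma is_vderive_const (v : R3) (s : R) : is_vderive (fun _ => v) s (0, 0, 0).
Proof. split; [|split]; apply (is_derive_const (V := R_NormedModule)). Qed.

Lemma is_vderive_cross (f g : R -> R3) (s : R) (l m : R3) : is_vderive f s l -> is_vderive g s m ->
  is_vderive (fun t => cross (f t) (g t)) s (plus (cross l (g s)) (cross (f s) m)).
Proof.
intros [h1 [h2 h3]] [k1 [k2 k3]].
assert (e1 := is_derive_minus (V := R_NormedModule) _ _ _ _ _
  (is_derive_prod _ _ _ _ _ h2 k3) (is_derive_prod _ _ _ _ _ h3 k2)).
assert (e2 := is_derive_minus (V := R_NormedModule) _ _ _ _ _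
  (is_derive_prod _ _ _ _ _ h3 k1) (is_derive_prod _ _ _ _ _ h1 k3)).
assert (e3 := is_derive_minus (V := R_NormedModule) _ _ _ _ _
  (is_derive_prod _ _ _ _ _ h1 k2) (is_derive_prod _ _ _ _ _ h2 k1)).
split; [|split];
  [match type of e1 with is_derive _ _ ?d => match goal with |- is_derive _ _ ?d' => replace d' with d; [exact e1|] end end
  |match type of e2 with is_derive _ _ ?d => match goal with |- is_derive _ _ ?d' => replace d' with d; [exact e2|] end end
  |match type of e3 with is_derive _ _ ?d => match goal with |- is_derive _ _ ?d' => replace d' with d; [exact e3|] end end];
  clear; coords; ring.
Qed.

Lemma is_vderive_scal (a : R -> R) (f : R -> R3) (s a' : R) (l : R3) :
  is_derive a s a' -> is_vderive f s l ->
  is_vderive (fun t => scal (a t) (f t)) s (plus (scal a' (f s)) (scal (a s) l)).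
Proof.
intros h [h1 [h2 h3]].
split; [|split]; [apply (is_derive_prod _ _ _ _ _ h h1)|apply (is_derive_prod _ _ _ _ _ h h2)|apply (is_derive_prod _ _ _ _ _ h h3)].
Qed.

Lemma is_vderive_plus (f g : R -> R3) (s : R) (l m : R3) : is_vderive f s l -> is_vderive g s m ->
  is_vderive (fun t => plus (f t) (g t)) s (plus l m).
Proof.
intros [h1 [h2 h3]] [k1 [k2 k3]].
split; [|split]; apply (is_derive_plus (V := R_NormedModule)); assumption.
Qed.

Lemma is_vderive_zero_const (f : R -> R3) : (forall s, is_vderive f s (0, 0, 0)) ->
  forall s t, f s = f t.
Proof.
intros h s t. apply R3_ext.
- apply (is_derive_zero_const (fun t => crd1 (f t))); intros; apply h.
- apply (is_derive_zero_const (fun t => crd2 (f t))); intros; apply h.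
- apply (is_derive_zero_const (fun t => crd3 (f t))); intros; apply h.
Qed.

Lemma dot_comm v w : dot v w = dot w v.
Proof. coords; ring. Qed.

Lemma dot_scal_l a v w : dot (scal a v) w = a * dot v w.
Proof. coords; ring. Qed.

Lemma dot_scal_r a v w : dot v (scal a w) = a * dot v w.
Proof. coords; ring. Qed.

Lemma dot_plus_l u v w : dot (plus u v) w = dot u w + dot v w.
Proof. coords; ring. Qed.

Lemma dot_minus_l u v w : dot (minus u v) w = dot u w - dot v w.
Proof. coords; ring. Qed.

Lemma lagrange u v w z : dot (cross u v) (cross w z) = dot u w * dot v z - dot u z * dot v w.
Proof. coords; ring. Qed.

Lemma cross_cross u v w : cross u (cross v w) = minus (scal (dot u w) v) (scal (dot u v) w).
Proof. apply R3_ext; coords; ring. Qed.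

Lemma dot_cross_l u v : dot u (cross u v) = 0.
Proof. coords; ring. Qed.

Lemma dot_cross_r u v : dot v (cross u v) = 0.
Proof. coords; ring. Qed.

Lemma frame_expansion (u v w : R3) : dot u u = 1 -> dot v v = 1 -> dot u v = 0 ->
  w = plus (plus (scal (dot w u) u) (scal (dot w v) v)) (scal (dot w (cross u v)) (cross u v)).
Proof.
intros hu hv huv.
assert (E : scal (dot u u * dot v v - dot u v * dot u v) w =
  plus (plus (scal (dot w u * dot v v - dot w v * dot u v) u)
             (scal (dot w v * dot u u - dot w u * dot u v) v)) (scal (dot w (cross u v)) (cross u v)))
  by (apply R3_ext; coords; ring).
rewrite hu, hv, huv, !Rmult_1_r, !Rmult_0_r, !Rminus_0_r in E.
rewrite <- E. apply R3_ext; coords; ring.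
Qed.

Lemma frame_parseval (u v w z : R3) : dot u u = 1 -> dot v v = 1 -> dot u v = 0 ->
  dot w z = dot w u * dot z u + dot w v * dot z v + dot w (cross u v) * dot z (cross u v).
Proof.
intros hu hv huv.
rewrite (frame_expansion u v w hu hv huv) at 1.
rewrite !dot_plus_l, !dot_scal_l, (dot_comm u z), (dot_comm v z), (dot_comm (cross u v) z). ring.
Qed.

Lemma frame_eq (u v w z : R3) : dot u u = 1 -> dot v v = 1 -> dot u v = 0 ->
  dot w u = dot z u -> dot w v = dot z v -> dot w (cross u v) = dot z (cross u v) -> w = z.
Proof.
intros hu hv huv h1 h2 h3.
rewrite (frame_expansion u v w hu hv huv), (frame_expansion u v z hu hv huv), h1, h2, h3. reflexivity.
Qed.

(** * Frenet equations along a unit speed curve on the sphere *)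

Section Sphere.
Context (rad : R) (hrad : 0 < rad) (x : R -> R3) (hx : spherical_curve rad x).

Lemma sphere_is_vderive s : is_vderive x s (tangent x s).
Proof. apply ex_derive_is_vderive, hx. Qed.

Lemma sphere_is_vderive2 s : is_vderive (tangent x) s (vDerive (tangent x) s).
Proof. apply ex_derive_is_vderive, hx. Qed.

Lemma dot_x_tangent s : dot (x s) (tangent x s) = 0.
Proof.
assert (h := is_derive_dot _ _ _ _ _ (sphere_is_vderive s) (sphere_is_vderive s)).
assert (h' : is_derive (fun t => dot (x t) (x t)) s 0).
{ eapply is_derive_ext; [|apply (is_derive_const (V := R_NormedModule) (rad ^ 2))].
  intros t; simpl. symmetry; apply (sc_on_sphere _ _ hx). }
apply is_derive_unique in h. apply is_derive_unique in h'. assert (E := eq_trans (eq_sym h) h').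
rewrite (dot_comm (tangent x s)) in E. lra.
Qed.

Lemma dot_accel_tangent s : dot (vDerive (tangent x) s) (tangent x s) = 0.
Proof.
assert (h := is_derive_dot _ _ _ _ _ (sphere_is_vderive2 s) (sphere_is_vderive2 s)).
assert (h' : is_derive (fun t => dot (tangent x t) (tangent x t)) s 0).
{ eapply is_derive_ext; [|apply (is_derive_const (V := R_NormedModule) 1)].
  intros t; simpl. symmetry; apply (sc_arc_length _ _ hx). }
apply is_derive_unique in h. apply is_derive_unique in h'. assert (E := eq_trans (eq_sym h) h').
rewrite (dot_comm (tangent x s)) in E. lra.
Qed.

Lemma dot_accel_x s : dot (vDerive (tangent x) s) (x s) = - 1.
Proof.
assert (h := is_derive_dot _ _ _ _ _ (sphere_is_vderive2 s) (sphere_is_vderive s)).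
assert (h' : is_derive (fun t => dot (tangent x t) (x t)) s 0).
{ eapply is_derive_ext; [|apply (is_derive_const (V := R_NormedModule) 0)].
  intros t; simpl. rewrite dot_comm. symmetry; apply dot_x_tangent. }
apply is_derive_unique in h. apply is_derive_unique in h'. assert (E := eq_trans (eq_sym h) h').
rewrite (sc_arc_length _ _ hx) in E. lra.
Qed.

Let unit_x s : R3 := scal (/ rad) (x s).

Lemma unit_x_frame s : dot (unit_x s) (unit_x s) = 1 /\ dot (unit_x s) (tangent x s) = 0 /\
  cross (unit_x s) (tangent x s) = normal rad x s.
Proof.
unfold unit_x. rewrite !dot_scal_l, dot_scal_r, (sc_on_sphere _ _ hx), dot_x_tangent.
repeat split.
- field; lra.
- ring.
- apply R3_ext; unfold normal; coords; ring.
Qed.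

Lemma sphere_frame_eq s (w z : R3) : dot w (x s) = dot z (x s) ->
  dot w (tangent x s) = dot z (tangent x s) -> dot w (normal rad x s) = dot z (normal rad x s) -> w = z.
Proof.
intros h1 h2 h3. destruct (unit_x_frame s) as [f1 [f2 f3]].
apply (frame_eq _ _ w z f1 (sc_arc_length _ _ hx s) f2).
- unfold unit_x. rewrite !dot_scal_r, h1; reflexivity.
- exact h2.
- rewrite f3; exact h3.
Qed.

Lemma sphere_parseval s (w z : R3) : dot w z = dot w (x s) * dot z (x s) / rad ^ 2
  + dot w (tangent x s) * dot z (tangent x s) + dot w (normal rad x s) * dot z (normal rad x s).
Proof.
destruct (unit_x_frame s) as [f1 [f2 f3]].
rewrite (frame_parseval _ _ w z f1 (sc_arc_length _ _ hx s) f2), f3.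
unfold unit_x. rewrite !dot_scal_r. field. lra.
Qed.

Lemma dot_normal_x s : dot (normal rad x s) (x s) = 0.
Proof. unfold normal. rewrite dot_scal_l, dot_comm, dot_cross_l; ring. Qed.

Lemma dot_normal_tangent s : dot (normal rad x s) (tangent x s) = 0.
Proof. unfold normal. rewrite dot_scal_l, dot_comm, dot_cross_r; ring. Qed.

Lemma dot_normal_normal s : dot (normal rad x s) (normal rad x s) = 1.
Proof.
unfold normal. rewrite dot_scal_l, dot_scal_r, lagrange, (sc_on_sphere _ _ hx),
  (sc_arc_length _ _ hx), dot_x_tangent. field; lra.
Qed.

Lemma dot_accel_normal s : dot (vDerive (tangent x) s) (normal rad x s) = kappa_g rad x s.
Proof.
unfold kappa_g, nablaTT. rewrite dot_minus_l, dot_scal_l, (dot_comm (x s) (normal rad x s)), dot_normal_x. ring.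
Qed.

(** The component along [x] comes from differentiating [dot T x = 0], the vanishing tangential one
    from the unit speed. *)
Lemma accel_eq s : vDerive (tangent x) s =
  plus (scal (- / rad ^ 2) (x s)) (scal (kappa_g rad x s) (normal rad x s)).
Proof.
apply (sphere_frame_eq s); rewrite dot_plus_l, !dot_scal_l.
- rewrite dot_accel_x, (sc_on_sphere _ _ hx), dot_normal_x. field; lra.
- rewrite dot_accel_tangent, dot_x_tangent, dot_normal_tangent. ring.
- rewrite dot_accel_normal, dot_normal_normal, (dot_comm (x s)), dot_normal_x. ring.
Qed.

Lemma normal_is_vderive s : is_vderive (normal rad x) s (scal (- kappa_g rad x s) (tangent x s)).
Proof.
assert (h := is_vderive_cross _ _ _ _ _ (sphere_is_vderive s) (sphere_is_vderive2 s)).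
assert (h2 := is_vderive_scal (fun _ => / rad) _ s 0 _ (is_derive_const (V := R_NormedModule) _ _) h).
match type of h2 with is_vderive _ _ ?l => replace (scal (- kappa_g rad x s) (tangent x s)) with l end; [exact h2|].
rewrite accel_eq.
assert (E : cross (x s) (normal rad x s) = scal (- rad) (tangent x s)).
{ replace (cross (x s) (normal rad x s)) with (scal (/ rad) (cross (x s) (cross (x s) (tangent x s))))
    by (apply R3_ext; unfold normal; coords; ring).
  rewrite cross_cross, dot_x_tangent, (sc_on_sphere _ _ hx).
  apply R3_ext; coords; field; lra. }
transitivity (scal (/ rad * kappa_g rad x s) (cross (x s) (normal rad x s))).
- apply R3_ext; coords; ring.
- rewrite E. apply R3_ext; coords; field; lra.
Qed.

End Sphere.

(** * The rotation vector *)

Lemma Rpower_neg_half (y : R) : 0 < y -> Rpower y (- (1 / 2)) = / sqrt y.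
Proof.
intros hy. rewrite Rpower_Ropp. f_equal. replace (1 / 2) with (/ 2) by field. apply Rpower_sqrt; assumption.
Qed.

Lemma cross_of_dots (rad : R) (x : R -> R3) (s b c : R) (w : R3) : 0 < rad -> spherical_curve rad x ->
  dot w (tangent x s) = b -> dot w (normal rad x s) = c ->
  cross w (x s) = plus (scal (rad * c) (tangent x s)) (scal (- rad * b) (normal rad x s)).
Proof.
intros hr hx hb hc.
apply (sphere_frame_eq rad hr x hx s); rewrite dot_plus_l, !dot_scal_l.
- rewrite (dot_comm (cross _ _)), dot_cross_r, (dot_normal_x rad x), (dot_comm (tangent x s)), (dot_x_tangent rad x hx). ring.
- rewrite (sc_arc_length _ _ hx), (dot_normal_tangent rad x).
  replace (dot (cross w (x s)) (tangent x s)) with (rad * dot w (normal rad x s)).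
  + rewrite hc; ring.
  + unfold normal; coords; field; lra.
- rewrite (dot_normal_normal rad hr x hx), (dot_comm (tangent x s)), (dot_normal_tangent rad x).
  unfold normal. rewrite dot_scal_r, lagrange, (dot_comm (x s) (tangent x s)).
  rewrite (dot_comm (tangent x s) (x s)), (dot_x_tangent rad x hx), (sc_on_sphere _ _ hx), hb. field; lra.
Qed.

Section Extremal.
Context (rad C1 : R) (hrad : 0 < rad) (x : R -> R3) (hx : extremal rad C1 x).

Let hs : spherical_curve rad x := ext_curve _ _ _ hx.
Let B : R -> R := Bfun rad x.
Let dB : R -> R := Derive B.

Lemma Bfun_pos s : 0 < Bfun rad x s.
Proof. apply exp_pos. Qed.

Lemma kappa_Bfun s : kappa_g rad x s = / (Bfun rad x s * sqrt (Bfun rad x s)).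
Proof.
assert (hk := ext_kappa_pos _ _ _ hx s).
rewrite <- Rpower_sqrt by apply Bfun_pos. unfold Bfun.
rewrite Rpower_mult, <- Rpower_plus.
replace (- (2 / 3) + - (2 / 3) * / 2) with (- (1)) by field.
rewrite Rpower_Ropp, Rpower_1, Rinv_inv by assumption. reflexivity.
Qed.

Lemma Bfun_is_derive s : is_derive (Bfun rad x) s (Derive (Bfun rad x) s).
Proof. apply Derive_correct, hx. Qed.

Lemma Bfun_is_derive2 s : is_derive (Derive (Bfun rad x)) s
  (C1 / 2 + 2 * / Bfun rad x s ^ 2 - / rad ^ 2 * Bfun rad x s).
Proof.
replace (C1 / 2 + 2 * / Bfun rad x s ^ 2 - / rad ^ 2 * Bfun rad x s) with (Derive (Derive (Bfun rad x)) s).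
- apply Derive_correct, hx.
- generalize (ext_ode _ _ _ hx s). lra.
Qed.

Lemma exists_first_integral : exists C2, first_integral rad C1 C2 x.
Proof.
set (F := fun s => dB s ^ 2 + B s ^ 2 / rad ^ 2 + 4 * / B s - C1 * B s).
assert (hF : forall s, is_derive F s 0).
{ intros s. assert (h1 := Bfun_is_derive s). assert (h2 := Bfun_is_derive2 s). assert (hp := Bfun_pos s).
  fold B in h1, h2, hp. fold dB in h1, h2.
  unfold F. auto_derive.
  - repeat split; try (eexists; eassumption). lra.
  - eval_derive h1. eval_derive h2. change (Derive B s) with (dB s). field; lra. }
exists (F 0). intros s.
assert (E := is_derive_zero_const F hF 0 s). unfold F in E. unfold F.
fold B. change (Derive B s) with (dB s). lra.
Qed.

(** The coefficients [a], [b], [c] make [om] constant. In its derivative the components along [x]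
    and the normal cancel by the Frenet equations and [kappa_g = B^(-3/2)]; the vanishing of the
    tangential component is the extremal equation itself. Hence [Jfield] is the cross product of a
    fixed vector with [x]. *)
Lemma exists_rotation_vector : exists w : R3, forall s,
  dot w (x s) = rad * (C1 / 2 - Bfun rad x s / rad ^ 2) /\
  dot w (tangent x s) = - Derive (Bfun rad x) s / rad /\
  dot w (normal rad x s) = - 2 / (rad * sqrt (Bfun rad x s)) /\
  Jfield rad x s = cross w (x s).
Proof.
set (a := fun s => (C1 / 2 - B s / rad ^ 2) / rad).
set (b := fun s => - dB s / rad).
set (c := fun s => - 2 / (rad * sqrt (B s))).
set (om := fun s => plus (plus (scal (a s) (x s)) (scal (b s) (tangent x s))) (scal (c s) (normal rad x s))).
assert (hom : forall s, is_vderive om s (0, 0, 0)).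
{ intros s. assert (h1 := Bfun_is_derive s). assert (h2 := Bfun_is_derive2 s). assert (hp := Bfun_pos s).
  fold B in h1, h2, hp. fold dB in h1, h2. change (Derive B s) with (dB s) in h1.
  assert (hq : 0 < sqrt (B s)) by (apply sqrt_lt_R0; assumption).
  assert (ha : is_derive a s (- dB s / rad ^ 3)).
  { unfold a. auto_derive; [eexists; eassumption|]. eval_derive h1. field; lra. }
  assert (hb : is_derive b s (- (C1 / 2 + 2 * / B s ^ 2 - / rad ^ 2 * B s) / rad)).
  { unfold b. auto_derive; [eexists; eassumption|]. eval_derive h2. field; lra. }
  assert (hc : is_derive c s (dB s / (rad * (B s * sqrt (B s))))).
  { unfold c. auto_derive.
    - repeat split; try (eexists; eassumption); try lra. apply Rgt_not_eq, Rmult_lt_0_compat; lra.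
    - eval_derive h1. replace (B s * sqrt (B s)) with (sqrt (B s) ^ 3).
      2:{ replace (sqrt (B s) ^ 3) with (sqrt (B s) ^ 2 * sqrt (B s)) by ring. rewrite pow2_sqrt; lra. }
      field; lra. }
  assert (h := is_vderive_plus _ _ _ _ _ (is_vderive_plus _ _ _ _ _
     (is_vderive_scal _ _ _ _ _ ha (sphere_is_vderive rad x hs s))
     (is_vderive_scal _ _ _ _ _ hb (sphere_is_vderive2 rad x hs s)))
     (is_vderive_scal _ _ _ _ _ hc (normal_is_vderive rad hrad x hs s))).
  match type of h with is_vderive _ _ ?l => replace ((0, 0, 0) : R3) with l; [exact h|] end.
  rewrite (accel_eq rad hrad x hs s), kappa_Bfun. fold B.
  assert (ek : forall u v w : R, (- dB s / rad ^ 3) * u + a s * v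
     + ((- (C1 / 2 + 2 * / B s ^ 2 - / rad ^ 2 * B s) / rad) * v
        + b s * (- / rad ^ 2 * u + / (B s * sqrt (B s)) * w))
     + (dB s / (rad * (B s * sqrt (B s))) * w + c s * (- / (B s * sqrt (B s)) * v)) = 0).
  { intros u v w.
    assert (e2 : / B s ^ 2 = / (sqrt (B s)) * / (B s * sqrt (B s))).
    { assert (eB : B s = sqrt (B s) * sqrt (B s)) by (symmetry; apply sqrt_sqrt; lra).
      set (r := sqrt (B s)) in *. rewrite eB. field; lra. }
    rewrite e2. unfold a, b, c. field. lra. }
  apply R3_ext.
  - rewrite <- (ek (crd1 (x s)) (crd1 (tangent x s)) (crd1 (normal rad x s))). reflexivity.
  - rewrite <- (ek (crd2 (x s)) (crd2 (tangent x s)) (crd2 (normal rad x s))). reflexivity.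
  - rewrite <- (ek (crd3 (x s)) (crd3 (tangent x s)) (crd3 (normal rad x s))). reflexivity. }
exists (om 0). intros s. rewrite (is_vderive_zero_const om hom 0 s).
assert (hp := Bfun_pos s). fold B in hp.
assert (hq : 0 < sqrt (B s)) by (apply sqrt_lt_R0; assumption).
assert (e1 : dot (om s) (x s) = rad * (C1 / 2 - B s / rad ^ 2)).
{ unfold om. rewrite !dot_plus_l, !dot_scal_l, (dot_comm (tangent x s)), (dot_x_tangent rad x hs),
    (dot_normal_x rad x), (sc_on_sphere _ _ hs). unfold a. field; lra. }
assert (e2 : dot (om s) (tangent x s) = - dB s / rad).
{ unfold om. rewrite !dot_plus_l, !dot_scal_l, (dot_x_tangent rad x hs),
    (dot_normal_tangent rad x), (sc_arc_length _ _ hs). unfold b. field; lra. }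
assert (e3 : dot (om s) (normal rad x s) = - 2 / (rad * sqrt (B s))).
{ unfold om. rewrite !dot_plus_l, !dot_scal_l, (dot_comm (x s)), (dot_comm (tangent x s)),
    (dot_normal_x rad x), (dot_normal_tangent rad x), (dot_normal_normal rad hrad x hs). unfold c. field; lra. }
repeat split; try assumption.
rewrite (cross_of_dots rad x s _ _ _ hrad hs e2 e3). unfold Jfield. fold B.
rewrite Rpower_neg_half by assumption. change (Derive B s) with (dB s).
f_equal; f_equal; field; lra.
Qed.

(** Parseval in the moving frame at one point, where the first integral eliminates the derivative of
    [B]. Positivity comes from the component along the normal, which never vanishes. *)
Lemma rotation_vector_norm (w : R3) (C2 : R) : first_integral rad C1 C2 x ->
  (forall s, dot w (x s) = rad * (C1 / 2 - Bfun rad x s / rad ^ 2) /\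
    dot w (tangent x s) = - Derive (Bfun rad x) s / rad /\
    dot w (normal rad x s) = - 2 / (rad * sqrt (Bfun rad x s)) /\ Jfield rad x s = cross w (x s)) ->
  dot w w = C1 ^ 2 / 4 + C2 / rad ^ 2 /\ 0 < dot w w.
Proof.
intros hC2 hw. destruct (hw 0) as [h1 [h2 [h3 _]]]. assert (hi := hC2 0).
assert (hp := Bfun_pos 0).
assert (hq : 0 < sqrt (Bfun rad x 0)) by (apply sqrt_lt_R0; assumption).
assert (hqq : sqrt (Bfun rad x 0) ^ 2 = Bfun rad x 0) by (apply pow2_sqrt; lra).
assert (E := sphere_parseval rad hrad x hs 0 w w). rewrite h1, h2, h3 in E.
split.
- rewrite E.
  replace (- 2 / (rad * sqrt (Bfun rad x 0)) * (- 2 / (rad * sqrt (Bfun rad x 0))))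
    with (4 / (rad ^ 2 * sqrt (Bfun rad x 0) ^ 2)) by (field; lra).
  rewrite hqq.
  replace (- Derive (Bfun rad x) 0 / rad * (- Derive (Bfun rad x) 0 / rad))
    with (Derive (Bfun rad x) 0 ^ 2 / rad ^ 2) by (field; lra).
  rewrite hi. field; lra.
- rewrite E.
  assert (0 < - 2 / (rad * sqrt (Bfun rad x 0)) * (- 2 / (rad * sqrt (Bfun rad x 0)))).
  { replace (- 2 / (rad * sqrt (Bfun rad x 0)) * (- 2 / (rad * sqrt (Bfun rad x 0))))
      with ((2 / (rad * sqrt (Bfun rad x 0))) ^ 2) by (field; lra).
    apply pow_lt, Rdiv_lt_0_compat; [lra|apply Rmult_lt_0_compat; lra]. }
  assert (0 <= rad * (C1 / 2 - Bfun rad x 0 / rad ^ 2) * (rad * (C1 / 2 - Bfun rad x 0 / rad ^ 2)) / rad ^ 2).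
  { apply Rmult_le_pos; [apply Rle_0_sqr|left; apply Rinv_0_lt_compat; nra]. }
  assert (h := Rle_0_sqr (- Derive (Bfun rad x) 0 / rad)). unfold Rsqr in h. lra.
Qed.

(** If [d] is parallel to [x] along the curve, differentiation makes it parallel to the tangent as
    well, so [d = 0]. This ensures that all frames allowed by [axis_frame] share one axis and one
    rate. *)
Lemma rotation_vector_unique (w v : R3) :
  (forall s, Jfield rad x s = cross w (x s)) -> (forall s, Jfield rad x s = cross v (x s)) -> w = v.
Proof.
intros hw hv.
set (d := minus w v).
assert (h0 : forall s, cross d (x s) = (0, 0, 0)).
{ intros s. assert (e : cross w (x s) = cross v (x s)) by (rewrite <- hw; apply hv).
  replace (cross d (x s)) with (minus (cross w (x s)) (cross v (x s))) by (apply R3_ext; unfold d; coords; ring).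
  rewrite e. apply R3_ext; coords; ring. }
assert (h1 : cross d (tangent x 0) = (0, 0, 0)).
{ assert (h := is_vderive_cross _ _ _ _ _ (is_vderive_const d 0) (sphere_is_vderive rad x hs 0)).
  assert (h' : is_vderive (fun t => cross d (x t)) 0 (0, 0, 0)).
  { eapply is_vderive_ext; [intros t; symmetry; apply h0|apply is_vderive_const]. }
  apply is_vderive_unique in h. apply is_vderive_unique in h'.
  rewrite h' in h. rewrite h. apply R3_ext; coords; ring. }
assert (z : forall u : R3, dot (0, 0, 0) u = 0) by (intros; coords; ring).
assert (hd : d = (0, 0, 0)).
{ apply (sphere_frame_eq rad hrad x hs 0); rewrite !z.
  - assert (e := lagrange d (tangent x 0) (x 0) (tangent x 0)).
    rewrite h1, z, (sc_arc_length _ _ hs), (dot_comm (tangent x 0) (x 0)), (dot_x_tangent rad x hs) in e. lra.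
  - assert (e := lagrange d (x 0) (tangent x 0) (x 0)).
    rewrite h0, z, (sc_on_sphere _ _ hs), (dot_x_tangent rad x hs) in e.
    assert (0 < rad ^ 2) by nra. nra.
  - replace (dot d (normal rad x 0)) with (/ rad * dot (cross d (x 0)) (tangent x 0)) by (unfold normal; coords; ring).
    rewrite h0, z; ring. }
assert (e1 := f_equal crd1 hd). assert (e2 := f_equal crd2 hd). assert (e3 := f_equal crd3 hd).
apply R3_ext; unfold d in *; coords; lra.
Qed.

End Extremal.

(** * The azimuth *)

(** [theta] is the integral of the angular form. The unit vector along [(u, v)], written in the
    basis rotated by [theta], has zero derivative, so it keeps its initial value [(1, 0)]. *)
Lemma polar_lift_exists (u v du dv : R -> R) :
  (forall s, is_derive u s (du s)) -> (forall s, is_derive v s (dv s)) ->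
  (forall s, 0 < u s ^ 2 + v s ^ 2) ->
  (forall s, continuous (fun s => (u s * dv s - v s * du s) / (u s ^ 2 + v s ^ 2)) s) ->
  0 < u 0 -> v 0 = 0 ->
  exists theta, (forall s, is_derive theta s ((u s * dv s - v s * du s) / (u s ^ 2 + v s ^ 2))) /\
    forall s, u s = sqrt (u s ^ 2 + v s ^ 2) * cos (theta s) /\
              v s = sqrt (u s ^ 2 + v s ^ 2) * sin (theta s).
Proof.
intros hu hv hpos hc u0 v0.
set (W := fun s => (u s * dv s - v s * du s) / (u s ^ 2 + v s ^ 2)) in *.
set (theta := fun s => RInt W 0 s).
assert (ht : forall s, is_derive theta s (W s)).
{ intros s. apply (is_derive_RInt W theta 0); [|apply hc].
  apply filter_forall. intros y. apply (RInt_correct (V := R_CompleteNormedModule)), ex_RInt_cont, hc. }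
exists theta. split; [exact ht|].
assert (hr : forall s, 0 < sqrt (u s ^ 2 + v s ^ 2)) by (intros; apply sqrt_lt_R0, hpos).
assert (er : forall s, sqrt (u s ^ 2 + v s ^ 2) ^ 2 = u s ^ 2 + v s ^ 2)
  by (intros s; apply pow2_sqrt; left; apply hpos).
assert (hdr : forall s, is_derive (fun s => sqrt (u s ^ 2 + v s ^ 2)) s
   ((u s * du s + v s * dv s) / sqrt (u s ^ 2 + v s ^ 2))).
{ intros s. assert (h := hr s). assert (h1 := hpos s). assert (hus := hu s). assert (hvs := hv s).
  assert (hsq : is_derive (fun s => u s ^ 2 + v s ^ 2) s (2 * (u s * du s + v s * dv s))).
  { auto_derive; [repeat split; eexists; eassumption|]. eval_derive hus. eval_derive hvs. ring. }
  assert (hd := is_derive_sqrt _ _ _ hsq h1).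
  match type of hd with is_derive _ _ ?d => replace ((u s * du s + v s * dv s) / sqrt (u s ^ 2 + v s ^ 2)) with d; [exact hd|] end.
  field. lra. }
set (r := fun s => sqrt (u s ^ 2 + v s ^ 2)) in *.
assert (hr' : forall s, r s <> 0) by (intros; apply Rgt_not_eq, hr).
assert (hW : forall s, W s * r s ^ 2 = u s * dv s - v s * du s).
{ intros s. unfold r. rewrite er. unfold W. field. apply Rgt_not_eq, hpos. }
assert (er' : forall s, r s ^ 2 = u s ^ 2 + v s ^ 2) by exact er.
assert (t0 : theta 0 = 0) by (exact (RInt_point (V := R_CompleteNormedModule) 0 W)).
assert (r0 : r 0 = u 0).
{ unfold r. rewrite v0. replace (u 0 ^ 2 + 0 ^ 2) with (u 0 ^ 2) by ring. apply sqrt_pow2; lra. }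
change (forall s, u s = r s * cos (theta s) /\ v s = r s * sin (theta s)).
assert (hdr' : forall s, is_derive r s ((u s * du s + v s * dv s) / r s)) by exact hdr.
clearbody r theta W. clear er hdr.
assert (hf : forall s, is_derive (fun s => (u s * cos (theta s) + v s * sin (theta s)) / r s) s 0).
{ intros s. assert (h0 := hr' s). assert (h1 := hW s). assert (h2 := er' s).
  assert (hus := hu s). assert (hvs := hv s). assert (hts := ht s). assert (hrs := hdr' s).
  auto_derive; [repeat split; try (eexists; eassumption); assumption|].
  eval_derive (hu s). eval_derive (hv s). eval_derive (ht s).
  replace (Derive (fun x : R => r x) s) with ((u s * du s + v s * dv s) / r s)
    by (symmetry; apply is_derive_unique; exact hrs).
  apply Rmult_eq_reg_r with (r s ^ 4); [|apply pow_nonzero; assumption].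
  match goal with |- ?l = _ => transitivity
    ((du s * cos (theta s) + dv s * sin (theta s)) * r s ^ 2 * r s + (- u s * sin (theta s) + v s * cos (theta s)) * (W s * r s ^ 2) * r s
      - (u s * cos (theta s) + v s * sin (theta s)) * (u s * du s + v s * dv s) * r s) end; [field; assumption|].
  rewrite h1, h2. ring. }
assert (hg : forall s, is_derive (fun s => (v s * cos (theta s) - u s * sin (theta s)) / r s) s 0).
{ intros s. assert (h0 := hr' s). assert (h1 := hW s). assert (h2 := er' s).
  assert (hus := hu s). assert (hvs := hv s). assert (hts := ht s). assert (hrs := hdr' s).
  auto_derive; [repeat split; try (eexists; eassumption); assumption|].
  eval_derive (hu s). eval_derive (hv s). eval_derive (ht s).
  replace (Derive (fun x : R => r x) s) with ((u s * du s + v s * dv s) / r s)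
    by (symmetry; apply is_derive_unique; exact hrs).
  apply Rmult_eq_reg_r with (r s ^ 4); [|apply pow_nonzero; assumption].
  match goal with |- ?l = _ => transitivity
    ((dv s * cos (theta s) - du s * sin (theta s)) * r s ^ 2 * r s + (- v s * sin (theta s) - u s * cos (theta s)) * (W s * r s ^ 2) * r s
      - (v s * cos (theta s) - u s * sin (theta s)) * (u s * du s + v s * dv s) * r s) end; [field; assumption|].
  rewrite h1, h2. ring. }
intros s.
assert (ef := is_derive_zero_const _ hf s 0). assert (eg := is_derive_zero_const _ hg s 0).
cbv beta in ef, eg. rewrite t0, cos_0, sin_0, r0, v0 in ef, eg.
assert (ef' : u s * cos (theta s) + v s * sin (theta s) = r s).
{ transitivity ((u s * cos (theta s) + v s * sin (theta s)) / r s * r s); [field; apply hr'|]. rewrite ef. field; lra. }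
assert (eg' : v s * cos (theta s) - u s * sin (theta s) = 0).
{ transitivity ((v s * cos (theta s) - u s * sin (theta s)) / r s * r s); [field; apply hr'|]. rewrite eg. field; lra. }
assert (hsc := sin2_cos2_pow (theta s)).
rewrite <- ef'.
split.
- transitivity (u s * (sin (theta s) ^ 2 + cos (theta s) ^ 2) + sin (theta s) * (v s * cos (theta s) - u s * sin (theta s)));
    [rewrite hsc, eg'; ring|ring].
- transitivity (v s * (sin (theta s) ^ 2 + cos (theta s) ^ 2) - cos (theta s) * (v s * cos (theta s) - u s * sin (theta s)));
    [rewrite hsc, eg'; ring|ring].
Qed.

(** A merely continuous determination is automatically differentiable: as long as it moves by less
    than [PI / 2] it equals [theta s] plus the arctangent of an explicit differentiable quotient. *)
Lemma polar_lift_derive (u v theta : R -> R) (s du dv : R) :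
  is_derive u s du -> is_derive v s dv -> continuous theta s ->
  (forall t, exists r, 0 < r /\ u t = r * cos (theta t) /\ v t = r * sin (theta t)) ->
  is_derive theta s ((u s * dv - v s * du) / (u s ^ 2 + v s ^ 2)).
Proof.
intros hu hv hc hl.
assert (hpi := PI_RGT_0).
destruct (hl s) as [r [hr [us vs]]].
assert (hsc := sin2_cos2_pow (theta s)).
assert (e0 : u s ^ 2 + v s ^ 2 = r ^ 2).
{ rewrite us, vs. replace ((r * cos (theta s)) ^ 2 + (r * sin (theta s)) ^ 2)
    with (r ^ 2 * (sin (theta s) ^ 2 + cos (theta s) ^ 2)) by ring. rewrite hsc; ring. }
assert (hp : 0 < u s * u s + v s * v s) by (assert (0 < r ^ 2) by (apply pow_lt; lra); lra).
set (F := fun t => theta s + atan ((v t * u s - u t * v s) / (u t * u s + v t * v s))).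
assert (hF : is_derive F s ((u s * dv - v s * du) / (u s ^ 2 + v s ^ 2))).
{ unfold F. auto_derive.
  - repeat split; try (eexists; eassumption). lra.
  - eval_derive hu. eval_derive hv. field. split; [lra|].
    replace ((v s * u s - u s * v s)) with 0 by ring. nra. }
apply is_derive_ext_loc with (2 := hF).
assert (hloc := proj1 (filterlim_locally (F := locally s) _ _) hc (mkposreal (PI / 2) ltac:(lra))).
revert hloc. apply filter_imp. intros t ht.
assert (hd : - (PI / 2) < theta t - theta s < PI / 2) by (apply Rabs_def2 in ht; unfold minus, plus, opp in ht; simpl in ht; lra).
destruct (hl t) as [r' [hr' [ut vt]]].
unfold F.
assert (hcos : 0 < cos (theta t - theta s)) by (apply cos_gt_0; lra).
replace ((v t * u s - u t * v s) / (u t * u s + v t * v s)) with (tan (theta t - theta s)).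
- rewrite atan_tan by lra. apply Rplus_minus.
- unfold tan. rewrite us, vs, ut, vt. rewrite sin_minus. rewrite cos_minus in *. field.
  split; [|lra].
  replace (r' * cos (theta t) * (r * cos (theta s)) + r' * sin (theta t) * (r * sin (theta s)))
    with (r' * r * (cos (theta t) * cos (theta s) + sin (theta t) * sin (theta s))) by ring.
  apply Rgt_not_eq. repeat apply Rmult_lt_0_compat; assumption.
Qed.

Section Azimuth.
Context (rad C1 C2 : R) (hrad : 0 < rad) (x : R -> R3) (hx : extremal rad C1 x)
  (hC2 : first_integral rad C1 C2 x).

Let hs : spherical_curve rad x := ext_curve _ _ _ hx.

Definition axis_rate : R := sqrt (C1 ^ 2 / 4 + C2 / rad ^ 2).

Lemma axis_frame_rotation e1 e2 e3 : axis_frame rad x e1 e2 e3 ->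
  0 < axis_rate /\ forall s,
  axis_rate * dot (x s) e3 = rad * (C1 / 2 - Bfun rad x s / rad ^ 2) /\
  axis_rate * dot (tangent x s) e3 = - Derive (Bfun rad x) s / rad /\
  axis_rate * dot (normal rad x s) e3 = - 2 / (rad * sqrt (Bfun rad x s)).
Proof.
intros [h1 [h2 [h12 [h3 [c [hc hJ]]]]]].
destruct (exists_rotation_vector rad C1 hrad x hx) as [w hw].
destruct (rotation_vector_norm rad C1 hrad x hx w C2 hC2 hw) as [hn hpos].
assert (ew : w = scal c e3) by (apply (rotation_vector_unique rad C1 hrad x hx); [apply hw|exact hJ]).
assert (h33 : dot e3 e3 = 1) by (rewrite <- h3, lagrange, h1, h2, h12; ring).
assert (ec : axis_rate = c).
{ unfold axis_rate. rewrite <- hn, ew, dot_scal_l, dot_scal_r, h33.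
  replace (c * (c * 1)) with (c ^ 2) by ring. apply sqrt_pow2; lra. }
rewrite ec. split; [assumption|]. intros s. destruct (hw s) as [a1 [a2 [a3 _]]].
rewrite ew, dot_scal_l, dot_comm in a1. rewrite ew, dot_scal_l, dot_comm in a2.
rewrite ew, dot_scal_l, dot_comm in a3. auto.
Qed.

Lemma dot_axis_pos s : 0 < Derive (Bfun rad x) s ^ 2 + 4 / Bfun rad x s.
Proof.
apply Rplus_le_lt_0_compat; [apply pow2_ge_0|]. apply Rdiv_lt_0_compat; [lra|apply Bfun_pos].
Qed.

(** The first right-hand side is the squared length of [Jfield]. As it is positive, the curve never
    meets the axis and the azimuth makes sense everywhere. *)
Lemma frame_polar e1 e2 e3 s : axis_frame rad x e1 e2 e3 ->
  axis_rate ^ 2 * (dot (x s) e1 ^ 2 + dot (x s) e2 ^ 2) = Derive (Bfun rad x) s ^ 2 + 4 / Bfun rad x s /\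
  axis_rate * (dot (x s) e1 * dot (tangent x s) e2 - dot (x s) e2 * dot (tangent x s) e1)
    = - 2 / sqrt (Bfun rad x s).
Proof.
intros hf. destruct (axis_frame_rotation _ _ _ hf) as [hr hrot].
destruct (hrot s) as [a1 [a2 a3]]. destruct hf as [h1 [h2 [h12 [h3 _]]]].
assert (hp := Bfun_pos rad x s).
assert (hq : 0 < sqrt (Bfun rad x s)) by (apply sqrt_lt_R0; assumption).
split.
- assert (E := frame_parseval e1 e2 (x s) (x s) h1 h2 h12). rewrite h3, (sc_on_sphere _ _ hs) in E.
  assert (ec : axis_rate ^ 2 = C1 ^ 2 / 4 + C2 / rad ^ 2).
  { unfold axis_rate. apply pow2_sqrt. unfold axis_rate in hr.
    apply Rnot_lt_le; intros hneg. rewrite sqrt_neg_0 in hr; lra. }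
  replace (dot (x s) e1 ^ 2 + dot (x s) e2 ^ 2) with (rad ^ 2 - dot (x s) e3 ^ 2) by (rewrite E; ring).
  replace (axis_rate ^ 2 * (rad ^ 2 - dot (x s) e3 ^ 2)) with (axis_rate ^ 2 * rad ^ 2 - (axis_rate * dot (x s) e3) ^ 2) by ring.
  rewrite a1, ec, (hC2 s). field. lra.
- replace (dot (x s) e1 * dot (tangent x s) e2 - dot (x s) e2 * dot (tangent x s) e1)
    with (rad * dot (normal rad x s) e3).
  + replace (axis_rate * (rad * dot (normal rad x s) e3)) with (rad * (axis_rate * dot (normal rad x s) e3)) by ring.
    rewrite a3. field; lra.
  + rewrite <- h3. unfold normal. rewrite dot_scal_l, lagrange. field; lra.
Qed.

(** The value is [axis_rate] times the tangential component of [Jfield] over its squared length. It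
    is negative because [Jfield] points towards increasing azimuth while its tangential component is
    negative. *)
Definition azimuth_speed (s : R) : R :=
  - 2 * axis_rate / (sqrt (Bfun rad x s) * (Derive (Bfun rad x) s ^ 2 + 4 / Bfun rad x s)).

Lemma frame_polar_speed e1 e2 e3 s : axis_frame rad x e1 e2 e3 ->
  (dot (x s) e1 * dot (tangent x s) e2 - dot (x s) e2 * dot (tangent x s) e1)
    / (dot (x s) e1 ^ 2 + dot (x s) e2 ^ 2) = azimuth_speed s.
Proof.
intros hf. destruct (axis_frame_rotation _ _ _ hf) as [hr _].
destruct (frame_polar _ _ _ s hf) as [p1 p2]. assert (hp := dot_axis_pos s).
assert (hB := Bfun_pos rad x s).
assert (hq : 0 < sqrt (Bfun rad x s)) by (apply sqrt_lt_R0; assumption).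
unfold azimuth_speed. rewrite <- p1 in *.
set (n := dot (x s) e1 ^ 2 + dot (x s) e2 ^ 2) in *.
assert (hn : n <> 0) by (intros E; rewrite E in hp; lra).
set (m := dot (x s) e1 * _ - _) in *.
replace (m / n) with (axis_rate * m / (axis_rate * n)) by (field; lra).
rewrite p2. field. lra.
Qed.

Lemma frame_is_derive e s : is_derive (fun t => dot (x t) e) s (dot (tangent x s) e).
Proof.
assert (h := is_derive_dot _ _ _ _ _ (sphere_is_vderive rad x hs s) (is_vderive_const e s)).
replace (dot (tangent x s) e) with (dot (tangent x s) e + dot (x s) (0, 0, 0)); [exact h|].
coords; ring.
Qed.

Lemma azimuth_derive e1 e2 e3 theta s : axis_frame rad x e1 e2 e3 -> azimuth x e1 e2 theta ->
  is_derive theta s (azimuth_speed s).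
Proof.
intros hf [ht1 ht2]. rewrite <- (frame_polar_speed _ _ _ s hf).
apply (polar_lift_derive (fun t => dot (x t) e1) (fun t => dot (x t) e2)); auto using frame_is_derive.
Qed.

Lemma continuous_azimuth_speed s : continuous azimuth_speed s.
Proof.
assert (hB := Bfun_pos rad x s).
assert (hq : 0 < sqrt (Bfun rad x s)) by (apply sqrt_lt_R0; assumption).
assert (hp := dot_axis_pos s).
apply continuous_of_ex_derive. unfold azimuth_speed.
assert (h1 := Bfun_is_derive rad C1 x hx s). assert (h2 := Bfun_is_derive2 rad C1 x hx s).
auto_derive. repeat split; try (eexists; eassumption); try lra.
apply Rgt_not_eq, Rmult_lt_0_compat; [assumption|]. simpl in hp. exact hp.
Qed.

(** Taking [e1] along the part of [x 0] orthogonal to the axis makes the initial azimuth zero, as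
    [polar_lift_exists] requires. This part is nonzero because the rotation vector has a nonzero
    component along the normal at [x 0]. *)
Lemma exists_azimuth : exists e1 e2 e3 theta, axis_frame rad x e1 e2 e3 /\ azimuth x e1 e2 theta /\
  forall s, dot (x s) e1 = sqrt (dot (x s) e1 ^ 2 + dot (x s) e2 ^ 2) * cos (theta s) /\
            dot (x s) e2 = sqrt (dot (x s) e1 ^ 2 + dot (x s) e2 ^ 2) * sin (theta s).
Proof.
destruct (exists_rotation_vector rad C1 hrad x hx) as [w hw].
destruct (rotation_vector_norm rad C1 hrad x hx w C2 hC2 hw) as [hn hpos].
set (c := sqrt (dot w w)). assert (hc : 0 < c) by (apply sqrt_lt_R0; assumption).
assert (hcc : c ^ 2 = dot w w) by (apply pow2_sqrt; lra).
set (e3 := scal (/ c) w).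
assert (h33 : dot e3 e3 = 1) by (unfold e3; rewrite dot_scal_l, dot_scal_r, <- hcc; field; lra).
set (h := dot (x 0) e3).
assert (hr : 0 < rad ^ 2 - h ^ 2).
{ destruct (hw 0) as [_ [_ [a3 _]]].
  assert (hB := Bfun_pos rad x 0).
  assert (hq : 0 < sqrt (Bfun rad x 0)) by (apply sqrt_lt_R0; assumption).
  assert (E := sphere_parseval rad hrad x hs 0 e3 e3). rewrite h33 in E.
  rewrite (dot_comm e3 (x 0)) in E. fold h in E.
  assert (0 < dot e3 (normal rad x 0) * dot e3 (normal rad x 0)).
  { unfold e3. rewrite dot_scal_l, a3.
    replace (/ c * (- 2 / (rad * sqrt (Bfun rad x 0))) * (/ c * (- 2 / (rad * sqrt (Bfun rad x 0)))))
      with ((/ c * (2 / (rad * sqrt (Bfun rad x 0)))) ^ 2) by (field; lra).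
    apply pow_lt, Rmult_lt_0_compat; [apply Rinv_0_lt_compat; lra|].
    apply Rdiv_lt_0_compat; [lra|apply Rmult_lt_0_compat; lra]. }
  assert (h' := Rle_0_sqr (dot e3 (tangent x 0))). unfold Rsqr in h'.
  assert (hr2 : 0 < rad ^ 2) by nra.
  assert (h * h / rad ^ 2 < 1) by lra.
  assert (h * h / rad ^ 2 * rad ^ 2 < 1 * rad ^ 2) by (apply Rmult_lt_compat_r; lra).
  replace (h * h / rad ^ 2 * rad ^ 2) with (h ^ 2) in * by (field; lra). lra. }
set (r := sqrt (rad ^ 2 - h ^ 2)). assert (hr0 : 0 < r) by (apply sqrt_lt_R0; assumption).
assert (hrr : r ^ 2 = rad ^ 2 - h ^ 2) by (apply pow2_sqrt; lra).
set (e1 := scal (/ r) (minus (x 0) (scal h e3))).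
set (e2 := cross e3 e1).
assert (h13 : dot e1 e3 = 0).
{ unfold e1. rewrite dot_scal_l, dot_minus_l, dot_scal_l, h33. fold h. ring. }
assert (h11 : dot e1 e1 = 1).
{ unfold e1 at 1. rewrite dot_scal_l, dot_minus_l, dot_scal_l, (dot_comm e3), h13.
  unfold e1. rewrite dot_scal_r, dot_comm, dot_minus_l, dot_scal_l, (sc_on_sphere _ _ hs).
  rewrite (dot_comm e3). fold h. replace (rad ^ 2 - h * h) with (r ^ 2) by (rewrite hrr; ring). field; lra. }
assert (h22 : dot e2 e2 = 1) by (unfold e2; rewrite lagrange, h33, h11, (dot_comm e3), h13; ring).
assert (h12 : dot e1 e2 = 0) by (unfold e2; apply dot_cross_r).
assert (hcr : cross e1 e2 = e3).
{ unfold e2. rewrite cross_cross, h11, h13. apply R3_ext; coords; ring. }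
assert (hf : axis_frame rad x e1 e2 e3).
{ repeat split; try assumption. exists c. split; [assumption|]. intros s.
  destruct (hw s) as [_ [_ [_ a4]]]. rewrite a4. f_equal. unfold e3. apply R3_ext; coords; field; lra. }
assert (hx0 : x 0 = plus (scal r e1) (scal h e3)) by (unfold e1; apply R3_ext; coords; field; lra).
destruct (polar_lift_exists (fun t => dot (x t) e1) (fun t => dot (x t) e2)
   (fun t => dot (tangent x t) e1) (fun t => dot (tangent x t) e2)) as [theta [t1 t2]].
- apply frame_is_derive.
- apply frame_is_derive.
- intros s. destruct (frame_polar _ _ _ s hf) as [p1 _]. destruct (axis_frame_rotation _ _ _ hf) as [ha _].
  assert (hp := dot_axis_pos s). rewrite <- p1 in hp. assert (0 < axis_rate ^ 2) by (apply pow_lt; lra). nra.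
- intros s. apply (continuous_ext azimuth_speed); [|apply continuous_azimuth_speed].
  intros t. symmetry; apply (frame_polar_speed _ _ _ t hf).
- rewrite hx0, dot_plus_l, !dot_scal_l, h11, (dot_comm e3), h13. lra.
- rewrite hx0, dot_plus_l, !dot_scal_l, h12. unfold e2. rewrite dot_cross_l. ring.
- exists e1, e2, e3, theta. split; [assumption|]. split; [|exact t2].
  split.
  + intros s. apply continuous_of_ex_derive. eexists; apply t1.
  + intros s. exists (sqrt (dot (x s) e1 ^ 2 + dot (x s) e2 ^ 2)). split; [|apply t2].
    destruct (frame_polar _ _ _ s hf) as [p1 _]. destruct (axis_frame_rotation _ _ _ hf) as [ha _].
    assert (hp := dot_axis_pos s). rewrite <- p1 in hp. assert (0 < axis_rate ^ 2) by (apply pow_lt; lra).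
    apply sqrt_lt_R0. nra.
Qed.

End Azimuth.

(** * Existence of extremal curves *)

Section Cylindrical.
Context (rad : R) (hrad : 0 < rad) (z z1 z2 th t t1 : R -> R)
  (hz : forall s, is_derive z s (z1 s)) (hz1 : forall s, is_derive z1 s (z2 s))
  (hth : forall s, is_derive th s (t s)) (ht : forall s, is_derive t s (t1 s))
  (heta : forall s, 0 < rad ^ 2 - z s ^ 2)
  (hunit : forall s, (rad ^ 2 - z s ^ 2) ^ 2 * t s ^ 2 = rad ^ 2 - z s ^ 2 - rad ^ 2 * z1 s ^ 2).

Definition cyl_radius (s : R) : R := sqrt (rad ^ 2 - z s ^ 2).

(** Height and azimuth are prescribed and the radius is forced by the sphere; [hunit] is then the
    unit speed condition multiplied by the squared radius. *)
Definition cyl_curve (s : R) : R3 := (cyl_radius s * cos (th s), cyl_radius s * sin (th s), z s).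

Lemma cyl_radius_pos s : 0 < cyl_radius s.
Proof. apply sqrt_lt_R0, heta. Qed.

Lemma cyl_radius_sq s : cyl_radius s ^ 2 = rad ^ 2 - z s ^ 2.
Proof. apply pow2_sqrt; left; apply heta. Qed.

Definition cyl_radius1 (s : R) : R := - z s * z1 s / cyl_radius s.
Definition cyl_radius2 (s : R) : R :=
  - (z1 s ^ 2 + z s * z2 s) / cyl_radius s - z s ^ 2 * z1 s ^ 2 / cyl_radius s ^ 3.

Lemma cyl_radius_derive s : is_derive cyl_radius s (cyl_radius1 s).
Proof.
assert (hzs := hz s). assert (hp := heta s). assert (hr := cyl_radius_pos s).
assert (hsq : is_derive (fun s => rad ^ 2 - z s ^ 2) s (- 2 * z s * z1 s)).
{ auto_derive; [repeat split; eexists; eassumption|]. eval_derive hzs. ring. }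
assert (hd := is_derive_sqrt _ _ _ hsq hp).
match type of hd with is_derive _ _ ?d => replace (cyl_radius1 s) with d; [exact hd|] end.
unfold cyl_radius1. fold (cyl_radius s). field. lra.
Qed.

Lemma cyl_radius_derive2 s : is_derive cyl_radius1 s (cyl_radius2 s).
Proof.
assert (hzs := hz s). assert (hzs1 := hz1 s). assert (hr := cyl_radius_pos s).
assert (hrs := cyl_radius_derive s).
unfold cyl_radius1. auto_derive; [repeat split; try (eexists; eassumption); lra|].
eval_derive hzs. eval_derive hzs1. eval_derive hrs.
unfold cyl_radius1, cyl_radius2. field. lra.
Qed.

Definition cyl_tangent (s : R) : R3 :=
  (cyl_radius1 s * cos (th s) - cyl_radius s * t s * sin (th s),
   cyl_radius1 s * sin (th s) + cyl_radius s * t s * cos (th s), z1 s).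

Definition cyl_accel (s : R) : R3 :=
  ((cyl_radius2 s - cyl_radius s * t s ^ 2) * cos (th s) - (2 * cyl_radius1 s * t s + cyl_radius s * t1 s) * sin (th s),
   (cyl_radius2 s - cyl_radius s * t s ^ 2) * sin (th s) + (2 * cyl_radius1 s * t s + cyl_radius s * t1 s) * cos (th s), z2 s).

Lemma cyl_is_vderive s : is_vderive cyl_curve s (cyl_tangent s).
Proof.
assert (h1 := cyl_radius_derive s). assert (h2 := hth s).
split; [|split]; unfold crd1, crd2, crd3; simpl.
- auto_derive; [repeat split; eexists; eassumption|]. eval_derive h1. eval_derive h2. ring.
- auto_derive; [repeat split; eexists; eassumption|]. eval_derive h1. eval_derive h2. ring.
- apply hz.
Qed.

Lemma cyl_is_vderive2 s : is_vderive cyl_tangent s (cyl_accel s).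
Proof.
assert (h1 := cyl_radius_derive s). assert (h2 := hth s).
assert (h3 := cyl_radius_derive2 s). assert (h4 := ht s).
split; [|split]; unfold crd1, crd2, crd3; simpl.
- auto_derive; [repeat split; eexists; eassumption|]. eval_derive h1. eval_derive h2. eval_derive h3. eval_derive h4. ring.
- auto_derive; [repeat split; eexists; eassumption|]. eval_derive h1. eval_derive h2. eval_derive h3. eval_derive h4. ring.
- apply hz1.
Qed.

Lemma cyl_tangent_eq s : tangent cyl_curve s = cyl_tangent s.
Proof. apply is_vderive_unique, cyl_is_vderive. Qed.

Lemma cyl_tangent_vderive s : is_vderive (tangent cyl_curve) s (cyl_accel s).
Proof.
apply (is_vderive_ext cyl_tangent); [intros; symmetry; apply cyl_tangent_eq|apply cyl_is_vderive2].
Qed.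

Lemma cyl_spherical : spherical_curve rad cyl_curve.
Proof.
split; intros s.
- assert (hsc := sin2_cos2_pow (th s)). assert (hr := cyl_radius_sq s).
  transitivity (cyl_radius s ^ 2 * (sin (th s) ^ 2 + cos (th s) ^ 2) + z s ^ 2).
  + unfold cyl_curve; coords; ring.
  + rewrite hsc, hr; ring.
- eapply is_vderive_ex_derive, cyl_is_vderive.
- rewrite cyl_tangent_eq. assert (hsc := sin2_cos2_pow (th s)). assert (hr := cyl_radius_sq s).
  assert (hp := cyl_radius_pos s). assert (hu := hunit s). assert (he := heta s).
  transitivity ((cyl_radius1 s ^ 2 + cyl_radius s ^ 2 * t s ^ 2) * (sin (th s) ^ 2 + cos (th s) ^ 2) + z1 s ^ 2).
  + unfold cyl_tangent; coords; ring.
  + rewrite hsc. unfold cyl_radius1.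
    replace ((- z s * z1 s / cyl_radius s) ^ 2) with (z s ^ 2 * z1 s ^ 2 / cyl_radius s ^ 2) by (field; lra).
    rewrite hr. set (e := rad ^ 2 - z s ^ 2) in *.
    replace ((z s ^ 2 * z1 s ^ 2 / e + e * t s ^ 2) * 1 + z1 s ^ 2)
      with ((e ^ 2 * t s ^ 2 + (z s ^ 2 + e) * z1 s ^ 2) / e) by (field; lra).
    rewrite hu. unfold e. field. unfold e in he. lra.
- eapply is_vderive_ex_derive, cyl_tangent_vderive.
Qed.

(** The azimuth drops out by rotational symmetry, and [hunit] turns the term cubic in [t] into a
    linear one. *)
Lemma cyl_kappa s : kappa_g rad cyl_curve s =
  rad * (t s * z2 s - z1 s * t1 s + 2 * z s * z1 s ^ 2 * t s / (rad ^ 2 - z s ^ 2)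
    + z s * t s / rad ^ 2).
Proof.
assert (hsc := sin2_cos2_pow (th s)). assert (hr := cyl_radius_sq s).
assert (hp := cyl_radius_pos s). assert (hu := hunit s). assert (he := heta s).
rewrite <- (dot_accel_normal rad).
rewrite (is_vderive_unique _ _ _ (cyl_tangent_vderive s)).
unfold normal. rewrite dot_scal_r, cyl_tangent_eq.
set (r := cyl_radius s) in *.
transitivity (/ rad * ((sin (th s) ^ 2 + cos (th s) ^ 2) * (r ^ 2 * t s * z2 s
   - z1 s * (2 * (r * cyl_radius1 s) * t s + r ^ 2 * t1 s)
   + z s * (2 * cyl_radius1 s ^ 2 * t s + r * cyl_radius1 s * t1 s - r * cyl_radius2 s * t s + r ^ 2 * t s ^ 3)))).
{ unfold cyl_accel, cyl_curve, cyl_tangent. fold r. coords. ring. }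
rewrite hsc.
replace (r * cyl_radius1 s) with (- z s * z1 s) by (unfold cyl_radius1; fold r; field; lra).
replace (cyl_radius1 s ^ 2) with (z s ^ 2 * z1 s ^ 2 / r ^ 2) by (unfold cyl_radius1; fold r; field; lra).
replace (r * cyl_radius2 s) with (- (z1 s ^ 2 + z s * z2 s) - z s ^ 2 * z1 s ^ 2 / r ^ 2)
  by (unfold cyl_radius2; fold r; field; lra).
rewrite hr. set (e := rad ^ 2 - z s ^ 2) in *.
replace (e * t s ^ 3) with (e ^ 2 * t s ^ 2 * t s / e) by (field; lra).
rewrite hu. unfold e in *. field. lra.
Qed.

End Cylindrical.

Section Construction.
Context (p q k : R) (H : admissible p q k) (phi : R -> R) (rho : R) (hphi : phase p q k phi rho).

Let hp : 0 < p := adm_p _ _ _ H.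
Let hk : 0 < k := adm_k _ _ _ H.
Let hq : p + k < q := adm_q _ _ _ H.

(** The rotation vector determines the height and azimuth speed of an extremal curve from its
    profile. Taking these formulas as a definition gives a unit speed curve, and the two
    differential relations for [B] show that its curvature is [B^(-3/2)]. *)
Lemma exists_extremal :
  exists x, extremal (p * q * k / 2) (mu_of p q k / (p * q * k / 2) ^ 2) x /\
    first_integral (p * q * k / 2) (mu_of p q k / (p * q * k / 2) ^ 2) (lam_of p q k / (p * q * k / 2) ^ 2) x.
Proof.
set (rad := p * q * k / 2). assert (hr : 0 < rad) by (apply (rad_pos p q k H)).
set (C1 := mu_of p q k / rad ^ 2). set (C2 := lam_of p q k / rad ^ 2).
set (B := fun s => prof p q k (phi s)). set (dB := fun s => prof_speed p q k (phi s)).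
assert (hB : forall s, 0 < B s) by (intros; apply prof_pos; exact H).
assert (h1 : forall s, is_derive B s (dB s)) by (intros; apply (phase_prof_derive p q k phi rho _ hphi)).
assert (h2 : forall s, is_derive dB s (C1 / 2 + 2 * / B s ^ 2 - / rad ^ 2 * B s))
  by (intros; apply (phase_prof_derive2 p q k H phi rho _ hphi)).
assert (h3 : forall s, dB s ^ 2 = C2 - B s ^ 2 / rad ^ 2 - 4 * / B s + C1 * B s)
  by (intros; apply (prof_speed_sq p q k H)).
(* The length of the future rotation vector: half the difference of the roots of [lam + mu B - B^2],
   divided by [rad ^ 2]. *)
set (c := (q ^ 2 - p ^ 2) / (2 * rad ^ 2)).
assert (hr2 : 0 < rad ^ 2) by (apply pow_lt; lra).
assert (hc : 0 < c) by (apply Rdiv_lt_0_compat; nra).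
assert (ec : c ^ 2 = C1 ^ 2 / 4 + C2 / rad ^ 2) by (unfold c, C1, C2, mu_of, lam_of; field; lra).
clearbody B dB C1 C2 c rad.
set (z := fun s => rad * (C1 / 2 - B s / rad ^ 2) / c).
set (z1 := fun s => - dB s / (rad * c)).
set (z2 := fun s => - (C1 / 2 + 2 * / B s ^ 2 - / rad ^ 2 * B s) / (rad * c)).
assert (hsq : forall s, 0 < sqrt (B s)) by (intros; apply sqrt_lt_R0, hB).
assert (eB : forall s, sqrt (B s) ^ 2 = B s) by (intros; apply pow2_sqrt; left; apply hB).
assert (heta : forall s, c ^ 2 * (rad ^ 2 - z s ^ 2) = dB s ^ 2 + 4 / B s).
{ intros s. transitivity (c ^ 2 * rad ^ 2 - (rad * (C1 / 2 - B s / rad ^ 2)) ^ 2); [unfold z; field; lra|].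
  rewrite ec, h3. assert (hb := hB s). field; lra. }
assert (hpos : forall s, 0 < dB s ^ 2 + 4 / B s).
{ intros s. apply Rplus_le_lt_0_compat; [apply pow2_ge_0|apply Rdiv_lt_0_compat; [lra|apply hB]]. }
assert (heta0 : forall s, 0 < rad ^ 2 - z s ^ 2).
{ intros s. assert (h := hpos s). rewrite <- heta in h. assert (0 < c ^ 2) by (apply pow_lt; lra). nra. }
set (t := fun s => - 2 / (c * sqrt (B s) * (rad ^ 2 - z s ^ 2))).
set (t1 := fun s => (dB s / (c * B s * sqrt (B s)) + 2 * z s * z1 s * t s) / (rad ^ 2 - z s ^ 2)).
assert (hz : forall s, is_derive z s (z1 s)).
{ intros s. assert (hd := h1 s). unfold z, z1. auto_derive; [eexists; eassumption|]. eval_derive hd. field; lra. }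
assert (hz1 : forall s, is_derive z1 s (z2 s)).
{ intros s. assert (hd := h2 s). unfold z1, z2. auto_derive; [eexists; eassumption|]. eval_derive hd.
  assert (hb := hB s). field; lra. }
assert (ez1 : forall s, dB s = - rad * c * z1 s) by (intros s; unfold z1; field; lra).
assert (ez : forall s, C1 / 2 - B s / rad ^ 2 = c * z s / rad) by (intros s; unfold z; field; lra).
assert (ez2 : forall s, C1 / 2 + 2 * / B s ^ 2 - / rad ^ 2 * B s = - rad * c * z2 s)
  by (intros s; assert (hb := hB s); unfold z2; field; lra).
clearbody z z1 z2.
assert (ht : forall s, is_derive t s (t1 s)).
{ intros s. assert (hd := h1 s). assert (hd' := hz s). assert (hb := hB s). assert (hs := hsq s). assert (he := heta0 s).
  unfold t. auto_derive.
  - repeat split; try (eexists; eassumption); try assumption.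
    apply Rgt_not_eq, Rmult_lt_0_compat; [apply Rmult_lt_0_compat; assumption|simpl in he; lra].
  - eval_derive hd. eval_derive hd'. unfold t1, t.
    replace (c * B s * sqrt (B s)) with (c * sqrt (B s) ^ 3)
      by (replace (sqrt (B s) ^ 3) with (sqrt (B s) ^ 2 * sqrt (B s)) by ring; rewrite eB; ring).
    field. repeat split; lra. }
assert (ct : forall s, continuous t s) by (intros s; apply continuous_of_ex_derive; eexists; apply ht).
set (th := fun s => RInt t 0 s).
assert (hth : forall s, is_derive th s (t s)).
{ intros s. apply (is_derive_RInt t th 0); [|apply ct].
  apply filter_forall. intros y. apply (RInt_correct (V := R_CompleteNormedModule)), ex_RInt_cont, ct. }
clearbody th.
assert (hunit : forall s, (rad ^ 2 - z s ^ 2) ^ 2 * t s ^ 2 = rad ^ 2 - z s ^ 2 - rad ^ 2 * z1 s ^ 2).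
{ intros s. assert (hb := hB s). assert (hs := hsq s). assert (he := heta0 s). assert (hh := heta s).
  transitivity (4 / (c ^ 2 * sqrt (B s) ^ 2)).
  - unfold t. field. repeat split; lra.
  - rewrite eB. apply Rmult_eq_reg_l with (c ^ 2); [|apply pow_nonzero; lra].
    replace (c ^ 2 * (rad ^ 2 - z s ^ 2 - rad ^ 2 * z1 s ^ 2))
      with (c ^ 2 * (rad ^ 2 - z s ^ 2) - (- rad * c * z1 s) ^ 2) by ring.
    rewrite hh, <- ez1. field; lra. }
set (x := cyl_curve rad z th).
assert (hx : spherical_curve rad x) by (exact (cyl_spherical rad z z1 z2 th t t1 hz hz1 hth ht heta0 hunit)).
assert (hkap : forall s, kappa_g rad x s = / (B s * sqrt (B s))).
{ intros s. unfold x. rewrite (cyl_kappa rad hr z z1 z2 th t t1 hz hz1 hth ht heta0 hunit).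
  assert (hb := hB s). assert (hs := hsq s). assert (he := heta0 s). assert (hh := heta s).
  set (e := rad ^ 2 - z s ^ 2) in *.
  transitivity (rad / (c ^ 2 * e * sqrt (B s)) * (/ rad * (2 * (C1 / 2 + 2 * / B s ^ 2 - / rad ^ 2 * B s)
      + dB s ^ 2 / B s - 2 * (C1 / 2 - B s / rad ^ 2)))).
  - rewrite ez2, ez. unfold t1, t, e. rewrite ez1. field. repeat split; unfold e in he; lra.
  - rewrite hh. assert (hp' := hpos s). field.
    repeat split; try lra. replace (dB s ^ 2 * B s + 4) with ((dB s ^ 2 + 4 / B s) * B s) by (field; lra).
    apply Rgt_not_eq, Rmult_lt_0_compat; lra. }
assert (hBf : forall s, Bfun rad x s = B s).
{ intros s. unfold Bfun. rewrite hkap. assert (hb := hB s).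
  rewrite <- (Rpower_sqrt (B s)) by assumption.
  rewrite <- (Rpower_1 (B s)) at 1 by assumption.
  rewrite <- Rpower_plus, <- Rpower_Ropp, Rpower_mult.
  replace (- (1 + / 2) * - (2 / 3)) with 1 by field. apply Rpower_1; assumption. }
assert (hdBf : forall s, is_derive (Bfun rad x) s (dB s)).
{ intros s. apply (is_derive_ext B); [intros; symmetry; apply hBf|apply h1]. }
assert (hddBf : forall s, is_derive (Derive (Bfun rad x)) s (C1 / 2 + 2 * / B s ^ 2 - / rad ^ 2 * B s)).
{ intros s. apply (is_derive_ext dB); [|apply h2]. intros u; symmetry; apply is_derive_unique, hdBf. }
exists x. split; [split|].
- assumption.
- intros s. rewrite hkap. apply Rinv_0_lt_compat, Rmult_lt_0_compat; [apply hB|apply hsq].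
- intros s; eexists; apply hdBf.
- intros s; eexists; apply hddBf.
- intros s. rewrite (is_derive_unique _ _ _ (hddBf s)), hBf. lra.
- intros s. rewrite (is_derive_unique _ _ _ (hdBf s)), hBf. apply h3.
Qed.

End Construction.

(** * The progression angle of an extremal curve *)

Lemma exists_polar_angle (a b r : R) : 0 < r -> a ^ 2 + b ^ 2 = r ^ 2 ->
  exists t, a = r * cos t /\ b = r * sin t.
Proof.
intros hr h.
assert (ha : -1 <= a / r <= 1).
{ assert (e : a / r * r = a) by (field; lra). set (u := a / r) in *.
  assert (h0 := pow2_ge_0 b). rewrite <- e in h.
  assert (hu : u ^ 2 <= 1).
  { apply Rmult_le_reg_r with (r ^ 2); [apply pow_lt; assumption|]. rewrite Rmult_1_l, <- Rpow_mult_distr. lra. }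
  split; nra. }
assert (e1 : cos (acos (a / r)) = a / r) by (apply cos_acos; exact ha).
assert (e2 : sin (acos (a / r)) = Rabs b / r).
{ rewrite sin_acos by exact ha.
  rewrite <- (sqrt_pow2 (Rabs b / r)).
  - f_equal. unfold Rsqr. replace ((Rabs b / r) ^ 2) with (b ^ 2 / r ^ 2) by (rewrite <- (pow2_abs b); field; lra).
    replace (b ^ 2) with (r ^ 2 - a ^ 2) by lra. field; lra.
  - apply Rmult_le_pos; [apply Rabs_pos|left; apply Rinv_0_lt_compat; lra]. }
destruct (Rle_lt_dec 0 b) as [hb|hb].
- exists (acos (a / r)). rewrite e1, e2, Rabs_pos_eq by assumption. split; field; lra.
- exists (- acos (a / r)). rewrite cos_neg, sin_neg, e1, e2, Rabs_left by assumption. split; field; lra.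
Qed.

Lemma cos_eq_1_multiple (y : R) : 0 <= y -> cos y = 1 -> exists n : nat, y = 2 * PI * INR n.
Proof.
intros hy hc. assert (hpi := PI_RGT_0).
destruct (nfloor_ex (y / (2 * PI))) as [n hn].
{ apply Rmult_le_pos; [assumption|left; apply Rinv_0_lt_compat; lra]. }
exists n.
set (y' := y - 2 * PI * INR n).
assert (hy' : 0 <= y' < 2 * PI).
{ assert (e : y / (2 * PI) * (2 * PI) = y) by (field; lra). unfold y'. split; nra. }
destruct (Rle_lt_or_eq_dec 0 y' (proj1 hy')) as [h|h]; [|unfold y' in h; lra].
assert (hlt := cos_1_between y' ltac:(lra)).
rewrite <- (cos_period y' n) in hlt.
replace (y' + 2 * INR n * PI) with y in hlt by (unfold y'; ring). lra.
Qed.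

Lemma dot_frame_eq (e1 e2 e3 v w : R3) : dot e1 e1 = 1 -> dot e2 e2 = 1 -> dot e1 e2 = 0 ->
  cross e1 e2 = e3 -> dot v e1 = dot w e1 -> dot v e2 = dot w e2 -> dot v e3 = dot w e3 -> v = w.
Proof. intros h1 h2 h12 <-; apply frame_eq; assumption. Qed.

Lemma kappa_period_iff (rad C1 : R) (x : R -> R3) (hx : extremal rad C1 x) (r : R) :
  (forall s, kappa_g rad x (s + r) = kappa_g rad x s) <->
  (forall s, Bfun rad x (s + r) = Bfun rad x s).
Proof.
split; intros h s.
- unfold Bfun. rewrite h; reflexivity.
- rewrite !(kappa_Bfun rad C1 x hx), h; reflexivity.
Qed.

Section Profile.
Context (p q k : R) (H : admissible p q k) (x : R -> R3) (phi : R -> R) (rho : R).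

Let hp : 0 < p := adm_p _ _ _ H.
Let hk : 0 < k := adm_k _ _ _ H.
Let hq : p + k < q := adm_q _ _ _ H.
Let rad : R := p * q * k / 2.
Let C1 : R := mu_of p q k / rad ^ 2.
Let C2 : R := lam_of p q k / rad ^ 2.
Let hrad : 0 < rad := rad_pos p q k H.

Context (hx : extremal rad C1 x) (hC2 : first_integral rad C1 C2 x) (hphi : phase p q k phi rho)
  (hB : forall s, Bfun rad x s = prof p q k (phi s)).

Lemma profile_least_period : least_period (kappa_g rad x) rho.
Proof.
split.
- split; [apply hphi|]. apply (kappa_period_iff rad C1 x hx). intros s.
  rewrite !hB. apply (prof_phase_period p q k phi rho s hphi).
- intros r [hr hper]. apply (prof_phase_least p q k H phi rho r hphi hr).
  intros s. rewrite <- !hB. revert s. apply (kappa_period_iff rad C1 x hx), hper.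
Qed.

Lemma profile_axis_rate : axis_rate rad C1 C2 = (q ^ 2 - p ^ 2) / (2 * rad ^ 2).
Proof.
unfold axis_rate. rewrite <- (sqrt_pow2 ((q ^ 2 - p ^ 2) / (2 * rad ^ 2))).
- f_equal. unfold C1, C2, mu_of, lam_of. field. lra.
- left; apply Rdiv_lt_0_compat; [nra|]. assert (0 < rad ^ 2) by (apply pow_lt; lra). lra.
Qed.

(** By the first integral [B_s^2 + 4 / B] is [(B - B1) (B2 - B) / rad^2], and [axis_rate] carries
    the factor [B2 - B1]; partial fractions then produce the two poles of [angle_density]. *)
Lemma profile_azimuth_speed s :
  azimuth_speed rad C1 C2 x s = - (angle_density p q k (phi s) * speed p q k (phi s)).
Proof.
assert (h1 := prof_pos p q k H (phi s)). assert (h2 := prof_root_pos p q k H (phi s)).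
assert (h3 := prof_gt_lower p q k H (phi s)). assert (h4 := prof_lt_upper p q k H (phi s)).
assert (hpos := dot_axis_pos rad x s).
unfold azimuth_speed. rewrite profile_axis_rate, (hC2 s) in *. rewrite hB in *.
unfold angle_density, speed. fold rad.
set (b := prof p q k (phi s)) in *.
rewrite sqrt_div_alt by lra.
assert (hs1 : 0 < sqrt b) by (apply sqrt_lt_R0; lra).
assert (hs2 : 0 < sqrt (b + k ^ 2)) by (apply sqrt_lt_R0; lra).
assert (hr2 : 0 < rad ^ 2) by (apply pow_lt; lra).
replace (C2 - b ^ 2 / rad ^ 2 - 4 * / b + C1 * b + 4 / b)
  with ((b - (p ^ 2 - k ^ 2)) * (q ^ 2 - k ^ 2 - b) / rad ^ 2)
  by (unfold C1, C2, mu_of, lam_of; field; lra).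
field. repeat split; lra.
Qed.

(** With [Psi] a primitive of [angle_density], the sum of [theta] and [Psi] of the phase is
    constant, and [Psi] grows by [angle p q k] over any turn of the phase. *)
Lemma profile_azimuth_shift e1 e2 e3 theta s : axis_frame rad x e1 e2 e3 -> azimuth x e1 e2 theta ->
  theta (s + rho) = theta s - angle p q k.
Proof.
intros hf ha.
set (Psi := fun y => RInt (angle_density p q k) 0 y).
assert (hPsi : forall y, is_derive Psi y (angle_density p q k y)).
{ intros y. apply (is_derive_RInt (angle_density p q k) Psi 0); [|apply continuous_angle_density, H].
  apply filter_forall. intros u. apply (RInt_correct (V := R_CompleteNormedModule)), ex_RInt_cont.
  intros; apply continuous_angle_density, H. }
assert (hz : forall u, is_derive (fun u => theta u + Psi (phi u)) u 0).
{ intros u. assert (d1 := azimuth_derive rad C1 C2 hrad x hx hC2 e1 e2 e3 theta u hf ha).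
  assert (d2 := phase_derive _ _ _ _ _ hphi u). assert (d3 := hPsi (phi u)).
  rewrite profile_azimuth_speed in d1.
  clearbody Psi. auto_derive; [repeat split; eexists; eassumption|].
  eval_derive d1. eval_derive d2. eval_derive d3. ring. }
assert (E := is_derive_zero_const _ hz s (s + rho)). cbv beta in E.
rewrite (phase_period _ _ _ _ _ hphi) in E.
assert (hper : forall y, Psi (y + 2 * PI) - Psi y = angle p q k).
{ intros y.
  assert (hz' : forall u, is_derive (fun u => Psi (u + 2 * PI) - Psi u) u 0).
  { intros u. assert (d1 := hPsi u). assert (d2 := hPsi (u + 2 * PI)).
    clearbody Psi. auto_derive; [repeat split; eexists; eassumption|].
    eval_derive d1. eval_derive d2.
    replace (angle_density p q k (u + 2 * PI)) with (angle_density p q k u); [ring|].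
    unfold angle_density, prof. replace (cos (u + 2 * PI)) with (cos u); [reflexivity|].
    rewrite <- (cos_period u 1); f_equal; simpl; ring. }
  rewrite (is_derive_zero_const _ hz' y 0). rewrite Rplus_0_l.
  unfold Psi at 2. rewrite RInt_point. unfold Psi, angle, zero; simpl. ring. }
rewrite <- (hper (phi s)). lra.
Qed.

Lemma profile_azimuth_shift_n e1 e2 e3 theta s n : axis_frame rad x e1 e2 e3 -> azimuth x e1 e2 theta ->
  theta (s + INR n * rho) = theta s - INR n * angle p q k.
Proof.
intros hf ha. induction n as [|n IH].
- simpl. rewrite !Rmult_0_l, Rplus_0_r, Rminus_0_r. reflexivity.
- rewrite S_INR. replace (s + (INR n + 1) * rho) with (s + INR n * rho + rho) by ring.
  rewrite (profile_azimuth_shift e1 e2 e3 theta _ hf ha), IH. ring.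
Qed.

Lemma profile_Bfun_shift_n s n : Bfun rad x (s + INR n * rho) = Bfun rad x s.
Proof.
induction n as [|n IH].
- simpl. rewrite Rmult_0_l, Rplus_0_r. reflexivity.
- rewrite S_INR. replace (s + (INR n + 1) * rho) with (s + INR n * rho + rho) by ring.
  rewrite hB, (prof_phase_period p q k phi rho _ hphi), <- hB. exact IH.
Qed.

Lemma angle_pos : 0 < angle p q k.
Proof. generalize (angle_gt_PI p q k H) PI_RGT_0; lra. Qed.

(** Both directions matter for [Lambda]: every curve with these constants has this angle, and the
    angle is attained, so [iota] selects it. *)
Lemma profile_progression_angle a : progression_angle rad x a <-> a = angle p q k.
Proof.
split.
- intros [e1 [e2 [e3 [theta [rho' [hf [ha [hl hs]]]]]]]].
  assert (er : rho' = rho).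
  { destruct profile_least_period as [b1 b2]. destruct hl as [c1 c2]. apply Rle_antisym; auto. }
  subst rho'. rewrite (hs 0), (profile_azimuth_shift e1 e2 e3 theta 0 hf ha).
  replace (theta 0 - angle p q k - theta 0) with (- angle p q k) by ring.
  rewrite Rabs_Ropp. apply Rabs_pos_eq. left; apply angle_pos.
- intros ->. destruct (exists_azimuth rad C1 C2 hrad x hx hC2) as [e1 [e2 [e3 [theta [hf [ha _]]]]]].
  exists e1, e2, e3, theta, rho. split; [assumption|]. split; [assumption|].
  split; [apply profile_least_period|]. intros s.
  rewrite (profile_azimuth_shift e1 e2 e3 theta s hf ha).
  replace (theta s - angle p q k - theta s) with (- angle p q k) by ring.
  rewrite Rabs_Ropp. symmetry; apply Rabs_pos_eq. left; apply angle_pos.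
Qed.

Lemma profile_height e1 e2 e3 s t : axis_frame rad x e1 e2 e3 ->
  Bfun rad x s = Bfun rad x t -> dot (x s) e3 = dot (x t) e3.
Proof.
intros hf hb. destruct (axis_frame_rotation rad C1 C2 hrad x hx hC2 e1 e2 e3 hf) as [hc hrot].
destruct (hrot s) as [a1 _]. destruct (hrot t) as [b1 _]. rewrite hb, <- b1 in a1. nra.
Qed.

(** The period [L] contains a whole number [j] of curvature periods, during which the azimuth
    changes by [n] full turns. Division of both by their gcd gives the coprime pair, and it remains
    to see that the curve closes at the shorter length. *)
Lemma profile_closed (L : R) : 0 < L -> (forall s, x (s + L) = x s) ->
  exists pp qq : nat, is_x_pq rad x pp qq /\ INR pp / INR qq = angle p q k / (2 * PI).
Proof.
intros hL hclosed.
assert (hpi := PI_RGT_0). assert (hap := angle_pos).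
(* The component of [x] along the axis is affine in [Bfun], so [Bfun] inherits the period [L]. *)
assert (hBL : forall s, Bfun rad x (s + L) = Bfun rad x s).
{ destruct (exists_rotation_vector rad C1 hrad x hx) as [w hw]. intros s.
  destruct (hw s) as [a1 _]. destruct (hw (s + L)) as [b1 _]. rewrite hclosed, a1 in b1.
  assert (E : C1 / 2 - Bfun rad x s / rad ^ 2 = C1 / 2 - Bfun rad x (s + L) / rad ^ 2)
    by (apply Rmult_eq_reg_l with rad; lra).
  assert (hr2 : 0 < rad ^ 2) by (apply pow_lt; lra).
  apply Rmult_eq_reg_r with (/ rad ^ 2); [unfold Rdiv in E; lra|apply Rgt_not_eq, Rinv_0_lt_compat; lra]. }
destruct profile_least_period as [[hrho _] hleast].
assert (hmin : forall r, 0 < r -> (forall s, Bfun rad x (s + r) = Bfun rad x s) -> rho <= r).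
{ intros r hr h. apply hleast. split; [assumption|]. apply (kappa_period_iff rad C1 x hx), h. }
destruct (nfloor_ex (L / rho)) as [j hj].
{ left; apply Rdiv_lt_0_compat; lra. }
assert (hLj : INR j * rho <= L < INR j * rho + rho).
{ assert (e : L / rho * rho = L) by (field; lra). split; nra. }
(* A positive remainder [L - INR j * rho] would be a period smaller than the least one. *)
assert (eL : L = INR j * rho).
{ destruct (Rle_lt_or_eq_dec _ _ (proj1 hLj)) as [h|h]; [|symmetry; exact h].
  exfalso. assert (hm := hmin (L - INR j * rho) ltac:(lra)).
  assert (rho <= L - INR j * rho); [|lra]. apply hm. intros s.
  rewrite <- (profile_Bfun_shift_n (s + (L - INR j * rho)) j).
  replace (s + (L - INR j * rho) + INR j * rho) with (s + L) by ring. apply hBL. }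
assert (hj0 : j <> 0%nat) by (intros ->; simpl in eL; lra).
assert (hjp : 0 < INR j) by (apply lt_0_INR; lia).
destruct (exists_azimuth rad C1 C2 hrad x hx hC2) as [e1 [e2 [e3 [theta [hf [ha hpol]]]]]].
destruct (cos_eq_1_multiple (INR j * angle p q k)) as [n hn].
{ apply Rmult_le_pos; lra. }
{ destruct (hpol 0) as [c0 s0]. destruct (hpol (0 + L)) as [cL sL]. rewrite hclosed in cL, sL.
  destruct (ha) as [_ ha2]. destruct (ha2 0) as [r [hr [u0 v0]]].
  assert (hrr : 0 < sqrt (dot (x 0) e1 ^ 2 + dot (x 0) e2 ^ 2)).
  { apply sqrt_lt_R0. rewrite u0, v0. assert (hsc := sin2_cos2_pow (theta 0)).
    replace ((r * cos (theta 0)) ^ 2 + (r * sin (theta 0)) ^ 2)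
      with (r ^ 2 * (sin (theta 0) ^ 2 + cos (theta 0) ^ 2)) by ring. rewrite hsc.
    assert (0 < r ^ 2) by (apply pow_lt; lra). lra. }
  set (rr := sqrt _) in *.
  assert (ec : cos (theta (0 + L)) = cos (theta 0)) by (apply Rmult_eq_reg_l with rr; lra).
  assert (es : sin (theta (0 + L)) = sin (theta 0)) by (apply Rmult_eq_reg_l with rr; lra).
  rewrite eL in ec, es.
  assert (et := profile_azimuth_shift_n e1 e2 e3 theta 0 j hf ha).
  replace (INR j * angle p q k) with (theta 0 - theta (0 + INR j * rho)) by lra.
  rewrite cos_minus, ec, es. assert (hsc := sin2_cos2_pow (theta 0)). lra. }
assert (hn0 : n <> 0%nat).
{ intros ->. simpl in hn. assert (0 < INR j * angle p q k) by (apply Rmult_lt_0_compat; lra). lra. }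
set (g := Nat.gcd n j).
assert (hg : g <> 0%nat) by (intros E; apply Nat.gcd_eq_0_l in E; lia).
destruct (Nat.gcd_divide_l n j) as [n' hn']. destruct (Nat.gcd_divide_r n j) as [j' hj']. fold g in hn', hj'.
assert (hgr : 0 < INR g) by (apply lt_0_INR; lia).
assert (en' : (n / g)%nat = n') by (rewrite hn'; apply Nat.div_mul; assumption).
assert (ej' : (j / g)%nat = j') by (rewrite hj'; apply Nat.div_mul; assumption).
assert (hgcd := Nat.gcd_div_gcd n j g hg eq_refl). rewrite en', ej' in hgcd.
assert (hj'0 : (0 < j')%nat) by (destruct j'; [simpl in hj'; lia|lia]).
assert (hn'0 : (0 < n')%nat) by (destruct n'; [simpl in hn'; lia|lia]).
assert (hjr : 0 < INR j') by (apply lt_0_INR; assumption).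
assert (heq : INR j' * angle p q k = 2 * PI * INR n').
{ rewrite hn', hj', !mult_INR in hn. apply Rmult_eq_reg_r with (INR g); lra. }
exists n', j'. split.
- split; [assumption|]. split; [assumption|]. split; [assumption|].
  exists rho, (angle p q k). split; [apply profile_least_period|].
  split; [apply profile_progression_angle; reflexivity|]. split; [|assumption].
  intros s.
  (* After [j'] curvature periods the height and the distance to the axis return with [Bfun], and
     the azimuth has changed by [2 * PI * INR n'], so all three frame coordinates agree. *)
  assert (h3 : dot (x (s + INR j' * rho)) e3 = dot (x s) e3)
    by (apply (profile_height e1 e2 e3); [assumption|apply profile_Bfun_shift_n]).
  destruct hf as [f1 [f2 [f12 [f3 fc]]]].
  assert (P1 := frame_parseval e1 e2 (x s) (x s) f1 f2 f12).
  assert (P2 := frame_parseval e1 e2 (x (s + INR j' * rho)) (x (s + INR j' * rho)) f1 f2 f12).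
  rewrite f3, (sc_on_sphere _ _ (ext_curve _ _ _ hx)) in P1, P2. rewrite h3 in P2.
  assert (er : dot (x (s + INR j' * rho)) e1 ^ 2 + dot (x (s + INR j' * rho)) e2 ^ 2
    = dot (x s) e1 ^ 2 + dot (x s) e2 ^ 2) by nra.
  destruct (hpol s) as [c0 s0]. destruct (hpol (s + INR j' * rho)) as [cL sL].
  rewrite er in cL, sL.
  rewrite (profile_azimuth_shift_n e1 e2 e3 theta s j' (conj f1 (conj f2 (conj f12 (conj f3 fc)))) ha), heq in cL, sL.
  assert (et : theta s = theta s - 2 * PI * INR n' + 2 * INR n' * PI) by ring.
  rewrite et, cos_period in c0. rewrite et, sin_period in s0.
  apply (dot_frame_eq e1 e2 e3); try assumption; congruence.
- apply Rmult_eq_reg_r with (INR j' * (2 * PI)).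
  + replace (INR n' / INR j' * (INR j' * (2 * PI))) with (2 * PI * INR n') by (field; lra).
    rewrite <- heq. field; lra.
  + apply Rgt_not_eq, Rmult_lt_0_compat; lra.
Qed.

End Profile.

(** * Limit of the progression angle and classification of closed curves *)

Lemma profile_of_extremal (p q k : R) (x : R -> R3) : admissible p q k ->
  extremal (p * q * k / 2) (mu_of p q k / (p * q * k / 2) ^ 2) x ->
  first_integral (p * q * k / 2) (mu_of p q k / (p * q * k / 2) ^ 2) (lam_of p q k / (p * q * k / 2) ^ 2) x ->
  exists phi rho, phase p q k phi rho /\ forall s, Bfun (p * q * k / 2) x s = prof p q k (phi s).
Proof.
intros H hx hC2.
apply (profile_solution p q k H (Bfun (p * q * k / 2) x) (Derive (Bfun (p * q * k / 2) x))).
- apply Bfun_pos.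
- intros s. eapply Bfun_is_derive, hx.
- intros s. apply (Bfun_is_derive2 _ _ _ hx).
- exact hC2.
Qed.

Lemma Lambda_admissible (p q k : R) : admissible p q k ->
  Lambda (p * q * k / 2) (mu_of p q k / (p * q * k / 2) ^ 2) (lam_of p q k) = angle p q k.
Proof.
intros H. unfold Lambda. apply (iota_unique (V := R_CompleteNormedModule)).
- intros a [x [hx [hC2 ha]]].
  destruct (profile_of_extremal p q k x H hx hC2) as [phi [rho [hphi hB]]].
  apply (profile_progression_angle p q k H x phi rho hx hC2 hphi hB), ha.
- destruct (exists_phase p q k H) as [phi0 [rho0 hphi0]].
  destruct (exists_extremal p q k H phi0 rho0 hphi0) as [x [hx hC2]].
  exists x. split; [assumption|]. split; [assumption|].
  destruct (profile_of_extremal p q k x H hx hC2) as [phi [rho [hphi hB]]].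
  apply (profile_progression_angle p q k H x phi rho hx hC2 hphi hB). reflexivity.
Qed.

(** A squeeze: [angle_lt_limit] bounds the angle above for every [lam] beyond D, [angle_near_limit]
    bounds it below once [k ^ 2] is close to its value at D. *)
Lemma Lambda_limit (rad C1 : R) : 0 < rad ->
  filterlim (Lambda rad C1) (at_right (Dvalue rad C1)) (locally (limit_angle rad C1)).
Proof.
intros hr.
destruct (exists_double_root (4 * rad ^ 2) (rad ^ 2 * C1)) as [b [hb eb]]; [nra|].
rewrite (Dvalue_double_root rad C1 b hr hb eb), (limit_angle_double_root rad C1 b hr hb eb).
set (D := - b ^ 2 + 8 * rad ^ 2 / b). set (l := 2 * PI * sqrt _).
apply (filterlim_locally (F := at_right D)). intros eps.
destruct (angle_near_limit rad (rad ^ 2 * C1) b hr hb eb eps) as [delta hdelta].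
(* The factor [2 * b] undoes the denominator in the estimate of [k ^ 2] from [exists_admissible]. *)
assert (hd : 0 < 2 * b * delta) by (apply Rmult_lt_0_compat; [lra|apply cond_pos]).
exists (mkposreal _ hd). intros lam hball hlam. 
assert (hlam' : lam < D + 2 * b * delta).
{ apply Rabs_def2 in hball. unfold minus, plus, opp in hball; simpl in hball. lra. }
destruct (exists_admissible rad (rad ^ 2 * C1) b lam hr hb eb hlam) as [p [q [k [H [e1 [e2 [e3 hk]]]]]]].
fold D in hk.
assert (hlow : l - eps < angle p q k).
{ apply hdelta; try assumption. rewrite Rabs_pos_eq by lra.
  apply Rle_lt_trans with (1 := proj2 hk). apply Rmult_lt_reg_r with (2 * b); [lra|].
  unfold Rdiv. rewrite Rmult_assoc, Rinv_l by lra. lra. }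
assert (hup : angle p q k < l).
{ unfold l. replace (4 * rad ^ 2) with ((p * q * k) ^ 2) in * by (rewrite <- e1; field).
  replace (rad ^ 2) with ((p * q * k) ^ 2 / 4) by (rewrite <- e1; field).
  apply (angle_lt_limit p q k H b hb). rewrite <- eb. symmetry; exact e2. }
assert (eL : Lambda rad C1 lam = angle p q k).
{ rewrite <- (Lambda_admissible p q k H). rewrite e1. f_equal; [|symmetry; exact e3].
  unfold mu_of. rewrite e2. field. lra. }
rewrite eL. change (Rabs (angle p q k - l) < eps). apply Rabs_def1; lra.
Qed.

(** Since [b] is a double root at D, [rad^2 B_s^2 = (lam - D) - (B - b)^2 (B + 4 rad^2 / b^2) / B].
    For [lam <= D] this forces [B_s = 0]. *)
Lemma nonconstant_energy (rad C1 C2 b : R) (x : R -> R3) : 0 < rad -> 0 < b ->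
  rad ^ 2 * C1 = 2 * b - 4 * rad ^ 2 / b ^ 2 ->
  extremal rad C1 x -> first_integral rad C1 C2 x -> nonconstant (kappa_g rad x) ->
  - b ^ 2 + 8 * rad ^ 2 / b < rad ^ 2 * C2.
Proof.
intros hr hb eb hx hC2 hnc.
apply Rnot_le_lt; intros hle.
assert (hz : forall s, Derive (Bfun rad x) s = 0).
{ intros s. assert (hp := Bfun_pos rad x s). assert (h := hC2 s).
  set (y := Bfun rad x s) in *. set (dy := Derive (Bfun rad x) s) in *.
  assert (hr2 : 0 < rad ^ 2) by (apply pow_lt; lra).
  assert (E : rad ^ 2 * dy ^ 2 = rad ^ 2 * C2 - (- b ^ 2 + 8 * rad ^ 2 / b)
     - (y - b) ^ 2 * (y + 4 * rad ^ 2 / b ^ 2) / y).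
  { rewrite h.
    replace (rad ^ 2 * (C2 - y ^ 2 / rad ^ 2 - 4 * / y + C1 * y))
      with (rad ^ 2 * C2 - y ^ 2 - 4 * rad ^ 2 / y + (rad ^ 2 * C1) * y) by (field; lra).
    rewrite eb. field; lra. }
  assert (0 <= (y - b) ^ 2 * (y + 4 * rad ^ 2 / b ^ 2) / y).
  { assert (0 < 4 * rad ^ 2 / b ^ 2) by (apply Rdiv_lt_0_compat; [lra|apply pow_lt; lra]).
    apply Rmult_le_pos; [apply Rmult_le_pos; [apply pow2_ge_0|lra]|left; apply Rinv_0_lt_compat; lra]. }
  assert (0 <= dy ^ 2) by apply pow2_ge_0.
  assert (dy ^ 2 = 0) by nra. nra. }
destruct hnc as [s [t hst]]. apply hst.
rewrite !(kappa_Bfun rad C1 x hx).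
rewrite (is_derive_zero_const (Bfun rad x)) with (b := t); [reflexivity|].
intros u. rewrite <- (hz u). apply (Bfun_is_derive rad C1 x hx).
Qed.

(** Constant [B] fixes the height and the azimuth speed. The latter is nonzero, so the azimuth is a
    nonconstant affine function of arc length and takes every value; hence the whole circle is
    covered. *)
Lemma constant_planar_circle (rad C1 : R) (x : R -> R3) : 0 < rad -> extremal rad C1 x ->
  ~ nonconstant (kappa_g rad x) -> planar_circle rad x.
Proof.
intros hr hx hnc.
destruct (exists_first_integral rad C1 hr x hx) as [C2 hC2].
assert (hB : forall s, Bfun rad x s = Bfun rad x 0).
{ intros s. unfold Bfun. f_equal. destruct (Req_dec (kappa_g rad x s) (kappa_g rad x 0)) as [e|e]; [exact e|].
  exfalso; apply hnc. exists s, 0; exact e. }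
destruct (exists_azimuth rad C1 C2 hr x hx hC2) as [e1 [e2 [e3 [theta [hf [ha hpol]]]]]].
destruct (axis_frame_rotation rad C1 C2 hr x hx hC2 e1 e2 e3 hf) as [hc hrot].
assert (hh : forall s, dot (x s) e3 = dot (x 0) e3).
{ intros s. destruct (hrot s) as [a1 _]. destruct (hrot 0) as [b1 _]. rewrite hB, <- b1 in a1. nra. }
set (h := dot (x 0) e3) in *.
assert (hf' := hf). destruct hf' as [f1 [f2 [f12 [f3 _]]]].
assert (hR : forall s, dot (x s) e1 ^ 2 + dot (x s) e2 ^ 2 = rad ^ 2 - h ^ 2).
{ intros s. assert (P := frame_parseval e1 e2 (x s) (x s) f1 f2 f12).
  rewrite f3, (sc_on_sphere _ _ (ext_curve _ _ _ hx)), hh in P. lra. }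
assert (hpos : 0 < rad ^ 2 - h ^ 2).
{ destruct (frame_polar rad C1 C2 hr x hx hC2 e1 e2 e3 0 hf) as [P _].
  assert (hp := dot_axis_pos rad x 0). rewrite <- P, hR in hp.
  assert (0 < axis_rate rad C1 C2 ^ 2) by (apply pow_lt; lra). nra. }
set (r := sqrt (rad ^ 2 - h ^ 2)).
assert (hr0 : 0 < r) by (apply sqrt_lt_R0; assumption).
assert (hr2 : r ^ 2 = rad ^ 2 - h ^ 2) by (apply pow2_sqrt; lra).
set (W := azimuth_speed rad C1 C2 x 0).
assert (hdB : forall s, Derive (Bfun rad x) s = 0).
{ intros s. rewrite (Derive_ext _ (fun _ => Bfun rad x 0)) by exact hB. apply Derive_const. }
assert (hW : forall s, azimuth_speed rad C1 C2 x s = W).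
{ intros s. unfold W, azimuth_speed. rewrite hB, !hdB. reflexivity. }
assert (hW0 : W <> 0).
{ unfold W, azimuth_speed. assert (hp := dot_axis_pos rad x 0). assert (hb := Bfun_pos rad x 0).
  assert (hs : 0 < sqrt (Bfun rad x 0)) by (apply sqrt_lt_R0; assumption).
  apply Rmult_integral_contrapositive_currified; [lra|].
  apply Rinv_neq_0_compat, Rgt_not_eq, Rmult_lt_0_compat; assumption. }
assert (hth : forall s, theta s = theta 0 + W * s).
{ intros s. assert (hz : forall u, is_derive (fun u => theta u - W * u) u 0).
  { intros u. assert (d := azimuth_derive rad C1 C2 hr x hx hC2 e1 e2 e3 theta u hf ha). rewrite hW in d.
    auto_derive; [eexists; eassumption|]. eval_derive d. ring. }
  assert (E := is_derive_zero_const _ hz s 0). cbv beta in E. lra. }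
exists e3, h. split.
{ rewrite <- f3, lagrange, f1, f2, f12. ring. }
split.
{ apply Rabs_def1; nra. }
intros y. split.
- intros [s <-]. split; [apply (ext_curve _ _ _ hx)|]. rewrite dot_comm; apply hh.
- intros [y1 y2]. rewrite dot_comm in y2.
  assert (P := frame_parseval e1 e2 y y f1 f2 f12). rewrite f3, y1, y2 in P.
  destruct (exists_polar_angle (dot y e1) (dot y e2) r hr0) as [al [a1 a2]]; [lra|].
  exists ((al - theta 0) / W).
  assert (et : theta ((al - theta 0) / W) = al) by (rewrite hth; field; exact hW0).
  destruct (hpol ((al - theta 0) / W)) as [p1 p2]. rewrite hR, et in p1, p2. fold r in p1, p2.
  apply (dot_frame_eq e1 e2 e3); try assumption.
  + rewrite p1, a1; reflexivity.
  + rewrite p2, a2; reflexivity.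
  + rewrite hh, y2; reflexivity.
Qed.

Theorem theorem5p12 (rad C1 : R) (x : R -> R3)
    (hrad : 0 < rad) (hx : extremal rad C1 x) (hclosed : closed_curve x) :
  (planar_circle rad x
   \/
   (nonconstant (kappa_g rad x) /\
    exists p q : nat,
      is_x_pq rad x p q /\
      1 / 2 < INR p / INR q < / (2 * PI) * limit_angle rad C1))
  /\
  filterlim (Lambda rad C1) (at_right (Dvalue rad C1))
    (locally (limit_angle rad C1)).
Proof.
split; [|apply Lambda_limit; assumption].
destruct (classic (nonconstant (kappa_g rad x))) as [hnc|hnc].
2:{ left. apply (constant_planar_circle rad C1); assumption. }
right. split; [assumption|].
assert (hpi := PI_RGT_0).
destruct (exists_double_root (4 * rad ^ 2) (rad ^ 2 * C1)) as [b [hb eb]]; [nra|].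
rewrite (limit_angle_double_root rad C1 b hrad hb eb).
destruct (exists_first_integral rad C1 hrad x hx) as [C2 hC2].
assert (hlam := nonconstant_energy rad C1 C2 b x hrad hb eb hx hC2 hnc).
destruct (exists_admissible rad (rad ^ 2 * C1) b (rad ^ 2 * C2) hrad hb eb hlam)
  as [p [q [k [H [er [em [el _]]]]]]].
assert (hup : angle p q k < 2 * PI * sqrt ((b ^ 3 + rad ^ 2) / (b ^ 3 + 4 * rad ^ 2))).
{ replace (4 * rad ^ 2) with ((p * q * k) ^ 2) in * by (rewrite <- er; field).
  replace (rad ^ 2) with ((p * q * k) ^ 2 / 4) by (rewrite <- er; field).
  apply (angle_lt_limit p q k H b hb). rewrite <- eb. symmetry; exact em. }
set (l := 2 * PI * sqrt _) in *.
(* All constants are now functions of [p], [q], [k], and substituting them gives the form in which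
   the results on profiles are stated. *)
assert (e1 : C1 = mu_of p q k / (p * q * k / 2) ^ 2) by (unfold mu_of; rewrite em, er; field; lra).
assert (e2 : C2 = lam_of p q k / (p * q * k / 2) ^ 2) by (unfold lam_of; rewrite el, er; field; lra).
clearbody l. clear eb em el hlam hb. subst rad. subst C1 C2.
destruct (profile_of_extremal p q k x H hx hC2) as [phi [rho [hphi hB]]].
destruct hclosed as [L [hL hper]].
destruct (profile_closed p q k H x phi rho hx hC2 hphi hB L hL hper) as [pp [qq [hpq e]]].
exists pp, qq. split; [assumption|]. rewrite e.
assert (hlow := angle_gt_PI p q k H).
split.
- apply Rmult_lt_reg_r with (2 * PI); [lra|]. unfold Rdiv. rewrite !Rmult_assoc, Rinv_l; lra.
- unfold Rdiv. rewrite (Rmult_comm (/ (2 * PI))). apply Rmult_lt_compat_r; [apply Rinv_0_lt_compat; lra|assumption].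
Qed.
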